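(* There is a function $f$ such that for all integers $\gamma,k\geq 0$, every $(\gamma,k)$-apex graph with girth at least $9$ is $2$-colourable with clustering at most $f(\gamma,k)$.
   Context: Graphs are finite, simple and undirected. The Euler genus of a surface (compact 2-dimensional manifold) with $h$ handles and $c$ cross-caps is $2h+c$; the Euler genus of a graph is the minimum Euler genus of a surface in which it embeds without crossings. For integers $\gamma,k\geq 0$, a graph $G$ is $(\gamma,k)$-apex if there exists $A\subseteq V(G)$ with $|A|\leq k$ such that $G-A$ has Euler genus at most $\gamma$. The girth of a graph is the length of its shortest cycle (infinite for a forest). A $2$-colouring assigns one of at most two colours to each vertex (not necessarily properly). A monochromatic component is a connected component of the subgraph induced by all vertices of a single colour. A colouring has clustering $c$ if every monochromatic component has at most $c$ vertices. *)

(* Defs.v *)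
(* MathComp / MathComp-Analysis *)
From HB Require Import structures.
From Stdlib Require Import Relation_Operators.
From mathcomp Require Import all_boot all_order all_algebra.
From mathcomp Require Import all_classical all_reals all_analysis.

Set Implicit Arguments.
Unset Strict Implicit.
Unset Printing Implicit Defensive.

Import Order.TTheory GRing.Theory Num.Theory.
Import numFieldNormedType.Exports.

Local Open Scope classical_set_scope.
Local Open Scope ring_scope.

(* The closed surface with h handles and c cross-caps.  The sphere is the
   one-point compactification of the plane.  Remove from it the open unit discs
   centred at (3i, 0) for i < 2h + c.
   - Handles: for j < h, the boundary circles 2j and 2j+1 are glued along the
     reflection in the vertical line half-way between them.  A reflection
     reverses orientation, so this is the same as attaching a tube to the two
     holes in the orientable way.
   - Cross-caps: each of the remaining c circles is glued to itself by
     identifying antipodal points. *)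
Section Surface.
Variables (R : realType) (h c : nat).

Definition sqdist_centre (i : nat) (p : R * R) : R :=
  (p.1 - (3 * i)%:R) ^+ 2 + p.2 ^+ 2.

Definition holed_sphere : set (one_point_compactification (R * R)%type) :=
  [set z | forall p : R * R, z = Some p ->
             forall i : nat, (i < 2 * h + c)%N -> 1 <= sqdist_centre i p].

Definition on_circle (i : nat) (p : R * R) : Prop := sqdist_centre i p = 1.

Definition glued (p q : R * R) : Prop :=
  (exists2 j : nat, (j < h)%N &
     [/\ on_circle (2 * j) p, on_circle (2 * j).+1 q
       & q = ((3 * (4 * j).+1)%:R - p.1, p.2)])
  \/
  (exists2 j : nat, (j < c)%N &
     on_circle (2 * h + j) p /\ q = ((6 * (2 * h + j))%:R - p.1, - p.2)).

Definition glued_points (x y : set_type holed_sphere) : Prop :=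
  exists p q : R * R,
    [/\ set_val x = Some p, set_val y = Some q & glued p q].

Definition glue_equiv (x y : set_type holed_sphere) : bool :=
  `[< clos_refl_sym_trans _ glued_points x y >].

Lemma glue_equiv_is_equiv : equiv_class_of glue_equiv.
Proof.
split=> [x|x y|y x z].
- by apply/asboolP; exact: rst_refl.
- by apply/asboolP/asboolP; exact: rst_sym.
- by move=> /asboolP xy /asboolP yz; apply/asboolP; exact: rst_trans xy yz.
Qed.

Canonical glue_equiv_rel := EquivRelPack glue_equiv_is_equiv.

Definition surface : topologicalType :=
  quotient_topology {eq_quot glue_equiv_rel}%qT.

End Surface.

(* Throughout, a finite simple graph is a symmetric irreflexive relation e on
   a finType.  An edge uv has a simple arc in each direction, one being the
   reverse of the other. *)
Definition embeds_in (R : realType) (T : finType) (e : rel T)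
    (S : topologicalType) : Prop :=
  exists (pos : T -> S) (arc : T -> T -> R -> S),
  [/\ injective pos,
      forall u v, e u v ->
        [/\ {within `[0, 1], continuous (arc u v)},
            {in `[0, 1] &, injective (arc u v)},
            arc u v 0 = pos u & arc u v 1 = pos v],
      forall u v, e u v -> {in `[0, 1], forall t, arc v u t = arc u v (1 - t)},
      forall u v w, e u v -> {in `]0, 1[, forall t, arc u v t <> pos w}
    & forall u v x y, e u v -> e x y -> (u, v) <> (x, y) -> (u, v) <> (y, x) ->
        {in `]0, 1[ &, forall s t, arc u v s <> arc x y t}].

Definition embeds_in_euler_genus (R : realType) (T : finType) (e : rel T)
    (g : nat) : Prop :=
  exists h c : nat, (2 * h + c)%N = g /\ embeds_in R e (surface R h c).

Definition is_euler_genus (R : realType) (T : finType) (e : rel T)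
    (g : nat) : Prop :=
  embeds_in_euler_genus R e g /\
  forall g', embeds_in_euler_genus R e g' -> (g <= g')%N.

Definition induced (T : finType) (e : rel T) (P : pred T) : rel {x : T | P x} :=
  fun x y => e (val x) (val y).
Arguments induced {T} e P.

Definition apex_graph (R : realType) (gamma k : nat) (T : finType)
    (e : rel T) : Prop :=
  exists A : {set T}, (#|A| <= k)%N /\
    exists g, is_euler_genus R (induced e (fun x => x \notin A)) g /\
              (g <= gamma)%N.

(* Cycles have length at least 3: ucycle also accepts the two traversals of a
   single edge and the empty sequence. *)
Definition girth_at_least (g : nat) (T : finType) (e : rel T) : Prop :=
  forall s : seq T, ucycle e s -> (3 <= size s)%N -> (g <= size s)%N.

Definition has_clustering (q b : nat) (T : finType) (e : rel T)
    (col : T -> 'I_q) : Prop :=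
  forall (i : 'I_q) (x : {v : T | col v == i}),
    (#|connect (induced e (fun v => col v == i)) x| <= b)%N.

Definition colourable_with_clustering (q b : nat) (T : finType)
    (e : rel T) : Prop :=
  exists col : T -> 'I_q, has_clustering b e col.

(* Main.v *)
(* Let A be the apex set.  Colour A with one colour and force the other colour on
   the neighbours of A, except on the at most |A|^2 of them that are within
   distance 2 of another one outside A.  The rest is coloured by removing one
   bounded island after another: an island is a set of vertices having at most
   one neighbour outside (none for forced vertices), so that its colours can be
   chosen different from the colours around it.

   Islands exist because G - A is sparse: 9 (m - n) <= 2 m up to a constant
   depending on the surface, by Euler's inequality for graphs of girth 9, and
   balls of radius 1 around forced vertices are disjoint.

   Euler's inequality is proved homologically, without the Jordan curve theorem.
   By compactness a graph embedded in the surface is a minor of a fine grid on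
   it: take the grid vertices near the first thirds of the arcs at a vertex, and
   join them by those near the middle thirds.  In the grid every edge lies on at
   most two cells and the first homology mod 2 has bounded rank, so up to
   bounded codimension the cycles of the minor bound unions of faces.  A face
   whose boundary is a nonzero cycle has at least 9 boundary edges, and every
   edge is on at most two faces. *)
From HB Require Import structures.
Require Import Defs.
From mathcomp Require Import all_boot all_order all_algebra.
From mathcomp Require Import all_classical all_reals all_analysis.
From mathcomp Require Import zify ring lra.
From Stdlib Require Import Relation_Operators.

Set Implicit Arguments.
Unset Strict Implicit.
Unset Printing Implicit Defensive.

Import Order.TTheory GRing.Theory Num.Theory.
Import numFieldNormedType.Exports.

(** * Faces and edges of a minor of a cell complex *)

(** Arcs of an embedding are merely continuous, so the regions that they cut out of the surface are
    hard to control and are not counted directly. In the grid everything is finite, but the grid is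
    full of 4-cycles; the girth hypothesis has to be applied to the graph itself. This is why edges
    of the minor are lifted to chains of the grid, and why the boundary of a face is read back as a
    sum of edges of the minor.

    Girth 9 enters twice. Average degree 18/7 together with about one mark for every three vertices
    keeps the average of degree plus mark below 3, the threshold under which islands must exist;
    girth 8 would only give 8/3 + 1/3 = 3. Moreover, two neighbours of one apex vertex that are both
    within distance 2 of neighbours of the same apex vertex close a cycle of length at most 8, which
    bounds the number of exceptions. *)

Section EvenSubgraph.
Variables (T : finType) (e : rel T).

(** A path is extended at its front to a neighbour other than the one it came from; on a finite type
    it must run into itself. *)
Lemma long_path_cycle (f : rel T) :
  symmetric f -> irreflexive f ->
  (forall x y, f x y -> exists2 w, w != y & f x w) ->
  (exists x y, f x y) -> exists s, ucycle f s /\ 3 <= size s.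
Proof.
move=> fsym firr deg2 [x0 [y0 xy0]].
(* [n] bounds the number of extensions still possible, since a simple path has at most [#|T|]
   vertices. *)
suff H (n : nat) : forall x y p, path f x (y :: p) -> uniq (x :: y :: p) ->
    #|T| < size p + n -> exists s, ucycle f s /\ 3 <= size s.
  apply: (H #|T|.+1 x0 y0 [::]); rewrite /= ?xy0 ?inE ?andbT //.
  by apply: contraTneq xy0 => ->; rewrite firr.
elim: n => [|n IH] x y p xp up sz.
  have : size [:: x, y & p] <= #|T| by rewrite -(card_uniqP up) max_card.
  rewrite /= => H; move: sz; rewrite addn0 ltnNge (leq_trans _ H) //; lia.
have xy : f x y by case/andP: xp.
have [w wy xw] := deg2 x y xy.
have [wp|wp] := boolP (w \in x :: y :: p); last first.
  apply: (IH w x (y :: p)).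
  - by rewrite /= -/(path f x (y :: p)) fsym xw.
  - by rewrite cons_uniq wp.
  - by rewrite /= addSnnS.
move: wp; rewrite !inE (negbTE wy) /= => /orP[/eqP wx|wp].
  by rewrite wx firr in xw.
case/splitPr: wp xp up sz => p1 p2 xp up sz.
exists (x :: y :: rcons p1 w); split; last by rewrite /= size_rcons.
rewrite /ucycle; apply/andP; split.
  rewrite /= rcons_path last_rcons (fsym w) xw andbT xy /=.
  by move: xp; rewrite /= cat_path /= rcons_path => /and4P[_ -> -> _].
by move: up; rewrite -cat_rcons -!cat_cons cat_uniq => /andP[].
Qed.

(** [S] holds one orientation of each edge of [f]. A cycle of [f] has at least [g] vertices, each of
    degree at least 2, so the degree sum [2 * #|S|] is at least [2 * g]. *)
Lemma even_subgraph_size (g : nat) (S : {set T * T}) :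
  symmetric e -> irreflexive e -> girth_at_least g e ->
  (forall p, p \in S -> e p.1 p.2) ->
  (forall x y, (x, y) \in S -> (y, x) \notin S) ->
  let f x y := ((x, y) \in S) || ((y, x) \in S) in
  (forall x y, f x y -> exists2 w, w != y & f x w) ->
  S != finset.set0 -> g <= #|S|.
Proof.
move=> esym eirr girth Se asym f deg2 /set0Pn[[x0 y0] xyS].
have fe x y : f x y -> e x y by move=> /orP[/Se //|/Se /=]; rewrite esym.
have fsym : symmetric f by move=> x y; rewrite /f orbC.
have firr : irreflexive f.
  by move=> x; apply: contraFF (eirr x) => /fe.
have [|s [sc s3]] := long_path_cycle fsym firr deg2.
  by exists x0, y0; rewrite /f xyS.
have /girth : ucycle e s.
  case/andP: sc => sc su; rewrite /ucycle su andbT.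
  by case: (s) sc => //= a p; apply: sub_path => ? ?; exact: fe.
move=> /(_ s3) sg; case/andP: sc => sc su.
have deg x : x \in s -> 2 <= #|[set y | f x y]|.
  move=> xs; have [w xw] : exists w, f x w.
    by exists (next s x); apply: next_cycle.
  have [w' ww' xw'] := deg2 _ _ xw; apply/card_gt1P.
  by exists w', w; rewrite !inE.
have cardE : #|[set p : T * T | f p.1 p.2]| = #|S| + #|S|.
  have -> : [set p : T * T | f p.1 p.2] = S :|: [set (p.2, p.1) | p in S].
    apply/finset.setP => -[x y]; rewrite !inE /f /=; congr (_ || _).
    apply/idP/imsetP => [yxS|[[a b] abS [-> ->]] //].
    by exists (y, x).
  rewrite cardsU card_imset; last by move=> [? ?] [? ?] /= [-> ->].
  rewrite (_ : S :&: _ = finset.set0) ?cards0 ?subn0 //.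
  apply/finset.setP => -[x y]; rewrite !inE; apply/negP => /andP[xyS' /imsetP[[a b] abS [xb ya]]].
  by have := asym _ _ xyS'; rewrite xb ya abS.
have : \sum_(x in s) 2 <= #|[set p : T * T | f p.1 p.2]|.
  rewrite (_ : #|[set p : T * T | f p.1 p.2]| = \sum_x #|[set y | f x y]|); last first.
    rewrite -sum1_card (eq_bigl (fun p => true && f p.1 p.2)); last by move=> p; rewrite inE.
    rewrite -(pair_big_dep xpredT f (fun _ _ => 1%N)) /=; apply: eq_bigr => x _.
    by rewrite -sum1_card; apply: eq_bigl => y; rewrite inE.
  rewrite [X in _ <= X](bigID (mem s)) /=; apply: leq_trans (leq_addr _ _).
  exact: leq_sum.
rewrite cardE sum_nat_const (card_uniqP su); lia.
Qed.

End EvenSubgraph.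

(** * Linear algebra over the field with two elements *)

Section FieldTwoAndRank.
Local Open Scope ring_scope.

Lemma F2_addxx (x : 'F_2) : x + x = 0.
Proof. by apply/eqP; case: x => [[|[|]]]. Qed.

Lemma F2_addr_eq0 (x y : 'F_2) : x + y = 0 -> x = y.
Proof. by move=> H; rewrite -[x]addr0 -(F2_addxx y) addrA H add0r. Qed.

Lemma rank_le_nonzero_rows (F : fieldType) (m n : nat) (A : 'M[F]_(m, n)) :
  (\rank A <= #|[set i | row i A != 0%R]|)%N.
Proof.
have sub : (A <= \sum_(i | row i A != 0) <<row i A>>)%MS.
  apply/row_subP => i; have [->|Hi] := eqVneq (row i A) 0; first exact: sub0mx.
  by apply: (sumsmx_sup i) => //; rewrite genmxE.
apply: leq_trans (mxrankS sub) _.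
apply: (@leq_trans (\sum_(i | row i A != 0%R) \rank <<row i A>>)%N).
  apply: (big_ind2 (fun (M : 'M[F]_n) k => (\rank M <= k)%N)) => //.
    by rewrite mxrank0.
  move=> M1 k1 M2 k2 H1 H2; apply: leq_trans (leq_add H1 H2).
  by have [] := mxrank_adds_leqif M1 M2.
rewrite -sum1_card [X in (_ <= X)%N](eq_bigl (fun i => row i A != 0)); last by move=> i; rewrite inE.
by apply: leq_sum => i _; rewrite mxrank_gen rank_leq_row.
Qed.

End FieldTwoAndRank.

(* [E] are the edges, [Q] the quadrangular cells of a two-dimensional complex.
   The hypothesis [cocycle] says that the first cohomology mod 2 is spanned by
   the indicators of the classes [cl a = k], so it bounds its rank by [#|K|]. *)
Section SurfaceMinor.
Local Open Scope ring_scope.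
Variables (N E Q K : finType) (src tgt : E -> N) (cl : E -> K) (side : Q -> 'I_4 -> E).

Definition linked (B : {set N}) : rel N := fun x y =>
  [&& x \in B, y \in B & [exists a, ((src a == x) && (tgt a == y)) || ((src a == y) && (tgt a == x))]].

Definition linked_set (B : {set N}) := {in B &, forall x y, connect (linked B) x y}.

(** The boundary of [p] is [x + y], expressed by pairing [p] with all coboundaries; this is the form
    that combines with the hypothesis [cocycle]. *)
Definition edge_chain (B : {set N}) (x y : N) (p : E -> 'F_2) :=
  (forall l : N -> 'F_2, \sum_a p a * (l (src a) + l (tgt a)) = l x + l y) /\
  (forall a, p a != 0 -> src a \in B /\ tgt a \in B).

Lemma connect_chain (B : {set N}) x y : connect (linked B) x y -> exists p, edge_chain B x y p.
Proof.
case/connectP => s; elim: s x => [|z s IH] x /=.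
  move=> _ ->; exists (fun=> 0); split=> [l|a]; last by rewrite eqxx.
  by rewrite F2_addxx big1 // => a _; rewrite mul0r.
case/andP=> /and3P[xB zB /existsP[a Ha]] pz yE.
have [p [p1 p2]] := IH _ pz yE.
exists (fun b => (b == a)%:R + p b); split=> [l|b].
  under eq_bigr do rewrite mulrDl.
  rewrite big_split /= p1 (bigD1 a) //= eqxx mul1r big1 ?addr0; last first.
    by move=> b /negbTE ->; rewrite mul0r.
  by case/orP: Ha => /andP[/eqP -> /eqP ->];
    rewrite ?(addrC (l z) (l x)) addrA -(addrA (l x)) F2_addxx addr0.
have [->|ba] := eqVneq b a.
  by case/orP: Ha => /andP[/eqP -> /eqP ->].
by rewrite add0r; exact: p2.
Qed.

Hypothesis side_le2 : forall a, (#|[set qj : Q * 'I_4 | side qj.1 qj.2 == a]| <= 2)%N.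
Hypothesis side_closed : forall q (l : N -> 'F_2),
  \sum_j (l (src (side q j)) + l (tgt (side q j))) = 0.
Hypothesis cocycle : forall z : E -> 'F_2, (forall q, \sum_j z (side q j) = 0) ->
  exists (l : N -> 'F_2) (k : K -> 'F_2), forall a, z a = l (src a) + l (tgt a) + k (cl a).

Variables (T : finType) (e : rel T) (Bl : T -> {set N}).
Hypotheses (esym : symmetric e) (eirr : irreflexive e) (girth : girth_at_least 9 e).
Hypothesis Bl_neq0 : forall u, Bl u != finset.set0.
Hypothesis Bl_linked : forall u, linked_set (Bl u).
Hypothesis Bl_disj : forall u v x, x \in Bl u -> x \in Bl v -> u = v.
Hypothesis Bl_edge : forall u v, e u v ->
  exists a, (src a \in Bl u /\ tgt a \in Bl v) \/ (src a \in Bl v /\ tgt a \in Bl u).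

Let EG : {set T * T} := [set p | e p.1 p.2 && (enum_rank p.1 < enum_rank p.2)%N].
Let m := #|EG|.
Let eu (i : 'I_m) : T := (enum_val i).1.
Let ev (i : 'I_m) : T := (enum_val i).2.

Let eE i : e (eu i) (ev i) && (enum_rank (eu i) < enum_rank (ev i))%N.
Proof. by have := enum_valP i; rewrite inE. Qed.

Let e_inj (i j : 'I_m) u v :
  (eu i = u /\ ev i = v) \/ (eu i = v /\ ev i = u) ->
  (eu j = u /\ ev j = v) \/ (eu j = v /\ ev j = u) -> i = j.
Proof.
move=> Hi Hj; have /andP[_ Ri] := eE i; have /andP[_ Rj] := eE j.
apply: enum_val_inj; rewrite [enum_val i]surjective_pairing [enum_val j]surjective_pairing.
rewrite -/(eu i) -/(ev i) -/(eu j) -/(ev j).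
case: Hi Ri => -[-> ->] Ri; case: Hj Rj => -[-> ->] Rj //; exfalso.
  by move: (ltn_trans Ri Rj); rewrite ltnn.
by move: (ltn_trans Ri Rj); rewrite ltnn.
Qed.

Let root_ex u : exists x, x \in Bl u.
Proof. exact/set0Pn/Bl_neq0. Qed.
Let rt u : N := xchoose (root_ex u).
Let rtP u : rt u \in Bl u. Proof. exact: (xchooseP (root_ex u)). Qed.

Let across (i : 'I_m) (a : E) :=
  (src a \in Bl (eu i) /\ tgt a \in Bl (ev i)) \/ (src a \in Bl (ev i) /\ tgt a \in Bl (eu i)).

Let ev_neq i : eu i <> ev i.
Proof. by case/andP: (eE i) => H _ E0; rewrite E0 eirr in H. Qed.

(** A lift of edge [i] of the minor to a chain between the roots of its two branch sets, with the
    one edge at which it changes branch set. Because the roots are fixed, cycles of the minor lift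
    to cycles. *)
Let chain_spec (i : 'I_m) (ap : E * (E -> 'F_2)) :=
  [/\ across i ap.1,
      forall l : N -> 'F_2, \sum_a ap.2 a * (l (src a) + l (tgt a)) = l (rt (eu i)) + l (rt (ev i)),
      ap.2 ap.1 = 1 &
      forall a, ap.2 a != 0 -> a != ap.1 -> exists u, src a \in Bl u /\ tgt a \in Bl u].

Let chain_ex i : exists ap, chain_spec i ap.
Proof.
have [uv _] := andP (eE i).
have key x y a : x \in Bl (eu i) -> y \in Bl (ev i) ->
    (src a = x /\ tgt a = y) \/ (src a = y /\ tgt a = x) ->
    exists ap, chain_spec i ap.
  move=> xu yv Ha.
  have [p [p1 p2]] := connect_chain (Bl_linked (rtP (eu i)) xu).
  have [q [q1 q2]] := connect_chain (Bl_linked yv (rtP (ev i))).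
  have p0 : p a = 0.
    apply/eqP; apply: contraT => /p2[]; case: Ha => -[-> ->] H1 H2.
      by case: (@ev_neq i); apply: Bl_disj H2 yv.
    by case: (@ev_neq i); apply: Bl_disj H1 yv.
  have q0 : q a = 0.
    apply/eqP; apply: contraT => /q2[]; case: Ha => -[-> ->] H1 H2.
      by case: (@ev_neq i); apply: Bl_disj xu H1.
    by case: (@ev_neq i); apply: Bl_disj xu H2.
  exists (a, fun b => p b + (b == a)%:R + q b); split=> /=.
  - by case: Ha => -[] H1 H2; [left|right]; rewrite H1 H2.
  - move=> l; under eq_bigr do rewrite !mulrDl.
    rewrite !big_split /= p1 q1 (bigD1 a) //= eqxx mul1r big1 ?addr0; last first.
      by move=> b /negbTE ->; rewrite mul0r.
    have -> : l (src a) + l (tgt a) = l x + l y.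
      by case: Ha => -[-> ->] //; rewrite addrC.
    rewrite -!addrA; congr (_ + _); rewrite !addrA F2_addxx add0r.
    by rewrite F2_addxx add0r.
  - by rewrite p0 q0 eqxx add0r addr0.
  - move=> b Hb /negbTE ba; move: Hb; rewrite ba addr0.
    have [->|/p2] := eqVneq (p b) 0; last by exists (eu i).
    by rewrite add0r => /q2; exists (ev i).
have [a [[xu yv]|[yv xu]]] := Bl_edge uv.
  by apply: (key _ _ _ xu yv); left.
by apply: (key _ _ _ xu yv); right.
Qed.

Let cdata_ex : exists d : 'I_m -> E * (E -> 'F_2), forall i, chain_spec i (d i).
Proof. by have /choice[d Hd] := chain_ex; exists d. Qed.

Let d := projT1 (cid cdata_ex).
Let dP i : chain_spec i (d i). Proof. exact: (projT2 (cid cdata_ex)). Qed.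
Let hat i := (d i).1.
Let ch i := (d i).2.

Let hat_across i : across i (hat i). Proof. by case: (dP i). Qed.

Let hat_not_in i u : src (hat i) \in Bl u -> tgt (hat i) \in Bl u -> False.
Proof.
move=> H1 H2; case: (hat_across i) => -[H3 H4]; apply: (@ev_neq i).
  by rewrite (Bl_disj H3 H1) (Bl_disj H4 H2).
by rewrite (Bl_disj H3 H1) (Bl_disj H4 H2).
Qed.

Let hat_inj : injective hat.
Proof.
move=> i j hij; have := hat_across j; rewrite -hij.
case: (hat_across i) => -[H1 H2] [] [H3 H4].
- by apply: (@e_inj i j (eu i) (ev i)); left; split=> //; [exact: Bl_disj H3 H1|exact: Bl_disj H4 H2].
- apply: (@e_inj i j (eu i) (ev i)); first by left.
  by right; split; [exact: Bl_disj H4 H2|exact: Bl_disj H3 H1].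
- apply: (@e_inj i j (eu i) (ev i)); first by left.
  by right; split; [exact: Bl_disj H3 H1|exact: Bl_disj H4 H2].
- by apply: (@e_inj i j (eu i) (ev i)); left; split=> //; [exact: Bl_disj H4 H2|exact: Bl_disj H3 H1].
Qed.

Let ch_hat i j : ch i (hat j) = (i == j)%:R.
Proof.
case: (dP i) => _ _ c1 c2; have [<-|ij] := eqVneq i j; first by [].
apply/eqP; apply: contraT => /c2 H.
have [|u [Hs Ht]] := H; last by case: (hat_not_in Hs Ht).
by apply: contra_neq ij => /hat_inj ->.
Qed.

(* Crossing an edge that is not [inK] stays in the same face. *)
Let inK : pred E := fun a =>
  [exists u, (src a \in Bl u) && (tgt a \in Bl u)] || [exists i, a == hat i].

Let ch_inK i a : ch i a != 0 -> inK a.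
Proof.
case: (dP i) => _ _ c1 c2 Ha; rewrite /inK.
have [->|/(c2 _ Ha)[u [H1 H2]]] := eqVneq a (hat i).
  by apply/orP; right; apply/existsP; exists i.
by apply/orP; left; apply/existsP; exists u; rewrite H1.
Qed.

(** Row vectors over ['I_m] are chains of the minor: [MA] takes their boundary, [MP] their lift, and
    [MB] the parity with which the lift meets each class. [MD] is the boundary map of the cells. *)
Let MA : 'M['F_2]_(m, #|T|) :=
  \matrix_(i, v) ((eu i == enum_val v)%:R + (ev i == enum_val v)%:R).
Let MP : 'M['F_2]_(m, #|E|) := \matrix_(i, a) ch i (enum_val a).
Let MB : 'M['F_2]_(m, #|K|) :=
  \matrix_(i, k) \sum_(a | cl a == enum_val k) ch i a.
Let inc q a : 'F_2 := \sum_j (side q j == a)%:R.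
Let MD : 'M['F_2]_(#|Q|, #|E|) := \matrix_(q, a) inc (enum_val q) (enum_val a).

Let sum_inc q (z : E -> 'F_2) : \sum_a inc q a * z a = \sum_j z (side q j).
Proof.
rewrite /inc; under eq_bigr do rewrite mulr_suml.
rewrite exchange_big /=; apply: eq_bigr => j _.
rewrite (bigD1 (side q j)) //= eqxx mul1r big1 ?addr0 //.
by move=> a /negbTE H; rewrite eq_sym H mul0r.
Qed.

(* The cycles of the minor whose lift meets every class evenly.  The columns of
   [cokermx MD] are cocycles and hence vanish on such a lift, so that the lift
   bounds a set of cells, which is a union of faces. *)
Let ker := kermx (row_mx MA MB).

Let sum_enum (I : finType) (F : I -> 'F_2) : \sum_(i < #|I|) F (enum_val i) = \sum_i F i.
Proof. by rewrite [RHS]big_enum_val. Qed.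

Let ker_lift : (ker *m MP <= MD)%MS.
Proof.
rewrite submxE -mulmxA.
suff [L ->] : exists L, MP *m cokermx MD = row_mx MA MB *m L by rewrite mulmxA mulmx_ker mul0mx.
have H (j : 'I_#|E|) : exists lk : (N -> 'F_2) * (K -> 'F_2),
    forall a, cokermx MD (enum_rank a) j = lk.1 (src a) + lk.1 (tgt a) + lk.2 (cl a).
  have [|l [k lk]] := cocycle (z := fun a => cokermx MD (enum_rank a) j).
    move=> q; rewrite -(sum_inc q (fun a => cokermx MD (enum_rank a) j)).
    transitivity ((MD *m cokermx MD) (enum_rank q) j); last by rewrite mulmx_coker mxE.
    rewrite mxE -[LHS]sum_enum; apply: eq_bigr => a _.
    by rewrite [MD _ _]mxE enum_rankK enum_valK.
  by exists (l, k).
have /choice[lk lkP] := H.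
(* Pairing column [j] of the cokernel with a lift leaves its potential at the two roots, a
   combination of columns of [MA], and its class constants, a combination of columns of [MB]. *)
exists (col_mx (\matrix_(v, j) (lk j).1 (rt (enum_val v))) (\matrix_(k, j) (lk j).2 (enum_val k))).
rewrite mul_row_col; apply/matrixP => i j; rewrite !mxE.
transitivity (\sum_a ch i a * ((lk j).1 (src a) + (lk j).1 (tgt a) + (lk j).2 (cl a))).
  by rewrite -[RHS]sum_enum; apply: eq_bigr => a _; rewrite [MP _ _]mxE -lkP enum_valK.
under eq_bigr do rewrite mulrDr.
rewrite big_split /=; congr (_ + _).
  case: (dP i) => _ -> _ _.
  transitivity (\sum_v ((eu i == v)%:R + (ev i == v)%:R) * (lk j).1 (rt v)); last first.
    by rewrite -[LHS]sum_enum; apply: eq_bigr => v _; rewrite !mxE.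
  under eq_bigr do rewrite mulrDl.
  rewrite big_split /=; congr (_ + _).
    rewrite (bigD1 (eu i)) //= eqxx mul1r big1 ?addr0 // => v /negbTE H2.
    by rewrite eq_sym H2 mul0r.
  rewrite (bigD1 (ev i)) //= eqxx mul1r big1 ?addr0 // => v /negbTE H2.
  by rewrite eq_sym H2 mul0r.
transitivity (\sum_k (\sum_(a | cl a == k) ch i a) * (lk j).2 k); last first.
  by rewrite -[LHS]sum_enum; apply: eq_bigr => v _; rewrite !mxE.
rewrite (partition_big cl predT) //=; apply: eq_bigr => k _.
by rewrite mulr_suml; apply: eq_bigr => a /eqP ->.
Qed.

Let nb : rel Q := fun q q' =>
  [exists a, ~~ inK a && ([exists j, side q j == a] && [exists j, side q' j == a])].

Let nb_sym : symmetric nb.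
Proof. by move=> q q'; apply: eq_existsb => a; rewrite [X in _ && X]andbC. Qed.

Let face q := fingraph.root nb q.
Let bd (f : Q) a : 'F_2 := \sum_(q | face q == f) inc q a.
(** A face that fails the second condition has an edge outside [inK] on an odd number of its sides,
    such as a free edge of the complex; a chain supported in [inK] cannot use it. *)
Let good f := (fingraph.root nb f == f) && [forall a, (bd f a != 0) ==> inK a].

Let MF : 'M['F_2]_(#|Q|, m) :=
  \matrix_(f, i) if good (enum_val f) then bd (enum_val f) (hat i) else 0.

Let inc_side q a : inc q a != 0 -> exists j, side q j = a.
Proof.
move=> H; suff /existsP[j /eqP ja] : [exists j, side q j == a] by exists j.
apply: contraNT H; rewrite negb_exists => /forallP H.
apply/eqP; rewrite /inc big1 // => j _.
by apply/eqP; move: (H j); case: eqP => // _; rewrite mulr0n.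
Qed.

(** Two distinct cells at [a] use up the two occurrences that [side_le2] allows, so each has [a]
    exactly once and no other cell has it. *)
Let inc_pair q q' a (x : Q -> 'F_2) : q != q' ->
  (exists j, side q j = a) -> (exists j, side q' j = a) ->
  \sum_p x p * inc p a = x q + x q'.
Proof.
move=> qq' [j ja] [j' ja'].
have full p k : side p k = a -> (p, k) = (q, j) \/ (p, k) = (q', j').
  move=> pk; suff /orP[/eqP|/eqP] : ((p, k) == (q, j)) || ((p, k) == (q', j'));
    [by left|by right|apply: contraT].
  rewrite negb_or => /andP[n1 n2].
  have := side_le2 a; rewrite leqNgt => /negP[].
  apply/card_gt2P; exists (p, k), (q, j), (q', j'); split; rewrite ?inE /= ?pk ?ja ?ja' ?eqxx //.
    split=> //; first by apply/eqP => -[E1]; rewrite E1 eqxx in qq'.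
    by apply: contraNneq n2 => <-.
have s1 : inc q a = 1.
  rewrite /inc (bigD1 j) //= ja eqxx big1 ?addr0 // => k kj.
  case: eqP => // /full[[E1]|[E1]]; first by rewrite E1 eqxx in kj.
  by rewrite E1 eqxx in qq'.
have s2 : inc q' a = 1.
  rewrite /inc (bigD1 j') //= ja' eqxx big1 ?addr0 // => k kj.
  case: eqP => // /full[[E1]|[E1]]; first by rewrite E1 eqxx in qq'.
  by rewrite E1 eqxx in kj.
rewrite (bigD1 q) //= (bigD1 q') 1?eq_sym //= s1 s2 !mulr1 big1 ?addr0 //.
move=> p /andP[pq pq']; have [->|/inc_side[k /full[[E1]|[E1]]]] := eqVneq (inc p a) 0.
- by rewrite mulr0.
- by rewrite E1 eqxx in pq.
- by rewrite E1 eqxx in pq'.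
Qed.

(** A lift vanishes off [inK], so the coefficients [x] of the cells that it bounds agree across such
    edges, hence on each face, and are zero on faces that are not good. Reading the lift at the
    edges [hat i] recovers the chain. *)
Let ker_faces : (ker <= MF)%MS.
Proof.
apply/row_subP => r; set C := row r ker.
have [x xE] : exists x, C *m MP = x *m MD.
  by apply/submxP; rewrite /C -row_mul; apply: submx_trans (row_sub _ _) ker_lift.
pose xs q := x 0 (enum_rank q).
have CE a : \sum_i C 0 i * ch i a = \sum_q xs q * inc q a.
  move/matrixP: xE => /(_ 0 (enum_rank a)); rewrite !mxE => H.
  transitivity (\sum_j C 0 j * MP j (enum_rank a)).
    by apply: eq_bigr => i _; rewrite !mxE enum_rankK.
  rewrite {}H -[RHS]sum_enum; apply: eq_bigr => q _.
  by rewrite !mxE /xs enum_valK enum_rankK.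
have CE0 a : ~~ inK a -> \sum_q xs q * inc q a = 0.
  move=> aK; rewrite -CE big1 // => i _; have [->|/ch_inK] := eqVneq (ch i a) 0.
    by rewrite mulr0.
  by rewrite (negbTE aK).
have Chat i : C 0 i = \sum_q xs q * inc q (hat i).
  rewrite -CE (bigD1 i) //= ch_hat eqxx mulr1 big1 ?addr0 // => j ji.
  by rewrite ch_hat (negbTE ji) mulr0.
have xnb q q' : nb q q' -> xs q = xs q'.
  case/existsP=> a /and3P[aK /existsP[j /eqP ja] /existsP[j' /eqP ja']].
  have [->//|qq'] := eqVneq q q'; apply: F2_addr_eq0.
  rewrite -(CE0 a aK); symmetry; apply: inc_pair => //; by [exists j|exists j'].
have xface q : xs q = xs (face q).
  have : connect nb q (face q) by exact: connect_root.
  case/connectP => s; elim: s q {+}(face q) => [|b s IH] q f /=; first by move=> _ ->.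
  by case/andP => /xnb -> /IH H /H.
have xbd f a : \sum_(q | face q == f) xs q * inc q a = xs f * bd f a.
  rewrite /bd mulr_sumr; apply: eq_bigr => q /eqP fq.
  by rewrite xface fq.
have xbad f : fingraph.root nb f == f -> ~~ good f -> xs f = 0.
  move=> rf; rewrite /good rf /= negb_forall => /existsP[a]; rewrite negb_imply => /andP[bda aK].
  apply/eqP; apply: contraT => xf0; have := CE0 a aK.
  have sum_face : \sum_q xs q * inc q a = \sum_(q | face q == f) xs q * inc q a.
    rewrite (bigID (fun q => face q == f)) /= [X in _ + X]big1 ?addr0 // => q qf.
    have [->|/inc_side[j ja]] := eqVneq (inc q a) 0; first by rewrite mulr0.
    have [p pf] : exists2 p, face p == f & inc p a != 0.
      apply/exists_inP; apply: contraNT bda; rewrite negb_exists_in => /forall_inP H.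
      by apply/eqP; rewrite /bd big1 // => p pf; have := H p pf; rewrite negbK => /eqP.
    case/inc_side => k ka; case/negP: qf; rewrite -(eqP pf); apply/eqP.
    apply/fingraph.rootP; first by apply: sym_connect_sym.
    apply: connect1; apply/existsP; exists a; rewrite aK /=.
    by apply/andP; split; apply/existsP; [exists j|exists k]; apply/eqP.
  rewrite sum_face xbd => /eqP; rewrite mulf_eq0 (negbTE xf0) (negbTE bda) //.
apply/submxP; exists x; apply/rowP => i; rewrite Chat [RHS]mxE.
transitivity (\sum_f xs f * MF (enum_rank f) i); last first.
  by rewrite -[LHS]sum_enum; apply: eq_bigr => f _; rewrite /xs enum_valK.
rewrite (partition_big face (fun f => fingraph.root nb f == f)) /=; last first.
  by move=> q _; apply/eqP; apply: root_root; apply: sym_connect_sym.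
rewrite big_mkcond /=; apply: eq_bigr => f _; rewrite !mxE enum_rankK.
case: ifP => [rf|rf]; last by rewrite /good rf mulr0.
rewrite xbd; case: ifP => // /negbT gf; by rewrite (xbad _ rf gf) mul0r mulr0.
Qed.

Let nzrows := [set f : 'I_#|Q| | row f MF != 0].

(** The kernel loses at most one dimension per column of [MA] and [MB], and its rank is at most the
    number of faces with a nonzero row: Euler's inequality. *)
Let rank_bound : (m <= #|T| + #|K| + #|nzrows|)%N.
Proof.
have := mxrankS ker_faces; rewrite mxrank_ker.
have := rank_le_nonzero_rows MF; have := rank_leq_col (row_mx MA MB).
rewrite -/nzrows; lia.
Qed.

(** The boundary of a set of cells pairs to zero with the coboundary of the indicator of [Bl u].
    Edges inside a branch set contribute nothing, so what is left is the degree of [u] mod 2. *)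
Let MF_degree f u : \sum_i MF f i * ((eu i == u)%:R + (ev i == u)%:R) = 0.
Proof.
have [gf|gf] := boolP (good (enum_val f)); last first.
  by rewrite big1 // => i _; rewrite mxE (negbTE gf) mul0r.
set g := enum_val f in gf *.
have bd0 : \sum_a bd g a * ((src a \in Bl u)%:R + (tgt a \in Bl u)%:R) = 0.
  rewrite /bd; under eq_bigr do rewrite mulr_suml.
  rewrite exchange_big big1 //= => q _.
  rewrite (sum_inc q (fun a => (src a \in Bl u)%:R + (tgt a \in Bl u)%:R)).
  exact: (side_closed q (fun x => (x \in Bl u)%:R)).
rewrite -[RHS]bd0 [RHS](bigID (fun a => [exists i, a == hat i])) /= [X in _ = _ + X]big1 ?addr0; last first.
  move=> a anh; have [->|bda] := eqVneq (bd g a) 0; first by rewrite mul0r.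
  move/andP: gf => [_ /forallP/(_ a)/implyP/(_ bda)].
  rewrite /inK => /orP[/existsP[v /andP[sv tv]]|/existsP[i /eqP ai]]; last first.
    by case/existsP: anh; exists i; apply/eqP.
  rewrite (_ : (src a \in Bl u) = (tgt a \in Bl u)) ?F2_addxx ?mulr0 //.
  by apply/idP/idP => H; [rewrite -(Bl_disj sv H)|rewrite -(Bl_disj tv H)].
rewrite [RHS](eq_bigl (fun a => a \in [set hat i | i in 'I_m])); last first.
  move=> a; apply/existsP/imsetP => [[i /eqP ->]|[i _ ->]]; by exists i.
rewrite big_imset /=; last by move=> ? ? _ _; exact: hat_inj.
apply: eq_bigr => i _; rewrite mxE -/g gf; congr (_ * _).
have memE v : (v == u) = (rt v \in Bl u).
  by apply/eqP/idP => [<-//|H]; exact: Bl_disj (rtP v) H.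
have mem2 v y : y \in Bl v -> (y \in Bl u) = (v == u).
  by move=> yv; apply/idP/eqP => [H|<- //]; exact: Bl_disj yv H.
by case: (hat_across i) => -[H1 H2]; rewrite (mem2 _ _ H1) (mem2 _ _ H2) // addrC.
Qed.

Let face_size f : f \in nzrows -> (9 <= #|[set i | MF f i != 0%R]|)%N.
Proof.
rewrite inE => rf0.
pose S : {set T * T} := [set enum_val i | i : 'I_m & MF f i != 0].
have -> : #|[set i | MF f i != 0]| = #|S|.
  rewrite card_imset; last exact: enum_val_inj.
  by apply: eq_card => i; rewrite !inE.
have SP x y : (x, y) \in S -> exists i, [/\ MF f i != 0, eu i = x & ev i = y].
  by case/imsetP => i; rewrite inE => Hi xy; exists i; rewrite /eu /ev -xy.
have PS i : MF f i != 0 -> (eu i, ev i) \in S.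
  by move=> Hi; apply/imsetP; exists i; rewrite ?inE // /eu /ev -surjective_pairing.
apply: (even_subgraph_size esym eirr girth).
- move=> [x y] /SP[i [_ <- <-]]; by case/andP: (eE i).
- move=> x y /SP[i [_ iu iv]]; apply/negP => /SP[j [_ ju jv]].
  have ij : i = j by apply: (@e_inj i j x y); [left|right].
  by apply: (@ev_neq i); rewrite iu ij jv.
- move=> x y xyS.
  have [i [Hi exy]] : exists i, MF f i != 0 /\ ((eu i = x /\ ev i = y) \/ (eu i = y /\ ev i = x)).
    by case/orP: xyS => /SP[i [Hi H1 H2]]; exists i; split=> //; [left|right].
  have [w /andP[wy fxw]|no] := pickP (fun w => (w != y) && (((x, w) \in S) || ((w, x) \in S))).
    by exists w.
  (* With no second neighbour, the degree sum at [x] would be the single nonzero term of edge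
     [i]. *)
  have := MF_degree f x; rewrite (bigD1 i) //= big1 ?addr0.
    have xny : x != y.
      apply/eqP => xy; subst y; apply: (@ev_neq i).
      by case: exy => -[-> ->].
    case: exy => -[-> ->]; rewrite eqxx 1?eq_sym (negbTE xny) ?addr0 ?add0r mulr1 => H;
    by rewrite H eqxx in Hi.
  move=> j ji; have [->|Hj] := eqVneq (MF f j) 0; first by rewrite mul0r.
  have Sj := PS _ Hj.
  have [ejx|ejx] := eqVneq (eu j) x.
    have := no (ev j); rewrite -{1}ejx Sj andbT => /negbFE/eqP ejy.
    case/eqP: ji; apply: (@e_inj j i x y) => //; by left.
  have [fjx|fjx] := eqVneq (ev j) x; last by rewrite !mulr0n addr0 mulr0.
  have := no (eu j); rewrite -{2}fjx Sj orbT andbT => /negbFE/eqP ejy.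
  case/eqP: ji; apply: (@e_inj j i x y) => //; by right.
- have [i Hi] : exists i, MF f i != 0.
    apply/existsP; apply: contraNT rf0; rewrite negb_exists => /forallP Hz.
    by apply/eqP/rowP => i; rewrite !mxE; have := Hz i; rewrite negbK !mxE => /eqP.
  by apply/set0Pn; exists (eu i, ev i); exact: PS.
Qed.

Let face_incidence i : (#|[set f | MF f i != 0%R]| <= 2)%N.
Proof.
apply: leq_trans (side_le2 (hat i)).
apply: leq_trans (leq_imset_card (fun qj : Q * 'I_4 => enum_rank (face qj.1)) _).
apply: subset_leq_card; apply/fintype.subsetP => f; rewrite inE mxE.
case: ifP => gf; last by rewrite eqxx.
move=> bdf; have [q qf] : exists2 q, face q == enum_val f & inc q (hat i) != 0.
  apply/exists_inP; apply: contraNT bdf; rewrite negb_exists_in => /forall_inP H.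
  by apply/eqP; rewrite /bd big1 // => p pf; have := H p pf; rewrite negbK => /eqP.
case/inc_side => j ja; apply/imsetP; exists (q, j); first by rewrite inE ja.
by rewrite /= (eqP qf) enum_valK.
Qed.

(** If [f] faces have a nonzero row, then [m <= #|T| + #|K| + f] and [9 f <= 2 m] give
    [7 m <= 9 (#|T| + #|K|)]. Every edge is counted in both directions, which doubles the right
    side. *)
Lemma surface_minor_edge_bound :
  (7 * #|[set p : T * T | e p.1 p.2]| <= 18 * (#|T| + #|K|))%N.
Proof.
have cardE : (#|[set p : T * T | e p.1 p.2]| <= m + m)%N.
  have -> : [set p : T * T | e p.1 p.2] = EG :|: [set (p.2, p.1) | p in EG].
    apply/finset.setP => -[x y]; rewrite !inE /=; apply/idP/idP => [xy|].
      rewrite xy /=; have [lt|lt|E0] := ltngtP (enum_rank x) (enum_rank y) => //=.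
        apply/imsetP; exists (y, x) => //; by rewrite inE /= esym xy.
      by move/val_inj/enum_rank_inj: E0 xy => ->; rewrite eirr.
    case/orP => [/andP[]//|/imsetP[[a b]]]; rewrite inE /= => /andP[ab _] [-> ->].
    by rewrite esym.
  by apply: leq_trans (leq_card_setU _ _) _; rewrite leq_add2l; exact: leq_imset_card.
have count : (9 * #|nzrows| <= 2 * m)%N.
  have : (\sum_(f in nzrows) 9 <= \sum_(f in nzrows) #|[set i | MF f i != 0%R]|)%N.
    by apply: leq_sum => f; exact: face_size.
  rewrite sum_nat_const mulnC => H; apply: leq_trans H _.
  apply: (@leq_trans (\sum_f \sum_i (MF f i != 0%R))%N).
    rewrite [X in (_ <= X)%N](bigID (mem nzrows)) /=; apply: leq_trans (leq_addr _ _).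
    apply: leq_sum => f _; rewrite -sum1dep_card big_mkcond /=.
    by apply: leq_sum => i _; case: (_ != _).
  rewrite exchange_big /=; apply: (@leq_trans (\sum_(i < m) 2)); last first.
    by rewrite sum_nat_const card_ord mulnC.
  apply: leq_sum => i _; apply: leq_trans (face_incidence i).
  rewrite -sum1dep_card [X in (_ <= X)%N]big_mkcond /=.
  by apply: leq_sum => f _; case: (_ != _).
have := rank_bound; lia.
Qed.

End SurfaceMinor.

(** * Discrete intervals and telescoping sums *)

Section LoHi.
Local Open Scope ring_scope.
Variable n : nat.

Definition lo (k : 'I_n) : 'I_n.+1 := widen_ord (leqnSn n) k.
Definition hi (k : 'I_n) : 'I_n.+1 := lift ord0 k.

Lemma val_lo k : val (lo k) = k. Proof. by []. Qed.
Lemma val_hi k : val (hi k) = k.+1. Proof. by []. Qed.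

Lemma lo_hi_ind (P : 'I_n.+1 -> Prop) :
  P ord0 -> (forall k, P (lo k) -> P (hi k)) -> forall b, P b.
Proof.
move=> P0 PS [b blt]; elim: b blt => [|b IH] blt.
  by rewrite (_ : Ordinal blt = ord0) //; exact: val_inj.
have blt' : (b < n)%N by [].
rewrite (_ : Ordinal blt = hi (Ordinal blt')); last exact: val_inj.
apply: PS; rewrite (_ : lo _ = Ordinal (ltnW blt)) //; exact: val_inj.
Qed.

Definition prefix_sum (F : 'I_n -> 'F_2) (b : 'I_n.+1) : 'F_2 :=
  \sum_(k < n | (k < b)%N) F k.

Lemma prefix_sum0 F : prefix_sum F ord0 = 0.
Proof. by rewrite /prefix_sum big_pred0. Qed.

Lemma prefix_sum_hi F k : prefix_sum F (hi k) = prefix_sum F (lo k) + F k.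
Proof.
rewrite /prefix_sum (bigD1 k) /=; last by rewrite /bump.
rewrite addrC; congr (_ + _); apply: eq_bigl => j.
by rewrite /bump /= add1n ltnS -val_eqE /= ltn_neqAle andbC.
Qed.

Lemma prefix_sum_telescope (G : 'I_n.+1 -> 'F_2) b :
  prefix_sum (fun k => G (lo k) + G (hi k)) b = G ord0 + G b.
Proof.
elim/lo_hi_ind: b => [|k IH]; first by rewrite prefix_sum0 F2_addxx.
by rewrite prefix_sum_hi IH addrA -(addrA (G ord0)) F2_addxx addr0.
Qed.

End LoHi.

(* Two grids, [s : bool], glued along intervals of their bottom rows.  The glued
   vertices are not identified: they are joined by a rung, and consecutive
   rungs of an interval bound a quadrangular cell. *)
Section GluedHalfPlanes.
Local Open Scope ring_scope.
Variables (W L : nat) (I : finType) (len : I -> nat).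
Variables (sA sB : I -> bool).
Variables (gA gB : forall i, 'I_(len i) -> 'I_W).
Variables (pA pB : forall i, 'I_(len i).+1 -> 'I_W.+1).

(** Both directions are allowed because a gluing may reverse its interval; mod 2 the orientation
    does not affect the sums. *)
Definition follows (i : I) (g : 'I_(len i) -> 'I_W) (p : 'I_(len i).+1 -> 'I_W.+1) :=
  forall t, (p (lo t) = lo (g t) /\ p (hi t) = hi (g t)) \/
            (p (lo t) = hi (g t) /\ p (hi t) = lo (g t)).

Hypothesis pA_follows : forall i, follows (gA (i := i)) (pA (i := i)).
Hypothesis pB_follows : forall i, follows (gB (i := i)) (pB (i := i)).

Let bdry (u : {i : I & 'I_(len i)}) (b : bool) : bool * nat :=
  if b then (sA (tag u), val (gA (tagged u))) else (sB (tag u), val (gB (tagged u))).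

Hypothesis bdry_inj : forall u u' b b', bdry u b = bdry u' b' -> u = u' /\ b = b'.

Definition gnode := (bool * 'I_W.+1 * 'I_L.+1)%type.
Definition grung := {i : I & 'I_(len i).+1}.
Definition gedge := (bool * 'I_W * 'I_L.+1 + bool * 'I_W.+1 * 'I_L + grung)%type.
Definition gcell := (bool * 'I_W * 'I_L + {i : I & 'I_(len i)})%type.

Definition Hedge s a b : gedge := inl (inl (s, a, b)).
Definition Vedge s a b : gedge := inl (inr (s, a, b)).
Definition Rung i (t : 'I_(len i).+1) : gedge := inr (Tagged (fun i => 'I_(len i).+1) t).

Definition gsrc (a : gedge) : gnode :=
  match a with
  | inl (inl (s, a, b)) => (s, lo a, b)
  | inl (inr (s, a, b)) => (s, a, lo b)
  | inr (existT i t) => (sA i, pA t, ord0)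
  end.

Definition gtgt (a : gedge) : gnode :=
  match a with
  | inl (inl (s, a, b)) => (s, hi a, b)
  | inl (inr (s, a, b)) => (s, a, hi b)
  | inr (existT i t) => (sB i, pB t, ord0)
  end.

Definition gclass (a : gedge) : option I := if a is inr u then Some (tag u) else None.

Definition gside (q : gcell) (j : 'I_4) : gedge :=
  match q with
  | inl (s, a, b) =>
    match val j with
    | 0 => Hedge s a (lo b) | 1 => Hedge s a (hi b)
    | 2 => Vedge s (lo a) b | _ => Vedge s (hi a) b end
  | inr (existT i t) =>
    match val j with
    | 0 => Hedge (sA i) (gA t) ord0 | 1 => Hedge (sB i) (gB t) ord0
    | 2 => Rung (lo t) | _ => Rung (hi t) end
  end%N.

Let sum_side (F : gedge -> 'F_2) q :
  \sum_j F (gside q j) = match q with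
  | inl (s, a, b) => F (Hedge s a (lo b)) + (F (Hedge s a (hi b)) +
      (F (Vedge s (lo a) b) + F (Vedge s (hi a) b)))
  | inr (existT i t) => F (Hedge (sA i) (gA t) ord0) + (F (Hedge (sB i) (gB t) ord0) +
      (F (Rung (lo t)) + F (Rung (hi t)))) end.
Proof.
by rewrite !big_ord_recl big_ord0 addr0; case: q => [[[s a] b]|[i t]].
Qed.

Let sigE (u u' : {i : I & 'I_(len i)}) :
  tag u = tag u' -> val (tagged u) = val (tagged u') -> u = u'.
Proof.
case: u u' => i t [i' t'] /= ii; subst i' => /val_inj ->; by [].
Qed.

Lemma gside_le2 a : (#|[set qj : gcell * 'I_4 | gside qj.1 qj.2 == a]| <= 2)%N.
Proof.
(* The label separates the two occurrences of an edge. A grid edge is the low side of one square and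
   the high side of another; a bottom edge has no square below it, but by [bdry_inj] at most one
   rung cell, which gets the label of a high side. *)
pose lb (qj : gcell * 'I_4) : bool := match qj.1 with
  | inl _ => ~~ odd qj.2 | inr _ => val qj.2 == 2 end.
have bd u u' b b' : bdry u b = bdry u' b' -> (inr u : gcell) = inr u' /\ b = b'.
  by move=> /bdry_inj[-> ->].
pose hpart (x : gedge) : bool * nat := match x with
  | inl (inl (s, c, _)) => (s, val c) | _ => (true, 0%N) end.
pose rpart (x : gedge) : option (I * nat) := match x with
  | inr (existT i t) => Some (i, val t) | _ => None end.
have inj : {in [set qj : gcell * 'I_4 | gside qj.1 qj.2 == a] &, injective lb}.
  move=> [q j] [q' j']; rewrite !inE /= => /eqP <- /eqP.
  case: j j' => [[|[|[|[|//]]]] Hj] [[|[|[|[|//]]]] Hj'];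
  case: q q' => [[[s x] y]|[i t]] [[[s' x'] y']|[i' t']] //= E _;
  try discriminate E; try (by case: E => -> -> /val_inj ->; congr (_, _); apply: val_inj);
  try (by case: E => -> /val_inj -> ->; congr (_, _); apply: val_inj).
  - have [H _] := bd (existT _ i' t') (existT _ i t) true true (congr1 hpart E).
    by congr (_, _); [exact: esym H|apply: val_inj].
  - by have [] := bd (existT _ i' t') (existT _ i t) false true (congr1 hpart E).
  - by have [] := bd (existT _ i' t') (existT _ i t) true false (congr1 hpart E).
  - have [H _] := bd (existT _ i' t') (existT _ i t) false false (congr1 hpart E).
    by congr (_, _); [exact: esym H|apply: val_inj].
  - have [i'i tt] : Some (i', val t') = Some (i, val t) := congr1 rpart E.
    by rewrite (@sigE (existT _ i' t') (existT _ i t)) //; congr (_, _); apply: val_inj.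
  - have [i'i tt] : Some (i', (val t').+1) = Some (i, (val t).+1) := congr1 rpart E.
    by rewrite (@sigE (existT _ i' t') (existT _ i t)) //; congr (_, _); apply: val_inj.
by rewrite -(card_in_imset inj); apply: leq_trans (max_card _) _; rewrite card_bool.
Qed.

Lemma gside_closed q (l : gnode -> 'F_2) :
  \sum_j (l (gsrc (gside q j)) + l (gtgt (gside q j))) = 0.
Proof.
have cancel4 (w x y z : 'F_2) : (w + x) + ((y + z) + ((w + y) + (x + z))) = 0.
  rewrite -[RHS](F2_addxx ((w + x) + (y + z))); ring.
rewrite (sum_side (fun a => l (gsrc a) + l (gtgt a))).
case: q => [[[s a] b]|[i t]] /=; first exact: cancel4.
case: (pA_follows t) => -[-> ->]; case: (pB_follows t) => -[-> ->].
- exact: cancel4.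
- by rewrite (addrC (l (sB i, lo _, _))); exact: cancel4.
- by rewrite (addrC (l (sA i, lo _, _))); exact: cancel4.
- rewrite (addrC (l (sB i, lo _, _))) (addrC (l (sA i, lo _, _))); exact: cancel4.
Qed.

(* Subtracting the coboundary of a potential given by path sums leaves a cocycle
   that vanishes on the grids and hence is constant along each interval. *)
Lemma gcocycle (z : gedge -> 'F_2) : (forall q, \sum_j z (gside q j) = 0) ->
  exists (l : gnode -> 'F_2) (k : option I -> 'F_2),
    forall a, z a = l (gsrc a) + l (gtgt a) + k (gclass a).
Proof.
move=> zq.
pose l (x : gnode) : 'F_2 := prefix_sum (fun a => z (Hedge x.1.1 a ord0)) x.1.2 +
  prefix_sum (fun b => z (Vedge x.1.1 x.1.2 b)) x.2.
have lV s a b : z (Vedge s a b) = l (s, a, lo b) + l (s, a, hi b).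
  have cancel3 (x y w : 'F_2) : (x + y) + (x + (y + w)) = w.
    have -> : (x + y) + (x + (y + w)) = (x + x) + ((y + y) + w) by ring.
    by rewrite !F2_addxx !add0r.
  by rewrite /l /= prefix_sum_hi cancel3.
have lH s a b : z (Hedge s a b) = l (s, lo a, b) + l (s, hi a, b).
  (* The cells between columns [lo a] and [hi a] below row [b] add up to this relation. *)
  have tele : prefix_sum (fun b => z (Vedge s (lo a) b)) b +
      prefix_sum (fun b => z (Vedge s (hi a) b)) b = z (Hedge s a ord0) + z (Hedge s a b).
    rewrite -(prefix_sum_telescope (fun b => z (Hedge s a b))) /prefix_sum -big_split /=.
    apply: eq_bigr => k _; apply: F2_addr_eq0.
    have := zq (inl (s, a, k)); rewrite sum_side /= => H; rewrite -[RHS]H; ring.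
  rewrite /l /= prefix_sum_hi.
  set u := prefix_sum _ (lo a); set v := prefix_sum _ b in tele *; set w := prefix_sum _ b in tele *.
  have -> : u + v + (u + z (Hedge s a ord0) + w) = (u + u) + (z (Hedge s a ord0) + (v + w)) by ring.
  by rewrite F2_addxx add0r tele addrA F2_addxx add0r.
pose k (o : option I) : 'F_2 := if o is Some i then
  z (Rung (i := i) ord0) + (l (gsrc (Rung (i := i) ord0)) + l (gtgt (Rung (i := i) ord0))) else 0.
exists l, k => -[[[[s a] b]|[[s a] b]]|[i t]] /=.
- by rewrite addr0 lH.
- by rewrite addr0 lV.
pose rest (t : 'I_(len i).+1) : 'F_2 := z (Rung t) + (l (sA i, pA t, ord0) + l (sB i, pB t, ord0)).
suff H : rest ord0 = rest t.
  transitivity (l (sA i, pA t, ord0) + l (sB i, pB t, ord0) + rest t); last by rewrite -H.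
  by rewrite /rest addrCA F2_addxx addr0.
elim/lo_hi_ind: t => // t ->; apply: F2_addr_eq0.
have := zq (inr (existT _ i t)); rewrite sum_side /rest !lH => H.
rewrite -[RHS]H.
by case: (pA_follows t) => -[-> ->]; case: (pB_follows t) => -[-> ->]; ring.
Qed.

End GluedHalfPlanes.

(* Each set [M u v] is cut into a part added to [C u] and the rest next to [C v]. *)
Section BranchSets.
Variables (N T : finType) (adj : rel N) (e : rel T).
Hypotheses (adj_sym : symmetric adj) (e_sym : symmetric e) (e_irr : irreflexive e).

Definition within_connect (B : {set N}) : rel N :=
  connect (fun x y => [&& x \in B, y \in B & adj x y]).

Lemma within_connect_sym B x y : within_connect B x y = within_connect B y x.
Proof.
by apply: sym_connect_sym => {}x {}y; rewrite andbCA; do 2 congr (_ && _); exact: adj_sym.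
Qed.

Lemma within_connect_sub (B B' : {set N}) x y : B \subset B' ->
  within_connect B x y -> within_connect B' x y.
Proof.
move=> /fintype.subsetP BB'; apply: connect_sub => u v /and3P[uB vB uv].
by apply: connect1; rewrite !BB'.
Qed.

Variables (C : T -> {set N}) (M : T -> T -> {set N}).
Hypothesis C_neq0 : forall u, exists x, x \in C u.
Hypothesis C_conn : forall u, {in C u &, forall x y, within_connect (C u) x y}.
Hypothesis C_disj : forall u v x, u != v -> x \in C u -> x \notin C v.
Hypothesis M_conn : forall u v, e u v -> {in M u v &, forall x y, within_connect (M u v) x y}.
Hypothesis M_left : forall u v, e u v -> exists x, x \in M u v /\ x \in C u.
Hypothesis M_right : forall u v, e u v -> exists x, x \in M u v /\ x \in C v.
Hypothesis MC_disj : forall u v w x, e u v -> w != u -> w != v -> x \in M u v -> x \notin C w.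
Hypothesis M_disj : forall u v u' v' x, e u v -> e u' v' -> (u, v) != (u', v') ->
  (u, v) != (v', u') -> x \in M u v -> x \notin M u' v'.

Let tail u v : {set N} :=
  [set x | [exists x0, (x0 \in C u) && within_connect (M u v :\: C v) x0 x] & x \in M u v :\: C v].

(** [M u v] and [M v u] belong to the same edge and may overlap, so only one of the two is
    distributed. *)
Let oriented u v := e u v && (enum_rank u < enum_rank v).

Let branch u : {set N} := C u :|: [set x | [exists v, oriented u v && (x \in tail u v)]].

Let branchP u x : reflect (x \in C u \/ exists2 v, oriented u v & x \in tail u v) (x \in branch u).
Proof.
rewrite !inE; apply: (iffP orP) => -[xC|H]; [by left| |by left|].
  by case/existsP: H => v /andP[uv xv]; right; exists v.
by case: H => v uv xv; right; apply/existsP; exists v; rewrite uv.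
Qed.

Let tail_step u v x y : x \in tail u v -> y \in M u v :\: C v -> adj x y -> y \in tail u v.
Proof.
move=> /setIdP[/existsP[x0 /andP[x0C x0x]] xM] yM xy; apply/setIdP; split=> //.
apply/existsP; exists x0; rewrite x0C /=; apply: connect_trans x0x _.
by apply: connect1; rewrite xM yM.
Qed.

Let tail_connected u v x : oriented u v -> x \in tail u v ->
  exists2 y, y \in C u & within_connect (branch u) x y.
Proof.
move=> uv xt; have /setIdP[/existsP[x0 /andP[x0C /connectP[p pp xE]]] xM] := xt.
exists x0 => //; rewrite within_connect_sym.
have x0M : x0 \in M u v :\: C v.
  by case: p pp xE xM => [_ /= -> //|y p /= /andP[/and3P[]]].
have x0t : x0 \in tail u v.
  by apply/setIdP; split=> //; apply/existsP; exists x0; rewrite x0C /within_connect connect0.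
clear xt xM x0C x0M; elim: p x0 x0t pp xE => [|y p IH] x0 x0t /=; first by move=> _ ->; exact: connect0.
case/andP=> /and3P[_ yM x0y] pp xE; have yt := tail_step x0t yM x0y.
apply: connect_trans (IH y yt pp xE); apply: connect1; rewrite x0y andbT.
by apply/andP; split; apply/branchP; right; exists v.
Qed.

(** The tail of [M u v] stops short of [C v], and [M u v] avoids every other [C w] and the sets of
    other edges, so no two branch sets collide. *)
Lemma branch_sets : exists Bl : T -> {set N},
  [/\ forall u, exists x, x \in Bl u,
      forall u, {in Bl u &, forall x y, within_connect (Bl u) x y},
      forall u v x, x \in Bl u -> x \in Bl v -> u = v &
      forall u v, e u v -> exists x y, [/\ x \in Bl u, y \in Bl v & adj x y]].
Proof.
have CB u : C u \subset branch u by apply/fintype.subsetP => x xC; apply/branchP; left.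
have tM u v x : x \in tail u v -> x \in M u v /\ x \notin C v.
  by case/setIdP => _; rewrite inE => /andP[].
exists branch; split.
- by move=> u; have [x xC] := C_neq0 u; exists x; apply/branchP; left.
- move=> u x y xB yB.
  have toC z : z \in branch u -> exists2 z', z' \in C u & within_connect (branch u) z z'.
    case/branchP => [zC|[v uv zt]]; last exact: tail_connected uv zt.
    by exists z => //; exact: connect0.
  have [x' x'C xx'] := toC x xB; have [y' y'C yy'] := toC y yB.
  apply: connect_trans xx' _; apply: (@connect_trans _ _ y').
    by apply: within_connect_sub (CB u) _; exact: C_conn.
  by rewrite -/(within_connect _ _ _) within_connect_sym.
- move=> u v x xu xv; apply/eqP; apply: contraT => uv.
  case/branchP: xu => [xCu|[u' uu' /tM[xMu xu']]]; case/branchP: xv => [xCv|[v' vv' /tM[xMv xv']]].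
  + by have := C_disj uv xCu; rewrite xCv.
  + case/andP: vv' => vv' _; have [E|ne] := eqVneq u v'; first by rewrite -E xCu in xv'.
    by have := MC_disj vv' uv ne xMv; rewrite xCu.
  + case/andP: uu' => uu' _; have [E|ne] := eqVneq v u'; first by rewrite -E xCv in xu'.
    by rewrite eq_sym in uv; have := MC_disj uu' uv ne xMu; rewrite xCv.
  + case/andP: uu' => uu' r1; case/andP: vv' => vv' r2.
    have := M_disj uu' vv' _ _ xMu; rewrite xMv => H; apply: H.
      by apply: contraNneq uv => -[->].
    by apply/eqP => -[E1 E2]; subst; move: (ltn_trans r1 r2); rewrite ltnn.
- suff H u v : oriented u v -> exists x y, [/\ x \in branch u, y \in branch v & adj x y].
    move=> u v uv; have [lt|lt|E] := ltngtP (enum_rank u) (enum_rank v).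
    + by apply: H; rewrite /oriented uv.
    + have [|x [y [xv yu xy]]] := H v u; first by rewrite /oriented e_sym uv.
      by exists y, x; split=> //; rewrite adj_sym.
    + by move/val_inj/enum_rank_inj: E uv => ->; rewrite e_irr.
  move=> uv; have euv : e u v by case/andP: uv.
  have [x [xM xC]] := M_left euv; have [y [yM yC]] := M_right euv.
  have unv : u != v by apply: contraTneq euv => ->; rewrite e_irr.
  have xt : x \in tail u v.
    have xM' : x \in M u v :\: C v by rewrite inE xM (C_disj unv xC).
    by apply/setIdP; split=> //; apply/existsP; exists x; rewrite xC /within_connect connect0.
  (* On a walk in [M u v] from [C u] to [C v] the vertices stay in the tail until the first one in
     [C v], and this step is the required adjacency. *)
  have /connectP[p pp yE] := M_conn euv xM yM; clear xM xC.
  elim: p x xt pp yE => [|z p IH] x xt /=.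
    by move=> _ yE; have [_] := tM _ _ _ xt; rewrite -yE yC.
  case/andP=> /and3P[_ zM xz] pp yE; have [zC|zC] := boolP (z \in C v).
    exists x, z; split=> //; first by apply/branchP; right; exists v.
    by apply/branchP; left.
  by apply: (IH z _ pp yE); apply: tail_step xt _ xz; rewrite inE zM zC.
Qed.

End BranchSets.

(** * Topology of the surface *)

Section Gluing.
Local Open Scope classical_set_scope.
Local Open Scope ring_scope.
Variables (R : realType) (h c : nat).

(* In both kinds of gluing a point of circle [i] is glued to [partner i p], where
   the sum of the abscissae is [mirror_centre i]. *)
Definition mirror_centre (i : nat) : nat :=
  if (i < 2 * h)%N then (3 * (4 * i./2).+1)%N else (6 * i)%N.

Definition partner (i : nat) (p : R * R) : R * R :=
  ((mirror_centre i)%:R - p.1, if (i < 2 * h)%N then p.2 else - p.2).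

Definition partner_circle (i : nat) : nat :=
  if (i < 2 * h)%N then (if odd i then i.-1 else i.+1) else i.

Definition paired (p q : R * R) : Prop :=
  exists2 i, (i < 2 * h + c)%N & on_circle i p /\ q = partner i p.

Lemma on_circle_inj (i j : nat) (p : R * R) : on_circle i p -> on_circle j p -> i = j.
Proof.
rewrite /on_circle /sqdist_centre => Hi Hj.
have Hsq (k : nat) : (p.1 - (3 * k)%:R) ^+ 2 + p.2 ^+ 2 = 1 ->
    -1 <= p.1 - (3 * k)%:R <= 1.
  move=> H; have := sqr_ge0 p.2 => H2; apply/andP; split; nra.
have /andP[i1 i2] := Hsq _ Hi; have /andP[j1 j2] := Hsq _ Hj.
have : (3 * i)%:R < (3 * j + 3)%:R :> R by rewrite natrD; lra.
have : (3 * j)%:R < (3 * i + 3)%:R :> R by rewrite natrD; lra.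
rewrite !ltr_nat; lia.
Qed.

Lemma partner_circle_lt i : (i < 2 * h + c)%N -> (partner_circle i < 2 * h + c)%N.
Proof. rewrite /partner_circle; case: ifP => // H; case: ifP => Ho; lia. Qed.

Lemma partner_on_circle (i : nat) (p : R * R) :
  on_circle i p -> on_circle (partner_circle i) (partner i p).
Proof.
rewrite /on_circle /sqdist_centre /partner /partner_circle /mirror_centre /= => H.
case: ifP => H2; last first.
  rewrite -[RHS]H sqrrN; congr (_ + _); rewrite -[LHS]sqrrN; congr (_ ^+ 2).
  by rewrite !natrM; ring.
rewrite -[RHS]H; congr (_ + _); rewrite -[LHS]sqrrN; congr (_ ^+ 2).
have -> : (3 * (4 * i./2).+1)%:R = 12 * i./2%:R + 3 :> R.
  by rewrite natrM -[(4 * _).+1]addn1 natrD natrM; ring.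
have E : i%:R = (odd i)%:R + 2 * i./2%:R :> R.
  by rewrite -[in LHS](odd_double_half i) natrD -muln2 natrM mulrC; ring.
case: ifP E => Ho E; rewrite natrM.
- rewrite [in RHS]natrM E.
  have -> : i.-1%:R = 2 * i./2%:R :> R.
    by rewrite -natrM; congr (_%:R); have := odd_double_half i; rewrite Ho; lia.
  by rewrite /=; ring.
- by rewrite -[i.+1]addn1 natrD natrM E /=; ring.
Qed.

Lemma partnerK (i : nat) (p : R * R) : partner (partner_circle i) (partner i p) = p.
Proof.
have E : (partner_circle i < 2 * h)%N = (i < 2 * h)%N.
  by rewrite /partner_circle; case: ifP => // H; case: ifP => Ho; lia.
have E2 : mirror_centre (partner_circle i) = mirror_centre i.
  rewrite /mirror_centre E; case: ifP => H; rewrite /partner_circle H //.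
  case: ifP => Ho; lia.
rewrite /partner E E2 /=; case: p => x y /=; congr (_, _); first by ring.
by case: ifP => -> //; rewrite opprK.
Qed.

Lemma paired_sym p q : paired p q -> paired q p.
Proof.
case=> i ilt [ip ->]; exists (partner_circle i); first exact: partner_circle_lt.
by rewrite partnerK; split => //; exact: partner_on_circle.
Qed.

Lemma paired_fun p q r : paired p q -> paired p r -> q = r.
Proof.
by case=> i _ [ip ->] [j _ [jp ->]]; rewrite (on_circle_inj ip jp).
Qed.

Lemma glued_paired p q : glued h c p q -> paired p q.
Proof.
case=> [[j jh [pj _ ->]]|[j jc [pj ->]]].
- exists (2 * j)%N; first lia.
  split=> //; rewrite /partner /mirror_centre; have -> : (2 * j < 2 * h)%N by lia.
  by rewrite mul2n doubleK.
- exists (2 * h + j)%N; first lia.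
  split=> //; rewrite /partner /mirror_centre.
  by have -> : (2 * h + j < 2 * h)%N = false by lia.
Qed.

Lemma paired_glued p q : paired p q -> glued h c p q \/ glued h c q p.
Proof.
case=> i ilt [ip ->]; have [ih|ih] := ltnP i (2 * h); last first.
  left; right; exists (i - 2 * h)%N; first lia.
  rewrite (_ : (2 * h + (i - 2 * h) = i)%N); last lia.
  split=> //; rewrite /partner /mirror_centre.
  by have -> : (i < 2 * h)%N = false by lia.
have := odd_double_half i; case Ho : (odd i) => Ei.
- right; left; exists i./2; first lia.
  have := partner_on_circle ip; rewrite /partner_circle ih Ho => Hq.
  have E : (2 * i./2 = i.-1)%N by lia.
  rewrite E; split => //; first by rewrite prednK //; lia.
  rewrite /partner ih /mirror_centre ih /=; case: p {ip Hq} => x y /=.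
  by congr (_, _); ring.
- left; left; exists i./2; first lia.
  have := partner_on_circle ip; rewrite /partner_circle ih Ho => Hq.
  have E : (2 * i./2 = i)%N by lia.
  rewrite E; split => //.
  by rewrite /partner ih /mirror_centre ih.
Qed.

Local Notation X := (set_type (@holed_sphere R h c)).

(** Pairing is symmetric and, as distinct circles are disjoint, single-valued; so the generated
    equivalence closes after one step. *)
Lemma glue_equivP (x y : X) :
  reflect (x = y \/ exists p q, [/\ set_val x = Some p, set_val y = Some q & paired p q])
    (glue_equiv x y).
Proof.
apply: (iffP (asboolP _)) => [|[->|[p [q [xp yq /paired_glued [pq|qp]]]]]].
- elim=> {x y} [x y [p [q [xp yq pq]]]|x|x y _ [->|[p [q [xp yq pq]]]]|x y z _ H1 _ H2].
  + by right; exists p, q; split => //; exact: glued_paired.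
  + by left.
  + by left.
  + by right; exists q, p; split => //; exact: paired_sym.
  + case: H1 => [->//|[p [q [xp yq pq]]]]; case: H2 => [<-|[q' [r [yq' zr qr]]]].
      by right; exists p, q.
    left; apply: val_inj; move: yq'; rewrite yq => -[?]; subst q'.
    rewrite -!set_valE /= in xp zr *.
    by rewrite xp zr (paired_fun (paired_sym pq) qr).
- exact: rst_refl.
- by apply: rst_step; exists p, q.
- by apply: rst_sym; apply: rst_step; exists q, p.
Qed.

End Gluing.

(** * Separation properties of the quotient *)

Section SurfaceTopology.
Local Open Scope classical_set_scope.
Local Open Scope ring_scope.
Variables (R : realType) (h c : nat).

Local Notation plane := (R * R)%type.
Local Notation opc := (one_point_compactification plane).
Local Notation holed := (@holed_sphere R h c).
Local Notation X := (set_type holed).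
Local Notation S := (surface R h c).

Definition proj_surface (x : X) : S := (\pi_S x)%qT.

Definition image_surface (F : set opc) : set S :=
  [set s | exists2 x : X, F (set_val x) & proj_surface x = s].

Definition preim_surface (K : set S) : set opc :=
  [set z | exists2 x : X, set_val x = z & K (proj_surface x)].

Lemma proj_surface_eq (x y : X) :
  proj_surface x = proj_surface y <->
  x = y \/ exists p q, [/\ set_val x = Some p, set_val y = Some q & paired h c p q].
Proof.
split=> [/eqmodP|] H; first exact/glue_equivP.
exact/eqmodP/glue_equivP.
Qed.

Lemma proj_surface_surj (s : S) : exists x, proj_surface x = s.
Proof. by exists (repr s); exact: reprK. Qed.

Lemma holed_val (x : X) : holed (set_val x).
Proof. exact: set_valP. Qed.

Lemma closed_some (K : set plane) : compact K -> closed K -> closed (Some @` K : set opc).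
Proof.
move=> cK clK; rewrite -openC openE => -[p|] /= Hp.
- rewrite /interior nbhsE /=; exists (Some @` (~` K)).
    split; last by exists p => // Kp; apply: Hp; exists p.
    by apply: one_point_compactification_open_some; rewrite openC.
  by move=> z [q Kq <-] /= [r Kr [rq]]; apply: Kq; rewrite -rq.
- by exists K => // z [[q Kq <-]|->] /= [r Kr] // [rq]; apply: Kq; rewrite -rq.
Qed.

Lemma plane_hausdorff : hausdorff_space plane.
Proof. exact: norm_hausdorff. Qed.

Lemma compact_square (b : R) : compact ([set p : plane | `|p.1| <= b /\ `|p.2| <= b]).
Proof.
have -> : [set p : plane | `|p.1| <= b /\ `|p.2| <= b] = `[- b, b] `*` `[- b, b].
  apply/seteqP; split => -[x y] /=; rewrite !in_itv /= -!ler_norml => -[? ?] //.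
apply: compact_setX; exact: segment_compact.
Qed.

Lemma plane_locally_compact : locally_compact [set: plane].
Proof.
move=> x _; rewrite withinET.
exists ([set p : plane | `|p.1| <= `|x| + 1 /\ `|p.2| <= `|x| + 1]).
  apply/nbhs_ballP; exists 1 => //= -[u v] [].
  rewrite /ball /= => Hu Hv; have : `|x.1| <= `|x| /\ `|x.2| <= `|x|.
    by rewrite prod_normE !le_max !lexx orbT.
  case=> H1 H2.
  have := ler_normB x.1 (x.1 - u); have := ler_normB x.2 (x.2 - v).
  rewrite !opprB !(addrC _ (_ - _)) !subrK => ? ?; split; lra.
split; first exact: compact_square.
by apply: compact_closed; [exact: plane_hausdorff|exact: compact_square].
Qed.

Lemma opc_hausdorff : hausdorff_space opc.
Proof.
apply: one_point_compactification_hausdorff; first exact: plane_locally_compact.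
exact: plane_hausdorff.
Qed.

Lemma opc_normal : normal_space opc.
Proof.
by apply: compact_normal; [exact: opc_hausdorff|exact: one_point_compactification_compact].
Qed.

Lemma sqdist_centre_continuous i : continuous (sqdist_centre i : plane -> R).
Proof.
move=> p; rewrite /sqdist_centre.
apply: cvgD.
- rewrite expr2; under eq_fun do rewrite expr2.
  by apply: cvgM; apply: cvgB; (exact: cvg_fst || exact: cvg_cst).
- rewrite expr2; under eq_fun do rewrite expr2.
  by apply: cvgM; exact: cvg_snd.
Qed.

Lemma circle_closed i : closed [set p : plane | on_circle i p].
Proof.
rewrite (_ : [set _ | _] = (sqdist_centre i : plane -> R) @^-1` [set x | x = 1]) //.
by apply: preimage_closed => // p _; exact: sqdist_centre_continuous.
Qed.

Lemma circle_compact i : compact [set p : plane | on_circle i p].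
Proof.
apply: (subclosed_compact (circle_closed (i := i)) (@compact_square ((3 * i)%:R + 1))).
move=> p /=; rewrite /on_circle /sqdist_centre => H.
have i0 : 0 <= (3 * i)%:R :> R by [].
move: (3 * i)%:R i0 H => a a0 H.
have := sqr_ge0 p.2; have := sqr_ge0 (p.1 - a) => H1 H2.
rewrite !ler_norml; split; apply/andP; split; nra.
Qed.

Lemma partner_continuous i : continuous (partner h i : plane -> plane).
Proof.
move=> p; rewrite /partner; apply: (@cvg_pair _ _ _ _ (nbhs _) (nbhs _)).
  by apply: cvgB; [exact: cvg_cst|exact: cvg_fst].
case: ifP => _; first exact: cvg_snd.
by apply: cvgN; exact: cvg_snd.
Qed.

Lemma holed_closed : closed holed.
Proof.
rewrite -openC openE => -[p|] /=; last by case.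
move=> /existsNP[q /not_implyP[[<-]]] /existsNP[i /not_implyP[ilt lt1]].
rewrite /interior nbhsE /=; exists (Some @` [set r : plane | sqdist_centre i r < 1]).
  split; last by exists p => //=; rewrite ltNge; exact/negP.
  apply: one_point_compactification_open_some.
  rewrite (_ : [set _ | _] = sqdist_centre i @^-1` [set x | x < 1]) //.
  by apply: open_comp => // r _; exact: sqdist_centre_continuous.
by move=> z [r /= r1 <-] /(_ r erefl i ilt); rewrite leNgt r1.
Qed.

Lemma open_sub_ex (U : set X) : open U -> exists2 W : set opc, open W & U = set_val @^-1` W.
Proof. by case=> W oW <-; exists W. Qed.

Lemma preim_closed (K : set S) : closed K -> closed (preim_surface K).
Proof.
rewrite -openC => /open_sub_ex[W oW WE].
rewrite (_ : preim_surface K = ~` W `&` holed).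
  by apply: closedI; [rewrite closedC|exact: holed_closed].
apply/seteqP; split=> [z [x <- Kx]|z [Wz hz]].
  split; last exact: holed_val.
  move=> Wx; have : (set_val @^-1` W) x by [].
  by rewrite -WE; apply.
exists (SigSub (mem_set hz)) => //; apply: contrapT => nK.
suff : (set_val @^-1` W) (SigSub (mem_set hz)) by [].
by rewrite -WE.
Qed.

(** The saturation of [F] consists of [F] and, for each circle, the compact set of its points whose
    partner lies in [F]: finitely many closed sets. *)
Lemma image_closed (F : set opc) : closed F -> closed (image_surface F).
Proof.
move=> clF.
pose F' : set plane := Some @^-1` F.
have clF' : closed F'.
  by apply: preimage_closed clF => p _; exact: one_point_compactification_some_continuous.
pose G i : set opc := Some @` ([set p | on_circle i p] `&` partner h i @^-1` F').
have clG i : closed (G i).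
  have cl : closed (partner h i @^-1` F').
    by apply: preimage_closed => // p _; exact: partner_continuous.
  apply: closed_some; first by apply: compact_closedI => //; exact: circle_compact.
  by apply: closedI => //; exact: circle_closed.
have cl2 : closed (F `|` \bigcup_(i in `I_(2 * h + c)) G i).
  by apply: closedU => //; apply: closed_bigcup => //; exact: finite_II.
rewrite -openC; exists (~` (F `|` \bigcup_(i in `I_(2 * h + c)) G i)); first by rewrite openC.
apply/seteqP; split=> x /=; last first.
  apply: contra_not => -[Fx|[i /= ilt [p [ip /= Fp] px]]]; first by exists x.
  (* The partner lies on a circle and hence outside the other open discs, whose centres are at
     distance at least 3 from its own. *)
  have hq : holed (Some (partner h i p)).
    move=> _ [<-] j jlt; have [jE|jE] := eqVneq j (partner_circle h i).
      by rewrite jE (partner_on_circle h ip).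
    have hx : holed (Some p) by rewrite px; exact: holed_val.
    have := partner_on_circle h ip.
    move: (partner h i p) => q {}ip; move: ip jE; move: (partner_circle h i) => k.
    rewrite /on_circle /sqdist_centre => H jk.
    have jk3 : (3 * k)%:R + 3 <= (3 * j)%:R :> R \/ (3 * j)%:R + 3 <= (3 * k)%:R :> R.
      move: jk; rewrite neq_ltn => /orP[jk|jk]; [right|left];
      by rewrite -natrD ler_nat; lia.
    move: (3 * j)%:R (3 * k)%:R jk3 H => a b ab H.
    have := sqr_ge0 q.2; have := sqr_ge0 (q.1 - b) => H1 H2.
    have : -1 <= q.1 - b <= 1 by apply/andP; split; nra.
    by case/andP=> H3 H4; case: ab => ab; nra.
  exists (SigSub (mem_set hq)) => //.
  apply/proj_surface_eq; right; exists (partner h i p), p; split=> //.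
  by apply: paired_sym; exists i.
move=> nF [y Fy xy]; apply: nF.
have /proj_surface_eq[<-|[p [q [yp xq pq]]]] := xy; first by left.
right; have [i ilt [iq pE]] := paired_sym pq; exists i => //.
by exists q => //; split => //=; move: Fy; rewrite yp pE.
Qed.

(** Fibres of distinct points are disjoint closed sets in a normal space. As the quotient map is
    closed, complements of images of closed sets are open and turn a separation of the fibres into
    one of the points. *)
Lemma surface_hausdorff : hausdorff_space S.
Proof.
have clS (s : S) : closed [set s].
  have [x <-] := proj_surface_surj s.
  rewrite (_ : [set _] = image_surface [set set_val x]).
    by apply: image_closed; apply: accessible_closed_set1;
       apply: hausdorff_accessible; exact: opc_hausdorff.
  apply/seteqP; split=> [_ -> /=|_ [y yx <-] /=]; first by exists x.
  by congr proj_surface; apply: val_inj; move: yx; rewrite -!set_valE.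
move=> p q clpq; apply: contrapT => npq.
have [] := @opc_normal _ (preim_closed (clS p)) (~` preim_surface [set q]).
  apply/set_nbhsP; exists (~` preim_surface [set q]); split => //.
    by rewrite openC; exact: preim_closed.
  by move=> z [x <- /= xp] [y /val_inj yx yq]; apply: npq; rewrite -xp -yq yx.
move=> U /set_nbhsP[V [oV pV VU]] clU.
have clU2 : closed (closure U) by exact: closed_closure.
have o1 : open (~` image_surface (~` V)).
  by rewrite openC; apply: image_closed; rewrite closedC.
have o2 : open (~` image_surface (closure U)).
  by rewrite openC; exact: image_closed.
have p1 : (~` image_surface (~` V)) p.
  by move=> [x Vx xp]; apply: Vx; apply: pV; exists x.
have q2 : (~` image_surface (closure U)) q.
  by move=> [x Ux xq]; apply: (clU _ Ux); exists x.
have [s [s1 s2]] := clpq _ _ (open_nbhs_nbhs (conj o1 p1)) (open_nbhs_nbhs (conj o2 q2)).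
have [x xs] := proj_surface_surj s.
apply: s1; exists x => // Vx; apply: s2; exists x => //.
by apply: subset_closure; exact: VU.
Qed.

Lemma compact_preim_closed (K : set S) : compact K -> closed (preim_surface K).
Proof.
by move=> cK; apply: preim_closed; apply: compact_closed => //; exact: surface_hausdorff.
Qed.

End SurfaceTopology.

(** * A grid on the surface *)

(* Pushing the upper and lower half-planes vertically onto the axis collapses
   hole [k] to the slit [3k - 1, 3k + 1].  At resolution [n] the abscissa [x] has
   grid coordinate [n (x + n)]; [slit k] is the left end of slit [k]. *)
Section SurfaceGrid.
Variables (h c n : nat).
Local Notation H := (2 * h + c).
Hypothesis n_large : 3 * H + 3 <= n.

(** Grid lines are [1 / n] apart and span the abscissae from [-n] to [n] and heights up to [n].
    Growing [n] makes the grid finer and larger at once, so a single limit also deals with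
    infinity. *)
Definition grid_width := 2 * n * n.
Definition grid_height := n * n.
Local Notation W := grid_width.
Local Notation L := grid_height.

Definition slit (k : nat) : nat := n * (n + 3 * k) - n.

Lemma slitE k : slit k + n = n * (n + 3 * k).
Proof. by rewrite /slit subnK //; apply: leq_pmulr; lia. Qed.

Lemma slit_lt k k' : k < k' -> slit k + 2 * n + n <= slit k'.
Proof. have := slitE k; have := slitE k'; nia. Qed.

Lemma slit_end k : k < H -> slit k + 2 * n < W.
Proof. have := slitE k; rewrite /W; nia. Qed.

Lemma slit_pos k : 0 < slit k.
Proof. have := slitE k; nia. Qed.

(* The axis outside the slits, the two sides of handle [j], and cross-cap [j]. *)
Definition interval := ('I_H.+1 + 'I_h * bool + 'I_c)%type.

(** [inl k] is the gap to the left of slit [k], or to the right of all slits if [k] is their number;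
    [inr k] is slit [k]. *)
Definition region := (nat + nat)%type.

Definition region_lo (r : region) : nat :=
  match r with inl 0 => 0 | inl k.+1 => slit k + 2 * n | inr k => slit k end.

Definition region_hi (r : region) : nat :=
  match r with inl k => if k < H then slit k else W | inr k => slit k + 2 * n end.

Definition region_ok (r : region) := match r with inl k => k <= H | inr k => k < H end.

Lemma region_lo_hi r : region_ok r -> region_lo r <= region_hi r <= W.
Proof.
case: r => [[|k]|k] /= kH.
- by case: ifP => // H0; apply: ltnW; have := @slit_end 0; lia.
- case: ifP => kH2; last by have := @slit_end k; lia.
  by have := @slit_lt k k.+1; have := @slit_end k.+1; lia.
- by have := @slit_end k; lia.
Qed.

Lemma region_inj r r' a : region_ok r -> region_ok r' ->
  region_lo r <= a < region_hi r -> region_lo r' <= a < region_hi r' -> r = r'.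
Proof.
(* This order only halves the case analysis: gaps precede slits in it wherever they lie on the
   axis. *)
wlog le : r r' / match r, r' with
    | inl k, inl k' => k <= k' | inl _, inr _ => true
    | inr _, inl _ => false | inr k, inr k' => k <= k' end.
  move=> WL ok ok' ra ra'; case: r r' ok ok' ra ra' => k [] k' ok ok' ra ra'.
  - by have [le|/ltnW le] := leqP k k'; [|apply/esym]; apply: WL.
  - exact: WL.
  - by apply/esym; apply: WL.
  - by have [le|/ltnW le] := leqP k k'; [|apply/esym]; apply: WL.
case: r r' le => k [] k' le ok ok' /andP[la ha] /andP[la' ha'] //=.
- have [<-//|/eqP kk'] := k =P k'; exfalso.
  have kH : k < H by move: ok' => /=; lia.
  move: la' ha; rewrite /= kH; case: k' kk' le {ok' ha'} => [|k'] kk' le; first lia.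
  have [/slit_lt|?] := ltnP k k'; first lia.
  have -> : k' = k by lia.
  lia.
- exfalso; move: la ha la' ha' => /=; have [lt|le'] := ltnP k' k.
    case: k {le ok} lt => // k lt; case: ifP => _;
    (have [/slit_lt|?] := ltnP k' k; first lia);
    (have -> : k' = k by lia); lia.
  have kH : k < H by move: ok' => /=; lia.
  rewrite kH; have [<-|/eqP kk'] := k =P k'; first lia.
  have lt : k < k' by lia.
  by move=> _; have := slit_lt lt; lia.
- have [<-//|/eqP kk'] := k =P k'; exfalso; move: la' ha => /=.
  have lt : k < k' by lia.
  by have := slit_lt lt; lia.
Qed.

(** [b] names an end of the rungs. A handle interval leads from slit [2 * j] to slit [2 * j + 1]
    within one half-plane; a gap or a cross-cap leads from the upper half-plane to the same region
    in the lower one. *)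
Definition region_of (i : interval) (b : bool) : region :=
  match i with
  | inl (inl i) => inl (val i)
  | inl (inr (j, _)) => inr (2 * j + ~~ b)
  | inr j => inr (2 * h + j)
  end.

Definition ilen (i : interval) := region_hi (region_of i true) - region_lo (region_of i true).

(** Gluing reflects abscissae, so handles and cross-caps run backwards along their second end. *)
Definition irev (i : interval) : bool := if i is inl (inl _) then false else true.

Definition iside (i : interval) (b : bool) : bool :=
  if i is inl (inr (_, s)) then s else b.

Lemma region_of_ok i b : region_ok (region_of i b).
Proof.
case: i => [[i|[j s]]|j] /=; first by rewrite -ltnS.
  by have := ltn_ord j; case: b => /=; lia.
by rewrite ltn_add2l.
Qed.

Lemma ilenE i b : region_lo (region_of i b) + ilen i = region_hi (region_of i b).
Proof.
have /andP[l1 l2] := region_lo_hi (region_of_ok i b).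
have /andP[l3 l4] := region_lo_hi (region_of_ok i true).
rewrite /ilen; case: i l1 l2 l3 l4 => [[i|[j s]]|j] /=; case: b => /=; lia.
Qed.

Lemma iend_bound i b t : t <= ilen i -> region_lo (region_of i b) + t < W.+1.
Proof.
move=> tl; have := ilenE i b; have /andP[_] := region_lo_hi (region_of_ok i b); lia.
Qed.

Lemma iedge_bound i b t : t < ilen i -> region_lo (region_of i b) + t < W.
Proof.
move=> tl; have := ilenE i b; have /andP[_] := region_lo_hi (region_of_ok i b); lia.
Qed.

Definition ipos (i : interval) (b : bool) (t : 'I_(ilen i).+1) : 'I_W.+1 :=
  if b || ~~ irev i then Ordinal (iend_bound b (leq_ord t))
  else Ordinal (iend_bound b (leq_subr t (ilen i))).

Lemma rev_edge_bound m (t : 'I_m) : m - t.+1 < m.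
Proof. by have := ltn_ord t; lia. Qed.

(** Under reversal vertex [t] goes to [ilen i - t], so the edge from [t] to [t.+1] goes to the one
    with left end [ilen i - t.+1]. *)
Definition iedge (i : interval) (b : bool) (t : 'I_(ilen i)) : 'I_W :=
  if b || ~~ irev i then Ordinal (iedge_bound b (ltn_ord t))
  else Ordinal (iedge_bound b (rev_edge_bound t)).

Lemma iedge_follows b i : follows (@iedge i b) (@ipos i b).
Proof.
move=> t; rewrite /iedge /ipos; case: ifP => _; [left|right]; split; apply: val_inj => /=.
all: have := ltn_ord t; rewrite /bump /=; lia.
Qed.

Definition ibdry (u : {i : interval & 'I_(ilen i)}) (b : bool) : bool * nat :=
  if b then (iside (tag u) true, val (@iedge _ true (tagged u)))
  else (iside (tag u) false, val (@iedge _ false (tagged u))).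

(** Regions do not overlap, so the position determines the region. The half-plane then separates the
    two ends of a gap or cross-cap and the two intervals of a handle. *)
Lemma ibdry_inj u u' b b' : ibdry u b = ibdry u' b' -> u = u' /\ b = b'.
Proof.
have E v d : ibdry v d = (iside (tag v) d, val (@iedge _ d (tagged v))) by case: d.
have rng (v : {i : interval & 'I_(ilen i)}) (d : bool) : region_lo (region_of (tag v) d) <= nat_of_ord (@iedge _ d (tagged v))
    < region_hi (region_of (tag v) d).
  rewrite -ilenE /iedge; have := ltn_ord (tagged v).
  by case: ifP => _ /=; lia.
rewrite !E => -[sE aE].
have rE : region_of (tag u) b = region_of (tag u') b'.
  apply: (region_inj (region_of_ok _ _) (region_of_ok _ _) (rng u b)).
  by rewrite aE; exact: rng.
have ltj (j : 'I_h) (x : bool) : 2 * j + x < 2 * h by have := ltn_ord j; case: x; lia.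
have fin : tag u = tag u' -> b = b' -> u = u' /\ b = b'.
  case: u u' {sE rng E rE} aE => i t [i' t'] /= + ii bb; subst i' b'.
  move=> aE; split=> //; congr existT; apply: val_inj; move: aE.
  rewrite /iedge; case: ifP => _ /=; first by move/addnI.
  by have := ltn_ord t; have := ltn_ord t'; lia.
apply: fin.
- move: rE sE; case: (tag u) => [[i|[j s]]|j]; case: (tag u') => [[i'|[j' s']]|j'] //=.
  + by move=> [/val_inj ->].
  + by move=> [rE] ->; congr (inl (inr (_, _))); apply: val_inj => /=;
      case: (b) (b') rE => -[] /=; lia.
  + by move=> [rE]; have := ltj j (~~ b); lia.
  + by move=> [rE]; have := ltj j' (~~ b'); lia.
  + by move=> [rE] _; congr inr; apply: val_inj => /=; lia.
- move: rE sE; case: (tag u) => [[i|[j s]]|j]; case: (tag u') => [[i'|[j' s']]|j'] //=.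
  + by move=> [rE] _; case: (b) (b') rE => -[] /=; lia.
  + by move=> [rE]; have := ltj j (~~ b); lia.
  + by move=> [rE]; have := ltj j' (~~ b'); lia.
Qed.

Definition snode := gnode W L.
Definition sedge := gedge W L ilen.
Definition scell := gcell W L ilen.
Definition ssrc : sedge -> snode :=
  @gsrc W L interval ilen (iside^~ true) (fun i => @ipos i true).
Definition stgt : sedge -> snode :=
  @gtgt W L interval ilen (iside^~ false) (fun i => @ipos i false).
Definition sside : scell -> 'I_4 -> sedge :=
  @gside W L interval ilen (iside^~ true) (iside^~ false) (fun i => @iedge i true) (fun i => @iedge i false).
Definition sclass : sedge -> option interval := @gclass W L interval ilen.

(** There are [H + 1] gaps, [2 * h] handle sides and [c] cross-caps; one more class holds the grid
    edges. *)
Lemma card_sclass : #|{: option interval}| = 2 * H + 2.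
Proof. rewrite card_option !card_sum card_prod !card_ord card_bool; lia. Qed.

Definition sadj (x y : snode) :=
  [exists a : sedge, ((ssrc a == x) && (stgt a == y)) || ((ssrc a == y) && (stgt a == x))].

Lemma surface_grid_edge_bound (T : finType) (e : rel T) (Bl : T -> {set snode}) :
  symmetric e -> irreflexive e -> girth_at_least 9 e ->
  (forall u, Bl u != finset.set0) ->
  (forall u, {in Bl u &, forall x y, within_connect sadj (Bl u) x y}) ->
  (forall u v x, x \in Bl u -> x \in Bl v -> u = v) ->
  (forall u v, e u v -> exists x y, [/\ x \in Bl u, y \in Bl v & sadj x y]) ->
  7 * #|[set p : T * T | e p.1 p.2]| <= 18 * (#|T| + (2 * H + 2)).
Proof.
move=> esym eirr girth Bl0 Bll Bld Ble; rewrite -card_sclass.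
apply: (@surface_minor_edge_bound _ _ _ _ ssrc stgt sclass sside _ _ _ _ e Bl) => //.
- exact: gside_le2 ibdry_inj.
- apply: gside_closed; exact: iedge_follows.
- apply: gcocycle; exact: iedge_follows.
- move=> u v /Ble[x [y [xu yv /existsP[a /orP[]]]]] /andP[/eqP sx /eqP ty];
  exists a; rewrite sx ty; by [left|right].
Qed.

Lemma sadj_sym x y : sadj x y = sadj y x.
Proof. by apply: eq_existsb => a; rewrite orbC. Qed.

Lemma sadjH s (a : 'I_W) (b : 'I_L.+1) : sadj (s, lo a, b) (s, hi a, b).
Proof. by apply/existsP; exists (Hedge _ s a b); rewrite /= !eqxx. Qed.

Lemma sadjV s (a : 'I_W.+1) (b : 'I_L) : sadj (s, a, lo b) (s, a, hi b).
Proof. by apply/existsP; exists (Vedge _ s a b); rewrite /= !eqxx. Qed.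

Lemma sadj_rung (i : interval) (t : 'I_(ilen i).+1) :
  sadj (iside i true, @ipos i true t, ord0) (iside i false, @ipos i false t, ord0).
Proof. by apply/existsP; exists (Rung _ _ t); rewrite /= !eqxx. Qed.

Lemma sadj_outside (t : 'I_W.+1) :
  (forall k, k < H -> t <= slit k \/ slit k + 2 * n <= t) ->
  sadj (true, t, ord0) (false, t, ord0).
Proof.
move=> out.
have [k kH [kl kh]] : exists2 k, k <= H & region_lo (inl k) <= t /\ t <= region_hi (inl k).
  have [/forallP all_le|] := boolP [forall k : 'I_H, slit k + 2 * n <= t].
    exists H => //; split; last by rewrite /= ltnn -ltnS.
    rewrite /=; case E : (H) => [//|k]; have kH : k < H by rewrite E.
    exact: (all_le (Ordinal kH)).
  rewrite negb_forall => /existsP[k0 k0P].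
  (* The gap at [t] is the one left of the first slit whose right end is beyond [t]. *)
  have ex : exists k, (k < H) && ~~ (slit k + 2 * n <= t) by exists k0; rewrite ltn_ord.
  case: (ex_minnP ex) => k /andP[kH kt] kmin; exists k; first exact: ltnW.
  split; last by rewrite /= kH; case: (out k kH) => //; rewrite (negbTE kt).
  case: k kH kt kmin => // k kH kt kmin /=; rewrite leqNgt; apply/negP => kt'.
  by have := kmin k; rewrite -ltnNge kt' (ltnW kH) => /(_ isT); rewrite ltnn.
have kH' : k < H.+1 by [].
pose i : interval := inl (inl (Ordinal kH')).
have tl : t - region_lo (inl k) < (ilen i).+1.
  have E : region_lo (inl k) + ilen i = region_hi (inl k) := ilenE i true.
  move: kl kh E; move: (region_lo _) (region_hi _) => x y; lia.
have := sadj_rung (Ordinal tl); rewrite /ipos /=.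
set o1 := Ordinal _; set o2 := Ordinal _.
have -> : o1 = t by apply: val_inj; rewrite /= subnKC.
by have -> : o2 = t by apply: val_inj; rewrite /= subnKC.
Qed.

Lemma sadj_handle j s (t t' : 'I_W.+1) : j < h ->
  slit (2 * j) <= t <= slit (2 * j) + 2 * n ->
  t + t' = slit (2 * j) + slit (2 * j).+1 + 2 * n ->
  sadj (s, t, ord0) (s, t', ord0).
Proof.
move=> jh tr tt'; pose i : interval := inl (inr (Ordinal jh, s)).
have il : ilen i = 2 * n by rewrite /ilen /= addKn.
have tl : t - slit (2 * j) < (ilen i).+1 by rewrite il; lia.
have := sadj_rung (Ordinal tl); rewrite /ipos /=.
set o1 := Ordinal _; set o2 := Ordinal _.
have -> : o1 = t by apply: val_inj; rewrite /= ?addn0 subnKC //; lia.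
by have -> : o2 = t' by apply: val_inj; rewrite /= il ?addn1; lia.
Qed.

Lemma sadj_crosscap j (t t' : 'I_W.+1) : j < c ->
  slit (2 * h + j) <= t <= slit (2 * h + j) + 2 * n ->
  t + t' = slit (2 * h + j) + slit (2 * h + j) + 2 * n ->
  sadj (true, t, ord0) (false, t', ord0).
Proof.
move=> jc tr tt'; pose i : interval := inr (Ordinal jc).
have il : ilen i = 2 * n by rewrite /ilen /= addKn.
have tl : t - slit (2 * h + j) < (ilen i).+1 by rewrite il; lia.
have := sadj_rung (Ordinal tl); rewrite /ipos /=.
set o1 := Ordinal _; set o2 := Ordinal _.
have -> : o1 = t by apply: val_inj; rewrite /= subnKC //; lia.
by have -> : o2 = t' by apply: val_inj; rewrite /= il; lia.
Qed.

Definition square := (bool * 'I_W * 'I_L)%type.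

Definition is_corner (m : nat) (a : 'I_m) (t : 'I_m.+1) : bool := (t == lo a) || (t == hi a).

(* [None] is the tile of the points at or near infinity. *)
Definition frame (x : snode) : bool :=
  [|| val x.1.2 == 0, val x.1.2 == W | val x.2 == L].

Definition tile_nodes (q : option square) : {set snode} :=
  match q with
  | Some (s, a, b) => [set x | [&& x.1.1 == s, is_corner a x.1.2 & is_corner b x.2]]
  | None => [set x | frame x]
  end.

Definition sconnect (B : {set snode}) : rel snode := within_connect sadj B.

Lemma sconnect_sym B x y : sconnect B x y = sconnect B y x.
Proof. exact: within_connect_sym sadj_sym _ _ _. Qed.

Lemma sconnect_trans B : transitive (sconnect B).
Proof. exact: connect_trans. Qed.

Lemma sconnect1 (B : {set snode}) x y : x \in B -> y \in B -> sadj x y -> sconnect B x y.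
Proof. by move=> xB yB xy; apply: connect1; rewrite xB yB. Qed.

Lemma tile_connected q : {in tile_nodes q &, forall x y, sconnect (tile_nodes q) x y}.
Proof.
case: q => [[[s a] b]|].
  have mem t u : is_corner a t -> is_corner b u -> (s, t, u) \in tile_nodes (Some (s, a, b)).
    by move=> Ht Hu; rewrite inE /= eqxx Ht.
  have la : is_corner a (lo a) by rewrite /is_corner eqxx.
  have ha : is_corner a (hi a) by rewrite /is_corner eqxx orbT.
  have lb : is_corner b (lo b) by rewrite /is_corner eqxx.
  have hb : is_corner b (hi b) by rewrite /is_corner eqxx orbT.
  have toroot x : x \in tile_nodes (Some (s, a, b)) ->
      sconnect (tile_nodes (Some (s, a, b))) x (s, lo a, lo b).
    case: x => [[s' t] u]; rewrite inE /= => /and3P[/eqP -> Ht Hu].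
    apply: (@sconnect_trans _ (s, lo a, u)).
      case/orP: (Ht) => /eqP ->; first exact: connect0.
      by rewrite sconnect_sym; apply: sconnect1; [exact: mem|exact: mem|exact: sadjH].
    case/orP: (Hu) => /eqP ->; first exact: connect0.
    by rewrite sconnect_sym; apply: sconnect1; [exact: mem|exact: mem|exact: sadjV].
  move=> x y xB yB; apply: sconnect_trans (toroot x xB) _.
  by rewrite sconnect_sym; exact: toroot.
have mem0 s (b : 'I_L.+1) : (s, ord0, b) \in tile_nodes None by rewrite inE.
have memW s (b : 'I_L.+1) : (s, ord_max, b) \in tile_nodes None.
  by rewrite inE /frame /= eqxx orbT.
have memL s (a : 'I_W.+1) : (s, a, ord_max) \in tile_nodes None.
  by rewrite inE /frame /= eqxx !orbT.
have left s b : sconnect (tile_nodes None) (s, ord0, ord0) (s, ord0, b).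
  elim/lo_hi_ind: b => [|k IH]; first exact: connect0.
  by apply: sconnect_trans IH _; apply: sconnect1 => //; exact: sadjV.
have top s a : sconnect (tile_nodes None) (s, ord0, ord_max) (s, a, ord_max).
  elim/lo_hi_ind: a => [|k IH]; first exact: connect0.
  by apply: sconnect_trans IH _; apply: sconnect1 => //; exact: sadjH.
have right0 s b : sconnect (tile_nodes None) (s, ord_max, ord0) (s, ord_max, b).
  elim/lo_hi_ind: b => [|k IH]; first exact: connect0.
  by apply: sconnect_trans IH _; apply: sconnect1 => //; exact: sadjV.
have toroot x : x \in tile_nodes None -> sconnect (tile_nodes None) (x.1.1, ord0, ord0) x.
  case: x => [[s a] b]; rewrite inE /frame /= => /or3P[] /eqP E.
  - by rewrite (_ : a = ord0) //; exact: val_inj.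
  - rewrite (_ : a = ord_max); last exact: val_inj.
    apply: sconnect_trans (left s ord_max) _; apply: sconnect_trans (top s ord_max) _.
    by apply: (@sconnect_trans _ (s, ord_max, ord0)) => //; rewrite sconnect_sym.
  - rewrite (_ : b = ord_max); last exact: val_inj.
    by apply: sconnect_trans (left s ord_max) _.
(* The frames of the two half-planes are joined by the rung at the left end of the axis, which is
   outside all slits. *)
have swap s : sconnect (tile_nodes None) (true, ord0, ord0) (s, ord0, ord0).
  case: s; first exact: connect0.
  by apply: sconnect1 => //; apply: sadj_outside => k _; left.
move=> x y xB yB; apply: (@sconnect_trans _ (true, ord0, ord0)).
  rewrite sconnect_sym; apply: sconnect_trans (swap x.1.1) _; exact: toroot.
by apply: sconnect_trans (swap y.1.1) _; exact: toroot.
Qed.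

End SurfaceGrid.

(** * Closed tiles covering the holed sphere *)

Section Tiles.
Local Open Scope classical_set_scope.
Local Open Scope ring_scope.
Variables (R : realType) (h c : nat).
Local Notation H := (2 * h + c)%N.
Local Notation plane := (R * R)%type.
Local Notation opc := (one_point_compactification plane).
Local Notation holed := (@holed_sphere R h c).

(* [Num.sqrt] is 0 on negative numbers, so at most one term is nonzero. *)
Definition hole_height (x : R) : R :=
  \sum_(i < H) Num.sqrt (1 - (x - (3 * i)%:R) ^+ 2).

Local Notation w := hole_height.

Lemma hole_height_ge0 x : 0 <= w x.
Proof. by apply: sumr_ge0 => i _; exact: sqrtr_ge0. Qed.

Lemma sqrt_far (i : nat) (x : R) : 1 <= `|x - (3 * i)%:R| ->
  Num.sqrt (1 - (x - (3 * i)%:R) ^+ 2) = 0.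
Proof.
move=> far; apply/eqP; rewrite sqrtr_eq0 subr_le0.
rewrite -real_normK ?num_real //; set d := `| _ | in far *; nra.
Qed.

Lemma hole_height_near (k : nat) (x : R) : (k < H)%N -> `|x - (3 * k)%:R| <= 1 ->
  w x = Num.sqrt (1 - (x - (3 * k)%:R) ^+ 2).
Proof.
move=> kH near; rewrite /w (bigD1 (Ordinal kH)) //= big1 ?addr0 // => i ik.
apply: sqrt_far.
have : (3 * i)%:R + 3 <= (3 * k)%:R :> R \/ (3 * k)%:R + 3 <= (3 * i)%:R :> R.
  have : (i : nat) != k by move: ik; rewrite -val_eqE.
  by rewrite neq_ltn => /orP[lt|lt]; [left|right]; rewrite -natrD ler_nat; lia.
move: near; rewrite ler_norml => /andP[n1 n2].
by case=> d; rewrite ler_normr; apply/orP; [left|right]; lra.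
Qed.

Lemma hole_height_far x : (forall k, (k < H)%N -> 1 <= `|x - (3 * k)%:R|) -> w x = 0.
Proof. by move=> far; rewrite /w big1 // => i _; apply: sqrt_far; exact: far. Qed.

Lemma hole_height_eq0 x : w x = 0 -> forall k, (k < H)%N -> 1 <= `|x - (3 * k)%:R|.
Proof.
move=> w0 k kH; rewrite leNgt; apply/negP => lt1.
move: w0; rewrite (hole_height_near kH (ltW lt1)) => /eqP.
rewrite sqrtr_eq0 subr_le0 -real_normK ?num_real //.
by have := normr_ge0 (x - (3 * k)%:R); set d := `| _ | in lt1 * => ? ?; nra.
Qed.

Lemma holed_height (p : plane) : holed (Some p) -> w p.1 <= `|p.2|.
Proof.
move=> hp; have [[k [kH near]]|no] :=
  pselect (exists k, (k < H)%N /\ `|p.1 - (3 * k)%:R| <= 1).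
  rewrite (hole_height_near kH near) -sqrtr_sqr ler_sqrt ?sqr_ge0 //.
  by have := hp p erefl k kH; rewrite /sqdist_centre; lra.
rewrite hole_height_far // => k kH; rewrite leNgt; apply/negP => lt1.
by apply: no; exists k; split=> //; exact: ltW.
Qed.

Lemma circle_near (k : nat) (p : plane) : on_circle k p -> `|p.1 - (3 * k)%:R| <= 1.
Proof.
rewrite /on_circle /sqdist_centre => cp.
by rewrite -[leRHS]sqrtr1 -sqrtr_sqr ler_sqrt // -[leRHS]cp lerDl sqr_ge0.
Qed.

Lemma circle_height (k : nat) (p : plane) : (k < H)%N -> on_circle k p -> w p.1 = `|p.2|.
Proof.
move=> kH cp; rewrite (hole_height_near kH (circle_near cp)) -sqrtr_sqr; congr Num.sqrt.
by rewrite -[X in X - _]cp /sqdist_centre; ring.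
Qed.

Lemma hole_height_le x : w x <= H%:R.
Proof.
rewrite -[H in leRHS]card_ord -sum1_card natr_sum; apply: ler_sum => i _.
by rewrite -[leRHS]sqrtr1 ler_sqrt // gerBl sqr_ge0.
Qed.

Lemma hole_height_continuous : continuous w.
Proof.
apply: continuous_big => [|i _ x]; first exact: add_continuous.
apply: (@continuous_comp _ _ _ (fun y : R => 1 - (y - (3 * i)%:R) ^+ 2) Num.sqrt); last exact: sqrt_continuous.
apply: cvgB; first exact: cvg_cst.
rewrite expr2; under eq_fun do rewrite expr2.
by apply: cvgM; (apply: cvgB; [exact: cvg_id|exact: cvg_cst]).
Qed.

Variable n : nat.
Local Notation W := (grid_width n).
Local Notation L := (grid_height n).

Definition ucoord (p : plane) : R := n%:R * (p.1 + n%:R).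
(** Height is measured from the rim of the hole, which gives 0 on the circles and, outside the
    holes, on the axis. *)
Definition vcoord (p : plane) : R := n%:R * (`|p.2| - w p.1).

Lemma ucoord_continuous : continuous ucoord.
Proof.
move=> p; apply: cvgM; first exact: cvg_cst.
by apply: cvgD; [exact: cvg_fst|exact: cvg_cst].
Qed.

Lemma vcoord_continuous : continuous vcoord.
Proof.
move=> p; apply: cvgM; first exact: cvg_cst.
apply: cvgB; first by apply: cvg_norm; exact: cvg_snd.
apply: (@continuous_comp _ _ _ fst w); [exact: cvg_fst|exact: hole_height_continuous].
Qed.

Definition side_coord (s : bool) (p : plane) : R := if s then p.2 else - p.2.

Lemma side_coord_continuous s : continuous (side_coord s).
Proof.
rewrite /side_coord; case: s => p; first exact: cvg_snd.
by apply: cvgN; exact: cvg_snd.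
Qed.

Definition square_region (s : bool) (a b : nat) : set plane :=
  [set p | [/\ 0 <= side_coord s p, a%:R <= ucoord p <= a.+1%:R & b%:R <= vcoord p <= b.+1%:R]].

Definition tile (q : option (square n)) : set opc :=
  match q with
  | Some (s, a, b) => Some @` square_region s a b
  | None => ~` (Some @` [set p | [/\ 0 < ucoord p, ucoord p < W%:R & vcoord p < L%:R]])
  end.

Hypothesis n_gt0 : (0 < n)%N.

Lemma closed_preim_le (f : plane -> R) (a b : R) : continuous f -> closed [set p | a <= f p <= b].
Proof.
move=> cf; rewrite (_ : [set _ | _] = f @^-1` `[a, b]).
  by apply: preimage_closed => [p _|]; [exact: cf|exact: interval_closed].
by apply/seteqP; split => p /=; rewrite in_itv.
Qed.

Lemma closed_preim_ge (f : plane -> R) (a : R) : continuous f -> closed [set p | a <= f p].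
Proof.
move=> cf; rewrite (_ : [set _ | _] = f @^-1` [set x | a <= x]) //.
by apply: preimage_closed => [p _|]; [exact: cf|exact: closed_ge].
Qed.

Lemma square_region_closed s a b : closed (square_region s a b).
Proof.
rewrite (_ : square_region s a b = [set p | 0 <= side_coord s p] `&`
   ([set p | a%:R <= ucoord p <= a.+1%:R] `&` [set p | b%:R <= vcoord p <= b.+1%:R])).
  apply: closedI; first exact/closed_preim_ge/side_coord_continuous.
  by apply: closedI; apply: closed_preim_le; [exact: ucoord_continuous|exact: vcoord_continuous].
by apply/seteqP; split=> [p [? ? ?]|p [? [? ?]]].
Qed.

Lemma tile_closed q : closed (tile q).
Proof.
case: q => [[[s a] b]|] /=; last first.
  rewrite closedC; apply: one_point_compactification_open_some.
  rewrite (_ : [set _ | _] = ucoord @^-1` `]0, W%:R[ `&` vcoord @^-1` [set x | x < L%:R]).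
    apply: openI; apply: open_comp => [p _|]; [exact: ucoord_continuous|exact: interval_open|exact: vcoord_continuous|].
    exact: open_lt.
  apply/seteqP; split=> p /=; rewrite in_itv /=; first by case=> -> -> ->.
  by case=> /andP[-> ->] ->.
apply: closed_some; last exact: square_region_closed.
(* As [n] is at least 1, [p.1 + n] lies between 0 and [a.+1], and [|p.2|] exceeds the hole height,
   which is at most [H], by at most [b.+1]. *)
pose B : R := a.+1%:R + n%:R + b.+1%:R + H%:R.
apply: (subclosed_compact (square_region_closed (s := s) (a := a) (b := b)) (compact_square (b := B))).
move=> p [_ /andP[u1 u2] /andP[v1 v2]].
have n1 : 1 <= n%:R :> R by rewrite ler1n.
have a0 : 0 <= a%:R :> R by [].
have b0 : 0 <= b%:R :> R by [].
have b1 : 0 <= b.+1%:R :> R by [].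
have h0 : 0 <= H%:R :> R by [].
have y0 := normr_ge0 p.2; have w1 := hole_height_le p.1; have w0 := hole_height_ge0 p.1.
move: u1 u2 v1 v2; rewrite /ucoord /vcoord /B.
move: a.+1%:R b.+1%:R a%:R b%:R H%:R n%:R a0 b0 b1 h0 n1 w1 => a1 b1 a0 b0 h0 n0 *.
split; last by nra.
by rewrite ler_norml; apply/andP; split; nra.
Qed.

Lemma tile_cover z : holed z -> exists q, tile q z.
Proof.
case: z => [p hp|_]; last by exists None => -[].
have [in_|] := pselect [/\ 0 < ucoord p, ucoord p < W%:R & vcoord p < L%:R]; last first.
  by move=> out; exists None => -[q qin [qp]]; apply: out; rewrite -qp.
case: in_ => u0 uW vL.
have v0 : 0 <= vcoord p by rewrite mulr_ge0 // subr_ge0; exact: holed_height.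
have /andP[a1 a2] := truncn_itv (ltW u0); have /andP[b1 b2] := truncn_itv v0.
have aW : (Num.truncn (ucoord p) < W)%N by rewrite -(ltr_nat R); exact: le_lt_trans uW.
have bL : (Num.truncn (vcoord p) < L)%N by rewrite -(ltr_nat R); exact: le_lt_trans vL.
exists (Some (0 <= p.2, Ordinal aW, Ordinal bL)); exists p => //; split=> /=.
- by rewrite /side_coord; case: (leP 0 p.2) => // /ltW; rewrite oppr_ge0.
- by rewrite a1 ltW.
- by rewrite b1 ltW.
Qed.

End Tiles.

(** * Links between tiles that meet on the surface *)

Section Touching.
Local Open Scope ring_scope.
Variables (R : realType) (h c n : nat).
Local Notation H := (2 * h + c)%N.
Local Notation plane := (R * R)%type.
Local Notation holed := (@holed_sphere R h c).
Local Notation W := (grid_width n).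
Local Notation L := (grid_height n).
Hypothesis n_large : (3 * H + 3 <= n)%N.
Local Notation u := (@ucoord R n).
Local Notation v := (@vcoord R h c n).
Local Notation tile := (@tile R h c n).
Local Notation nodes := (@tile_nodes n).
Local Notation sconnect := (@sconnect h c n n_large).

(** Rounding down gives a corner of every unit interval containing [x], a choice common to all
    squares at a point. *)
Lemma corner_trunc (m : nat) (a : 'I_m) (x : R) : a%:R <= x <= a.+1%:R ->
  exists2 t, is_corner a t & val t = Num.truncn x.
Proof.
move=> /andP[ax xa]; have x0 : 0 <= x by apply: le_trans ax.
have /andP[t1 t2] := truncn_itv x0.
have : (a < (Num.truncn x).+1)%N by rewrite -(ltr_nat R); exact: le_lt_trans t2.
have : (Num.truncn x < a.+2)%N.
  by rewrite -(ltr_nat R); apply: le_lt_trans t1 _; apply: le_lt_trans xa _; rewrite ltr_nat.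
move=> lt1 lt2; have [E|E] := eqVneq (Num.truncn x) a.
  by exists (lo a); rewrite /is_corner ?eqxx // E.
by exists (hi a); rewrite /is_corner ?eqxx ?orbT //= /bump /=; lia.
Qed.

(** Reflection turns rounding down into rounding up, which is again a corner; so the rung at the
    rounded [x] ends in the square of [y]. *)
Lemma corner_reflect (m C : nat) (a : 'I_m) (x y : R) : 0 <= x -> x + y = C%:R ->
  a%:R <= y <= a.+1%:R -> exists2 t, is_corner a t & (Num.truncn x + val t = C)%N.
Proof.
move=> x0 xy /andP[ay ya]; have /andP[t1 t2] := truncn_itv x0.
have : (Num.truncn x + a <= C)%N by rewrite -(ler_nat R) natrD; lra.
have : (C < (Num.truncn x).+1 + a.+1)%N by rewrite -(ltr_nat R) natrD; lra.
move=> lt1 lt2; have [E|E] := eqVneq (Num.truncn x + a)%N C.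
  by exists (lo a); rewrite /is_corner ?eqxx.
by exists (hi a); rewrite /is_corner ?eqxx ?orbT //= /bump /=; lia.
Qed.

Lemma square_in_tile (s : bool) (a : 'I_W) (b : 'I_L) (p : plane) :
  tile (Some (s, a, b)) (Some p) <-> square_region h c n s a b p.
Proof. by split=> [[q Hq [<-]]|Hp] //; exists p. Qed.

Lemma outer_tile (p : plane) : tile None (Some p) <-> [\/ u p <= 0, W%:R <= u p | L%:R <= v p].
Proof.
split=> [out|out [q [u0 uW vL] [qp]]]; last first.
  by subst q; case: out; rewrite leNgt ?u0 ?uW ?vL.
have [l1|l1] := leP (u p) 0; first exact: Or31.
have [l2|l2] := leP W%:R (u p); first exact: Or32.
have [l3|l3] := leP L%:R (v p); first exact: Or33.
by case: out; exists p.
Qed.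

Lemma tiles_joined (B : {set snode n}) (q q' : option (square n)) :
  nodes q \subset B -> nodes q' \subset B ->
  (exists x y, [/\ x \in nodes q, y \in nodes q' & sconnect B x y]) ->
  forall x y, x \in nodes q -> y \in nodes q' -> sconnect B x y.
Proof.
move=> qB q'B [x0 [y0 [x0q y0q' xy]]] x y xq yq'.
have c1 := within_connect_sub qB (tile_connected n_large xq x0q).
have c2 := within_connect_sub q'B (tile_connected n_large y0q' yq').
exact: sconnect_trans c1 (sconnect_trans xy c2).
Qed.

Lemma frame_corner (s : bool) (a : 'I_W) (b : 'I_L) (p : plane) :
  tile (Some (s, a, b)) (Some p) -> tile None (Some p) ->
  exists2 x, x \in nodes (Some (s, a, b)) & x \in nodes None.
Proof.
move=> /square_in_tile[_ /andP[a1 a2] /andP[b1 b2]] /outer_tile.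
have mem t t' : is_corner a t -> is_corner b t' -> (s, t, t') \in nodes (Some (s, a, b)).
  by move=> Ht Ht'; rewrite inE /= eqxx Ht.
have la : is_corner a (lo a) by rewrite /is_corner eqxx.
have ha : is_corner a (hi a) by rewrite /is_corner eqxx orbT.
have lb : is_corner b (lo b) by rewrite /is_corner eqxx.
have hb : is_corner b (hi b) by rewrite /is_corner eqxx orbT.
have aW := ltn_ord a; have bL := ltn_ord b.
case=> Hp.
- exists (s, lo a, lo b); first exact: mem.
  rewrite inE /frame /=; suff -> : (a : nat) = 0%N by [].
  by have := le_trans a1 Hp; rewrite lern0 => /eqP.
- exists (s, hi a, lo b); first exact: mem.
  have E : val (hi a) = W by rewrite val_hi; move: (le_trans Hp a2); rewrite ler_nat; lia.
  by rewrite inE /frame [X in _ || (X || _)](introT eqP E) orbT.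
- exists (s, lo a, hi b); first exact: mem.
  have E : val (hi b) = L by rewrite val_hi; move: (le_trans Hp b2); rewrite ler_nat; lia.
  by rewrite inE /frame [X in _ || (_ || X)](introT eqP E) !orbT.
Qed.

Let n_gt0 : (0 < n)%N. Proof. by lia. Qed.
Let nR_gt0 : 0 < n%:R :> R. Proof. by rewrite ltr0n. Qed.

Let slitR k : (slit n k)%:R = n%:R * (n%:R + 3 * k%:R - 1) :> R.
Proof.
have := congr1 (fun m => m%:R : R) (slitE n_large k); rewrite /= natrD natrM natrD natrM => E.
by rewrite mulrBr -E mulr1 addrK.
Qed.

Let u_near k (p : plane) : `|p.1 - (3 * k)%:R| <= 1 -> (slit n k)%:R <= u p <= (slit n k + 2 * n)%:R.
Proof.
rewrite ler_norml natrM => /andP[l1 l2]; rewrite natrD natrM slitR /ucoord.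
have -> : n%:R * (n%:R + 3 * k%:R - 1) + 2 * n%:R = n%:R * (n%:R + 3 * k%:R + 1) :> R by ring.
by apply/andP; split; rewrite ler_pM2l //; lra.
Qed.

Let u_trunc k (p : plane) : `|p.1 - (3 * k)%:R| <= 1 ->
  (slit n k <= Num.truncn (u p) <= slit n k + 2 * n)%N.
Proof.
move=> /u_near/andP[l1 l2]; have u0 : 0 <= u p by apply: le_trans l1.
have /andP[t1 t2] := truncn_itv u0.
rewrite -ltnS -(ltr_nat R) (le_lt_trans l1) //=.
by rewrite -(ler_nat R) (le_trans t1).
Qed.

Let u_outside k (p : plane) : 0 <= u p -> 1 <= `|p.1 - (3 * k)%:R| ->
  (Num.truncn (u p) <= slit n k)%N \/ (slit n k + 2 * n <= Num.truncn (u p))%N.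
Proof.
move=> u0; have /andP[t1 t2] := truncn_itv u0.
rewrite ler_normr natrM => /orP[le|le]; [right|left].
  rewrite -ltnS -(ltr_nat R); apply: le_lt_trans t2.
  rewrite natrD natrM slitR /ucoord.
  have -> : n%:R * (n%:R + 3 * k%:R - 1) + 2 * n%:R = n%:R * (n%:R + 3 * k%:R + 1) :> R by ring.
  by rewrite ler_pM2l //; lra.
by rewrite -(ler_nat R); apply: le_trans t1 _; rewrite slitR /ucoord ler_pM2l //; lra.
Qed.

Lemma touch_same (B : {set snode n}) z q q' :
  (forall q'', tile q'' z -> nodes q'' \subset B) -> tile q z -> tile q' z ->
  forall x y, x \in nodes q -> y \in nodes q' -> sconnect B x y.
Proof.
move=> zB qz q'z; apply: tiles_joined; [exact: zB|exact: zB|].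
have one r r' : tile r z -> tile r' z -> (exists2 x, x \in nodes r & x \in nodes r') ->
    exists x y, [/\ x \in nodes r, y \in nodes r' & sconnect B x y].
  by move=> _ _ [x xr xr']; exists x, x; split=> //; exact: connect0.
case: q qz => [[[s a] b]|] qz; case: q' q'z => [[[s' a'] b']|] q'z; last 1 first.
- by apply: one => //; exists (true, ord0, ord0); rewrite inE.
- have [p zp] : exists p, z = Some p by case: qz => p _ <-; exists p.
  subst z; case/square_in_tile: (qz) => sp ap bp; case/square_in_tile: (q'z) => sp' ap' bp'.
  have [t ta tu] := corner_trunc ap; have [t' ta' tu'] := corner_trunc ap'.
  have [r rb rv] := corner_trunc bp; have [r' rb' rv'] := corner_trunc bp'.
  have tt : t' = t by apply: val_inj; rewrite tu tu'.
  have rr : r' = r by apply: val_inj; rewrite rv rv'.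
  subst t' r'; have [ss|ss] := eqVneq s s'.
    by subst s'; apply: one => //; exists (s, t, r); rewrite inE /= eqxx ?ta ?ta' ?rb ?rb'.
  (* A point in squares of both half-planes is on the axis; as its height above the rim is
     nonnegative, no hole lies over it and a rung joins the half-planes there. *)
  have p20 : p.2 = 0.
    move: sp sp' ss; rewrite /side_coord; case: (s) (s') => -[] // p1 p2 _;
    by apply/eqP; rewrite eq_le; apply/andP; split; lra.
  have v0 : v p = 0.
    apply/eqP; rewrite eq_le; apply/andP; split; last first.
      by case/andP: bp => b1 _; apply: le_trans b1.
    by rewrite /vcoord p20 normr0 sub0r mulrN oppr_le0 mulr_ge0 // hole_height_ge0.
  have w0 : hole_height h c p.1 = 0.
    move/eqP: v0; rewrite /vcoord mulf_eq0 (gt_eqF nR_gt0) /= p20 normr0 sub0r oppr_eq0.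
    by move/eqP.
  have r0 : r = ord0 by apply: val_inj; rewrite rv v0 truncn0.
  have u0 : 0 <= u p by case/andP: ap => a1 _; apply: le_trans a1.
  have adj : sadj n_large (true, t, ord0) (false, t, ord0).
    apply: sadj_outside => k kH; rewrite tu; apply: u_outside => //.
    exact: (hole_height_eq0 w0).
  have m1 : (s, t, r) \in nodes (Some (s, a, b)) by rewrite inE /= eqxx ta.
  have m2 : (s', t, r) \in nodes (Some (s', a', b')) by rewrite inE /= eqxx ta'.
  exists (s, t, r), (s', t, r); split=> //; apply: sconnect1.
  + by move/fintype.subsetP: (zB _ qz) => /(_ _ m1).
  + by move/fintype.subsetP: (zB _ q'z) => /(_ _ m2).
  + rewrite r0; move: ss; case: (s) (s') => -[] // _.
    by rewrite sadj_sym.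
- have [p zp] : exists p, z = Some p by case: qz => p _ <-; exists p.
  by subst z; apply: one => //; apply: frame_corner qz q'z.
- have [p zp] : exists p, z = Some p by case: q'z => p _ <-; exists p.
  subst z; apply: one => //; have [x x1 x2] := frame_corner q'z qz; by exists x.
Qed.

Lemma partner_sum (k : nat) (p : plane) :
  u p + u (partner h k p) = (n * (mirror_centre h k + 2 * n))%:R.
Proof. by rewrite /ucoord /= natrM natrD natrM; ring. Qed.

Let slit_sum_even j : (2 * j < 2 * h)%N ->
  (n * (mirror_centre h (2 * j) + 2 * n) = slit n (2 * j) + slit n (2 * j).+1 + 2 * n)%N.
Proof.
move=> jh; have := slitE n_large (2 * j); have := slitE n_large (2 * j).+1.
by rewrite /mirror_centre jh mul2n doubleK; nia.
Qed.

Let slit_sum_odd j : ((2 * j).+1 < 2 * h)%N ->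
  (n * (mirror_centre h (2 * j).+1 + 2 * n) = slit n (2 * j) + slit n (2 * j).+1 + 2 * n)%N.
Proof.
move=> jh; have := slitE n_large (2 * j); have := slitE n_large (2 * j).+1.
by rewrite /mirror_centre jh mul2n /= uphalf_double; nia.
Qed.

Let slit_sum_crosscap k : (2 * h <= k)%N ->
  (n * (mirror_centre h k + 2 * n) = slit n k + slit n k + 2 * n)%N.
Proof.
move=> kh; have := slitE n_large k.
by rewrite /mirror_centre ltnNge kh /=; nia.
Qed.

Let rung_adj (k : nat) (s : bool) (t t' : 'I_W.+1) : (k < H)%N ->
  (slit n k <= t <= slit n k + 2 * n)%N ->
  (t + t' = n * (mirror_centre h k + 2 * n))%N ->
  sadj n_large (s, t, ord0) (if (k < 2 * h)%N then s else ~~ s, t', ord0).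
Proof.
move=> kH tr tt'; case: ltnP => kh; last first.
  have E := slit_sum_crosscap kh; have kE : (k = 2 * h + (k - 2 * h))%N by lia.
  have jc : (k - 2 * h < c)%N by lia.
  case: s => /=.
    by apply: (@sadj_crosscap _ _ _ n_large (k - 2 * h)%N); rewrite -?kE //; lia.
  rewrite sadj_sym.
  by apply: (@sadj_crosscap _ _ _ n_large (k - 2 * h)%N); rewrite -?kE //; lia.
have kE := odd_double_half k; rewrite -mul2n in kE.
have jh : (k./2 < h)%N by move: kE kh; case: (odd k) => /=; lia.
case ko: (odd k) kE => kE.
- rewrite -kE add1n in tr tt' kh kH *.
  have E := slit_sum_odd kh.
  by rewrite sadj_sym; apply: (@sadj_handle _ _ _ n_large k./2) => //; lia.
- rewrite -kE add0n in tr tt' kh kH *.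
  have E := slit_sum_even kh.
  by apply: (@sadj_handle _ _ _ n_large k./2) => //; lia.
Qed.

(** Slits lie strictly inside the grid, which excludes the outer tile, and height 0 leaves only the
    bottom row. *)
Lemma circle_tile (k : nat) (p : plane) q : (k < H)%N -> on_circle k p -> tile q (Some p) ->
  exists s a b, q = Some (s, a, b) /\ val b = 0%N /\ v p = 0.
Proof.
move=> kH kp; have v0 : v p = 0 by rewrite /vcoord (circle_height kH kp) subrr mulr0.
have /andP[u1 u2] := u_near (circle_near kp).
case: q => [[[s a] b]|].
  move=> /square_in_tile[_ _ /andP[b1 _]]; exists s, a, b; split=> //; split=> //.
  by move: b1; rewrite v0 lern0 => /eqP.
move=> /outer_tile; rewrite v0 => -[Hu|Hu|].
- have := le_trans u1 Hu; rewrite lern0 => /eqP E.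
  by have := slit_pos n_large k; rewrite E.
- have := le_trans Hu u2; rewrite ler_nat leqNgt => /negP[].
  exact: (slit_end n_large kH).
- by rewrite lern0 /grid_height muln_eq0 orbb => /eqP E; move: n_gt0; rewrite E.
Qed.

Lemma touch_paired (B : {set snode n}) p p' q q' : paired h c p p' ->
  (forall q'', tile q'' (Some p) \/ tile q'' (Some p') -> nodes q'' \subset B) ->
  tile q (Some p) -> tile q' (Some p') ->
  forall x y, x \in nodes q -> y \in nodes q' -> sconnect B x y.
Proof.
case=> k kH [kp p'E] pB qp q'p'.
have kp' := partner_on_circle h kp; rewrite -p'E in kp'.
have [s [a [b [qE [b0 v0]]]]] := circle_tile kH kp qp; subst q.
have [s' [a' [b' [q'E [b'0 v'0]]]]] := circle_tile (partner_circle_lt kH) kp' q'p'; subst q'.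
pose s2 := if (k < 2 * h)%N then s else ~~ s.
case/square_in_tile: (qp) => sp ap bp; case/square_in_tile: (q'p') => sp' ap' bp'.
(* If [p'] is on the axis, [q'] may be in the wrong half-plane. The rung leads to the half-plane
   [s2] that the gluing prescribes, and [touch_same] leads on from there. *)
have q2p' : tile (Some (s2, a', b')) (Some p').
  apply/square_in_tile; split=> //; rewrite p'E /partner /side_coord /s2 /=.
  by move: sp; rewrite /side_coord; case: (k < 2 * h)%N; case: (s) => /=; rewrite ?opprK.
have [t ta tu] := corner_trunc ap.
have u0 : 0 <= u p by case/andP: ap => a1 _; apply: le_trans a1.
have sumE : u p + u p' = (n * (mirror_centre h k + 2 * n))%:R by rewrite p'E; exact: partner_sum.
have [t' ta' tt'] := corner_reflect u0 sumE ap'.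
rewrite -tu in tt'.
have tr : (slit n k <= t <= slit n k + 2 * n)%N.
  by have := u_trunc (circle_near kp); rewrite -tu.
have adj := rung_adj s kH tr tt'; rewrite -/s2 in adj.
have m1 : (s, t, ord0) \in nodes (Some (s, a, b)).
  rewrite inE /= eqxx ta /is_corner /= (_ : lo b = ord0) ?eqxx //; exact: val_inj.
have m2 : (s2, t', ord0) \in nodes (Some (s2, a', b')).
  rewrite inE /= eqxx ta' /is_corner /= (_ : lo b' = ord0) ?eqxx //; exact: val_inj.
have B1 : nodes (Some (s, a, b)) \subset B by apply: pB; left.
have B2 : nodes (Some (s2, a', b')) \subset B by apply: pB; right.
move=> x y xq yq'; apply: (@sconnect_trans _ _ _ _ _ (s2, t', ord0)).
  apply: (tiles_joined B1 B2 _ xq m2); exists (s, t, ord0), (s2, t', ord0); split; [exact: m1|exact: m2|].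
  by apply: sconnect1 => //; [exact: (fintype.subsetP B1)|exact: (fintype.subsetP B2)].
apply: (touch_same _ q2p' q'p') m2 yq' => q'' q''p'; apply: pB; by right.
Qed.

(** The hypothesis on [B] concerns all tiles at all representatives of the point, because the
    connecting route may pass through a third tile. *)
Lemma tiles_touch (B : {set snode n}) (x x' : set_type holed) q q' :
  proj_surface x = proj_surface x' ->
  (forall y q'', proj_surface y = proj_surface x -> tile q'' (set_val y) -> nodes q'' \subset B) ->
  tile q (set_val x) -> tile q' (set_val x') ->
  forall a b, a \in nodes q -> b \in nodes q' -> sconnect B a b.
Proof.
move=> xx' allB qx q'x'.
have /proj_surface_eq[E|[p [p' [xp x'p' pp']]]] := xx'.
  apply: (touch_same (z := set_val x)) => //; last by rewrite E.
  by move=> q''; exact: allB.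
apply: (touch_paired pp'); rewrite -?xp -?x'p' // => q'' [|]; exact: allB.
Qed.

End Touching.

(** * Disjoint closed sets at fine resolution *)

Section Mesh.
Local Open Scope classical_set_scope.
Local Open Scope ring_scope.
Variables (R : realType) (h c : nat).
Local Notation H := (2 * h + c)%N.
Local Notation plane := (R * R)%type.
Local Notation opc := (one_point_compactification plane).
Local Notation w := (@hole_height R h c).

Lemma corner_close (m : nat) (a a' : 'I_m) t : is_corner a t -> is_corner a' t ->
  (a <= a'.+1)%N /\ (a' <= a.+1)%N.
Proof.
by move=> /orP[] /eqP -> /orP[] /eqP /(congr1 val); rewrite ?val_lo ?val_hi /=; lia.
Qed.

Lemma inner_index (t r a b W L : nat) : t = a \/ t = a.+1 -> r = b \/ r = b.+1 ->
  (0 < a -> a.+1 < W -> b.+1 < L -> ~~ [|| t == 0, t == W | r == L])%N.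
Proof. by case=> -> [] ->; rewrite !negb_or; lia. Qed.

(** The grid coordinates of [p] keep a distance of at least [2 * n] from the left, right and top of
    the grid, more than the side of a square. *)
Lemma tile_far n q (p : plane) (B : R) : (0 < n)%N -> `|p.1| <= B -> `|p.2| <= B ->
  B + 2 <= n%:R -> tile h c q (Some p) -> forall x, x \in tile_nodes q -> x \notin tile_nodes (None : option (square n)).
Proof.
move=> n0 p1 p2 Bn.
have n1 : 1 <= n%:R :> R by rewrite ler1n.
have w0 := hole_height_ge0 h c p.1.
move: p1; rewrite ler_norml => /andP[p11 p12].
have B0 : 0 <= B by apply: le_trans p2.
have WE : (grid_width n)%:R = 2 * n%:R * n%:R :> R by rewrite !natrM.
have LE : (grid_height n)%:R = n%:R * n%:R :> R by rewrite natrM.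
have uB : n%:R * 2 <= ucoord n p /\ ucoord n p <= 2 * n%:R * n%:R - n%:R * 2.
  by rewrite /ucoord; split; nra.
have vB : vcoord h c n p <= n%:R * n%:R - n%:R * 2.
  by rewrite /vcoord; nra.
case: uB => uB1 uB2.
case: q => [[[s a] b]|]; last first.
  by move=> /outer_tile; rewrite WE LE => -[] ?; nra.
move=> /square_in_tile[_ /andP[a1 a2] /andP[b1 b2]] [[s' t] r]; rewrite !inE /frame /=.
move=> /and3P[_ ta rb].
have tB : ((t : nat) = a \/ (t : nat) = a.+1) by case/orP: ta => /eqP ->; [left|right].
have rB : ((r : nat) = b \/ (r : nat) = b.+1) by case/orP: rb => /eqP ->; [left|right].
have c1 : (0 < a)%N.
  rewrite lt0n; apply/eqP => a0; move: a2; rewrite a0 => ?; nra.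
have c2 : (a.+1 < grid_width n)%N.
  rewrite -(ltr_nat R) WE -natr1; nra.
have c3 : (b.+1 < grid_height n)%N.
  rewrite -(ltr_nat R) LE -natr1; nra.
exact: (inner_index tB rB).
Qed.

(** Around a point of [K1] some ball misses [K2], and points of tiles with a common node are closer
    than its radius once [n] is large. Compactness of [K1] makes the bound on [n] uniform. *)
Lemma mesh_bounded (K1 K2 : set opc) : closed K1 -> closed K2 -> ~ K1 None ->
  K1 `&` K2 = set0 ->
  \forall n \near \oo, forall (q1 q2 : option (square n)) x,
    x \in tile_nodes q1 -> x \in tile_nodes q2 ->
    forall z1 z2, K1 z1 -> K2 z2 -> tile h c q1 z1 -> tile h c q2 z2 -> False.
Proof.
move=> cl1 cl2 n1 dis.
pose P1 : set plane := Some @^-1` K1; pose P2 : set plane := Some @^-1` K2.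
have clP (K : set opc) : closed K -> closed (Some @^-1` K : set plane).
  by apply: preimage_closed => p _; exact: one_point_compactification_some_continuous.
have cP1 : compact P1.
  have : nbhs (None : opc) (~` K1) by apply: open_nbhs_nbhs; split=> //; rewrite openC.
  case=> U [cU clU] UK; apply: subclosed_compact (clP _ cl1) cU _.
  move=> p Kp; apply: contrapT => nU; apply: (UK (Some p)) => //.
  by left; exists p.
have : \forall n \near \oo, P1 `<=` (fun p => forall (q1 q2 : option (square n)) x,
    x \in tile_nodes q1 -> x \in tile_nodes q2 ->
    forall z2, K2 z2 -> tile h c q1 (Some p) -> tile h c q2 z2 -> False).
  move/compact_near_coveringP: cP1; apply => p0 p0K.
  have nP2 : nbhs p0 (~` P2).
    apply: open_nbhs_nbhs; split; first by rewrite openC; exact: clP.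
    by move=> p0K2; have : (K1 `&` K2) (Some p0) by []; rewrite dis.
  case/nbhs_ballP: nP2 => eps /= eps0 ballP2.
  have wc := @hole_height_continuous R h c p0.1.
  have : \forall x \near p0.1, `|w p0.1 - w x| < eps / 8.
    by move/cvgrPdist_lt: wc; apply; lra.
  case/nbhs_ballP => d /= d0 ballw.
  (* Points of the two tiles will differ by less than [eta] in abscissa and in height above the rim;
     [d] controls the change of the rim itself, and the factor 8 leaves room for adding the
     errors. *)
  pose eta := Num.min (Num.min d eps) 1 / 8.
  have eta0 : 0 < eta by rewrite divr_gt0 // !lt_min d0 eps0 ltr01.
  have [ed ee e1] : [/\ 8 * eta <= d, 8 * eta <= eps & 8 * eta <= 1].
    rewrite /eta mulrCA divff // mulr1; split; rewrite !ge_min ?lexx ?orbT //.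
  pose B := `|p0.1| + `|p0.2| + 1.
  (* This makes [n * eta] exceed 2, the largest difference of coordinates within two squares that
     share a corner, and keeps [p] away from the frame. *)
  pose N := (Num.truncn (B + 2 + 2 / eta)).+1.
  exists (ball p0 eta, [set m | (N <= m)%N]).
    by split; [exact: nbhsx_ballx|exact: nbhs_infty_ge].
  case=> p n /= [[]]; rewrite /ball /= => p1 p2 Nn q1 q2 x xq1 xq2 z2 K2z t1 t2.
  have [n0 nB neta] : [/\ (0 < n)%N, B + 2 <= n%:R & 2 < n%:R * eta].
    have e2 : 0 < 2 / eta by rewrite divr_gt0.
    have B0 : 0 <= B by rewrite !addr_ge0.
    have /andP[_ lt] : (Num.truncn (B + 2 + 2 / eta))%:R <= B + 2 + 2 / eta <
        (Num.truncn (B + 2 + 2 / eta)).+1%:R by apply: truncn_itv; lra.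
    have : N%:R <= n%:R :> R by rewrite ler_nat.
    rewrite -/N in lt *; split; [by apply: leq_trans Nn|lra|].
    by rewrite -ltr_pdivrMr //; lra.
  have p1B : `|p.1| <= B.
    have := ler_normB p0.1 (p0.1 - p.1); rewrite opprB addrC subrK => ?.
    by rewrite /B; have := normr_ge0 p0.2; lra.
  have p2B : `|p.2| <= B.
    have := ler_normB p0.2 (p0.2 - p.2); rewrite opprB addrC subrK => ?.
    by rewrite /B; have := normr_ge0 p0.1; lra.
  have nof := tile_far n0 p1B p2B nB t1 xq1.
  case: q2 xq2 t2 => [[[s' a'] b']|] xq2 t2; last by rewrite xq2 in nof.
  case: z2 K2z t2 => [r|] K2z t2; last by case: t2.
  case/square_in_tile: t2 => sr /andP[ar1 ar2] /andP[br1 br2].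
  case: q1 xq1 t1 {nof} => [[[s a] b]|]; last first.
    by move=> xN t1; have := tile_far n0 p1B p2B nB t1 xN; rewrite xN.
  move=> xq1 /square_in_tile[sp /andP[ap1 ap2] /andP[bp1 bp2]].
  case: x xq1 xq2 => [[s0 t] t']; rewrite !inE /= => /and3P[/eqP s0s ta tb] /and3P[/eqP s0s' ta' tb'].
  have ss : s' = s by rewrite -s0s -s0s'.
  have [aa1 aa2] := corner_close ta ta'; have [bb1 bb2] := corner_close tb tb'.
  have le2 (m m' : nat) : (m <= m'.+1)%N -> m%:R <= m'%:R + 1 :> R.
    by rewrite natr1 ler_nat.
  have n0R : 0 < n%:R :> R by rewrite ltr0n.
  have step (f g : R) : n%:R * f - n%:R * g <= 2 -> f - g < eta.
    move=> fg; rewrite -(ltr_pM2l n0R) mulrBr; exact: le_lt_trans neta.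
  move: (le2 _ _ aa1) (le2 _ _ aa2) (le2 _ _ bb1) (le2 _ _ bb2) => {}aa1 {}aa2 {}bb1 {}bb2.
  rewrite -!natr1 in ap2 ar2 bp2 br2.
  have x1 : p.1 + n%:R - (r.1 + n%:R) < eta by apply: step; rewrite -/(ucoord n p) -/(ucoord n r); lra.
  have x2 : r.1 + n%:R - (p.1 + n%:R) < eta by apply: step; rewrite -/(ucoord n p) -/(ucoord n r); lra.
  have y1 : `|p.2| - w p.1 - (`|r.2| - w r.1) < eta by apply: step; rewrite -/(vcoord h c n p) -/(vcoord h c n r); lra.
  have y2 : `|r.2| - w r.1 - (`|p.2| - w p.1) < eta by apply: step; rewrite -/(vcoord h c n p) -/(vcoord h c n r); lra.
  clear ap1 ap2 ar1 ar2 bp1 bp2 br1 br2 aa1 aa2 bb1 bb2 nB neta p1B p2B n0R.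
  move: p1 p2; rewrite !ltr_norml => /andP[p11 p12] /andP[p21 p22].
  have wp : `|w p0.1 - w p.1| < eps / 8.
    by apply: ballw; rewrite /ball /= ltr_norml; apply/andP; split; lra.
  have wr : `|w p0.1 - w r.1| < eps / 8.
    by apply: ballw; rewrite /ball /= ltr_norml; apply/andP; split; lra.
  move: wp wr; rewrite !ltr_norml => /andP[wp1 wp2] /andP[wr1 wr2].
  apply: (ballP2 r) => //; split; rewrite /ball /= ltr_norml; apply/andP; split; try lra.
  (* Both points are in the same closed half-plane, so the absolute values open with the same
     sign. *)
  - move: sp sr; rewrite ss /side_coord; case: (s) => sp sr.
      by move: y1 y2; rewrite !ger0_norm //; lra.
    by move: y1 y2; rewrite !ler0_norm; lra.
  - move: sp sr; rewrite ss /side_coord; case: (s) => sp sr.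
      by move: y1 y2; rewrite !ger0_norm //; lra.
    by move: y1 y2; rewrite !ler0_norm; lra.
apply: filterS => n P1n q1 q2 x xq1 xq2 z1 z2 K1z K2z.
case: z1 K1z => [p|] K1z t1 t2; last by case: n1.
by apply: (P1n p K1z q1 q2 x xq1 xq2 z2 K2z).
Qed.

(** Infinity is in at most one of the sets and the claim is symmetric, so the bounded case
    suffices. *)
Lemma mesh_disjoint (K1 K2 : set opc) : closed K1 -> closed K2 -> K1 `&` K2 = set0 ->
  \forall n \near \oo, forall (q1 q2 : option (square n)) x,
    x \in tile_nodes q1 -> x \in tile_nodes q2 ->
    forall z1 z2, K1 z1 -> K2 z2 -> tile h c q1 z1 -> tile h c q2 z2 -> False.
Proof.
move=> cl1 cl2 dis; have [K1N|] := pselect (K1 None); last by move=> K1N; exact: mesh_bounded.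
have K2N : ~ K2 None by move=> K2N; have : (K1 `&` K2) None by []; rewrite dis.
have := mesh_bounded cl2 cl1 K2N; rewrite setIC => /(_ dis).
by apply: filterS => n Hn q1 q2 x x1 x2 z1 z2 Kz1 Kz2 t1 t2; apply: (Hn q2 q1 x x2 x1 z2 z1).
Qed.

End Mesh.

(** * Traces of connected sets on the grid *)

Section Trace.
Local Open Scope classical_set_scope.
Local Open Scope ring_scope.
Variables (R : realType) (h c n : nat).
Local Notation H := (2 * h + c)%N.
Local Notation S := (surface R h c).
Hypothesis n_large : (3 * H + 3 <= n)%N.

(** Every tile that meets [K] contributes, rather than one chosen tile per point; this is what
    [tiles_touch] requires of its set. *)
Definition trace (K : set S) : {set snode n} :=
  [set x | `[< exists q z, [/\ x \in tile_nodes q, preim_surface K z & tile h c q z] >]].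

Lemma traceP K x : reflect (exists q z, [/\ x \in tile_nodes q, preim_surface K z & tile h c q z])
  (x \in trace K).
Proof. by rewrite inE; exact: asboolP. Qed.

Lemma trace_mono (K K' : set S) : K `<=` K' -> trace K \subset trace K'.
Proof.
move=> KK'; apply/fintype.subsetP => x /traceP[q [z [xq [y yz Ky] qz]]].
by apply/traceP; exists q, z; split=> //; exists y => //; exact: KK'.
Qed.

Lemma tile_nodes_neq0 (q : option (square n)) : exists x, x \in tile_nodes q.
Proof.
case: q => [[[s a] b]|]; last by exists (true, ord0, ord0); rewrite inE.
by exists (s, lo a, lo b); rewrite inE /= /is_corner !eqxx.
Qed.

Lemma trace_neq0 (K : set S) s : K s -> exists x, x \in trace K.
Proof.
move=> Ks; have [y ys] := proj_surface_surj s.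
have n_gt0 : (0 < n)%N by lia.
have [q qy] := @tile_cover R h c n _ (@holed_val R h c y).
have [x xq] := tile_nodes_neq0 q.
by exists x; apply/traceP; exists q, (set_val y); split=> //; exists y => //; rewrite ys.
Qed.

Lemma trace_common (K K' : set S) s : K s -> K' s -> exists x, x \in trace K /\ x \in trace K'.
Proof.
move=> Ks K's; have [x xK] := @trace_neq0 (K `&` K') s (conj Ks K's).
exists x; split; apply: (fintype.subsetP (trace_mono _)) xK; by move=> ? [].
Qed.

(** The tiles whose nodes are all reachable from [x] and the remaining tiles cover [K] by two closed
    sets. These cannot meet in [K], since tiles that meet there are linked, so the first set
    contains [K]. *)
Lemma trace_connected (K : set S) : connected K ->
  {in trace K &, forall x y, sconnect n_large (trace K) x y}.
Proof.
move=> cK x y /traceP[q0 [z0 [xq0 Kz0 qz0]]] /traceP[q1 [z1 [yq1 Kz1 qz1]]].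
have n_gt0 : (0 < n)%N by lia.
pose good q := forall v, v \in tile_nodes q -> sconnect n_large (trace K) x v.
pose E (b : bool) : set S :=
  \bigcup_(q in [set q : option (square n) | good q <-> b]) image_surface (tile h c q).
have clE b : closed (E b).
  apply: closed_bigcup => [|q _]; first exact: finite_finset.
  by apply: image_closed; exact: tile_closed.
have touch y1 y2 q q' v v' : K (proj_surface y1) -> proj_surface y1 = proj_surface y2 ->
    tile h c q (set_val y1) -> tile h c q' (set_val y2) ->
    v \in tile_nodes q -> v' \in tile_nodes q' -> sconnect n_large (trace K) v v'.
  move=> Ky E12 t1 t2 vq v'q'; apply: (@tiles_touch R h c n n_large (trace K) y1 y2 q q' E12 _ t1 t2) => //.
  move=> y3 q3 E3 t3; apply/fintype.subsetP => u uq; apply/traceP; exists q3, (set_val y3).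
  by split=> //; exists y3 => //; rewrite E3.
have good0 : good q0.
  move=> v vq; case: Kz0 => y0 yz Ky; rewrite -yz in qz0.
  exact: (touch y0 y0 q0 q0).
have KE : K `&` E true = K.
  apply: cK.
  - case: Kz0 => y0 yz Ky; exists (proj_surface y0); split=> //.
    by exists q0 => //; exists y0 => //; rewrite yz.
  - exists (~` E false); first by rewrite openC.
    apply/seteqP; split=> s [Ks Es]; split=> //.
      case: Es => q [_ /(_ isT) gq] [y1 qy1 y1s] [q' [ngq _] [y2 qy2 y2s]].
      suff // : good q' by move/ngq.
      move=> v vq'; have [u uq] := tile_nodes_neq0 q.
      apply: sconnect_trans (gq u uq) _; apply: (touch y1 y2 q q') => //.
        by rewrite y1s.
      by rewrite y1s y2s.
    have [y1 y1s] := proj_surface_surj s.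
    have [q qy] := @tile_cover R h c n _ (@holed_val R h c y1).
    exists q; last by exists y1.
    split=> // _; apply: contrapT => ngq; apply: Es; exists q; last by exists y1.
    by split.
  - by exists (E true).
case: Kz1 => y1 yz1 Ky1.
have : (K `&` E true) (proj_surface y1) by rewrite KE.
case=> _ [q [_ /(_ isT) gq] [y2 qy2 y21]].
have [u uq] := tile_nodes_neq0 q.
apply: sconnect_trans (gq u uq) _; apply: (touch y2 y1 q q1) => //; first by rewrite y21.
by rewrite yz1.
Qed.

End Trace.

(** * Stars and middle thirds of an embedded graph *)

Section Embedding.
Local Open Scope classical_set_scope.
Local Open Scope ring_scope.
Variables (R : realType) (h c : nat) (T : finType) (e : rel T).
Local Notation H := (2 * h + c)%N.
Local Notation S := (surface R h c).
Variables (pos : T -> S) (arc : T -> T -> R -> S).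
Hypothesis pos_inj : injective pos.
Hypothesis arcP : forall u v, e u v ->
        [/\ {within `[0, 1], continuous (arc u v)},
            {in `[0, 1] &, injective (arc u v)},
            arc u v 0 = pos u & arc u v 1 = pos v].
Hypothesis arc_rev : forall u v, e u v -> {in `[0, 1], forall t, arc v u t = arc u v (1 - t)}.
Hypothesis arc_pos : forall u v w, e u v -> {in `]0, 1[, forall t, arc u v t <> pos w}.
Hypothesis arc_disj : forall u v x y, e u v -> e x y -> (u, v) <> (x, y) -> (u, v) <> (y, x) ->
        {in `]0, 1[ &, forall s t, arc u v s <> arc x y t}.

Definition arc_part (u v : T) (a b : R) : set S := arc u v @` `[a, b].

Lemma arc_part_compact u v a b : e u v -> 0 <= a -> b <= 1 -> compact (arc_part u v a b).
Proof.
move=> /arcP[cuv _ _ _] a0 b1; apply: continuous_compact; last exact: segment_compact.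
by apply: continuous_subspaceW cuv; apply: subset_itv; rewrite bnd_simp.
Qed.

Lemma arc_part_connected u v a b : e u v -> 0 <= a -> b <= 1 -> connected (arc_part u v a b).
Proof.
move=> /arcP[cuv _ _ _] a0 b1; apply: connected_continuous_connected; first exact: segment_connected.
by apply: continuous_subspaceW cuv; apply: subset_itv; rewrite bnd_simp.
Qed.

(* Stars of different vertices and middle thirds of different edges are disjoint
   compact connected sets. *)
Definition star (u : T) : set S :=
  \bigcup_(o in [set o : option T | if o is Some v then e u v else true])
    (if o is Some v then arc_part u v 0 (1 / 3) else [set pos u]).

Definition middle (u v : T) : set S := arc_part u v (1 / 3) (2 / 3).

Lemma star_compact u : compact (star u).
Proof.
rewrite /star -bigsetU_fset_set; last exact: finite_finset.
rewrite big_seq; apply: big_ind => [||o]; [exact: compact0|exact: compactU|].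
rewrite in_fset_set; last exact: finite_finset.
rewrite inE /=; case: o => [v uv|_]; last exact: compact_set1.
by apply: arc_part_compact => //; lra.
Qed.

Lemma star_connected u : connected (star u).
Proof.
apply: bigcup_connected.
  exists (pos u) => -[v /= uv|] //; exists 0; first by rewrite /= in_itv /=; lra.
  by case: (arcP uv).
case=> [v /= uv|_]; last exact: connected1.
by apply: arc_part_connected => //; lra.
Qed.

Lemma starE u s : star u s -> s = pos u \/ exists v t, [/\ e u v, 0 < t <= 1 / 3 & s = arc u v t].
Proof.
case=> -[v /= uv|_ ->]; last by left.
case=> t /=; rewrite in_itv /= => /andP[t0 t1] <-.
move: t0; rewrite le_eqVlt => /orP[/eqP <-|t0]; first by left; case: (arcP uv).
by right; exists v, t; rewrite t0.
Qed.

Lemma star_disjoint u v : u <> v -> star u `&` star v = set0.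
Proof.
move=> uv; apply/seteqP; split=> // s [].
move=> /starE[->|[x [t [ux /andP[t0 t1] ->]]]] /starE[|[y [t' [vy /andP[t'0 t'1]]]]].
- by move/pos_inj.
- by move/esym; apply: arc_pos => //; rewrite in_itv /=; lra.
- by apply: arc_pos => //; rewrite in_itv /=; lra.
(* Only the two parametrisations of one edge can share inner points; there [t = 1 - t'], but both
   are at most [1 / 3]. *)
have [E|ne] := pselect ((u, x) = (y, v)).
  case: E => uy xv; subst y x; rewrite (arc_rev ux) ?in_itv /=; last by lra.
  case: (arcP ux) => _ inj _ _ E; have tE : t = 1 - t'.
    by apply: (inj t (1 - t') _ _ E); rewrite in_itv /=; lra.
  by clear uv; lra.
by apply: arc_disj => //; [case|rewrite in_itv /=; lra|rewrite in_itv /=; lra].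
Qed.

Lemma middleE u v s : middle u v s -> exists t, 1 / 3 <= t <= 2 / 3 /\ s = arc u v t.
Proof. by case=> t /=; rewrite in_itv /= => t1 <-; exists t. Qed.

Lemma middle_disjoint u v x y : e u v -> e x y -> (u, v) <> (x, y) -> (u, v) <> (y, x) ->
  middle u v `&` middle x y = set0.
Proof.
move=> uv xy n1 n2; apply/seteqP; split=> // s [].
move=> /middleE[t [t1 ->]] /middleE[t' [t'1]].
by apply: arc_disj => //; rewrite in_itv /=; lra.
Qed.

Lemma middle_star_disjoint u v x : e u v -> x <> u -> x <> v -> middle u v `&` star x = set0.
Proof.
move=> uv xu xv; apply/seteqP; split=> // s [].
move=> /middleE[t [t1 ->]] /starE[|[y [t' [xy t'1]]]].
  by apply: arc_pos => //; rewrite in_itv /=; lra.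
by apply: arc_disj => //; try (by case => *; subst); rewrite in_itv /=; lra.
Qed.

(** A finite index type for all stars and middles, so that one resolution serves every pair. *)
Definition piece (i : T + T * T) : set S :=
  match i with inl u => star u | inr (u, v) => if e u v then middle u v else set0 end.

Lemma piece_closed i : closed (preim_surface (piece i)).
Proof.
apply: compact_preim_closed; case: i => [u|[u v]] /=; first exact: star_compact.
case: ifP => [uv|_]; last exact: compact0.
by apply: arc_part_compact => //; lra.
Qed.

Lemma fine_resolution : exists n (n_large : (3 * H + 3 <= n)%N),
  forall i j, piece i `&` piece j = set0 ->
    forall x, x \in trace n (piece i) -> x \notin trace n (piece j).
Proof.
pose fine (n : nat) (ij : (T + T * T) * (T + T * T)) := piece ij.1 `&` piece ij.2 = set0 ->
    forall (q1 q2 : option (square n)) x, x \in tile_nodes q1 -> x \in tile_nodes q2 ->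
    forall z1 z2, preim_surface (piece ij.1) z1 -> preim_surface (piece ij.2) z2 ->
      tile h c q1 z1 -> tile h c q2 z2 -> False.
have ev ij : \forall n \near \oo, fine n ij.
  have [d|nd] := pselect (piece ij.1 `&` piece ij.2 = set0); last by apply: nearW => n /nd.
  have dis : preim_surface (piece ij.1) `&` preim_surface (piece ij.2) = set0.
    apply/seteqP; split=> // z [[y1 <- K1] [y2 /val_inj E K2]].
    by rewrite E in K2; have : (piece ij.1 `&` piece ij.2) (proj_surface y1) by []; rewrite d.
  have := @mesh_disjoint R h c _ _ (piece_closed (i := ij.1)) (piece_closed (i := ij.2)) dis.
  by apply: filterS => n Hn _.
have [n [n_large Hn]] : exists n, (3 * H + 3 <= n)%N /\ forall ij, fine n ij.
  near \oo => n; exists n; split; first by near: n; exact: nbhs_infty_ge.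
  by near: n; apply: filter_forall => ij; exact: ev.
exists n, n_large => i j dij x /traceP[q1 [z1 [x1 Kz1 qz1]]]; apply/negP => /traceP[q2 [z2 [x2 Kz2 qz2]]].
exact: (Hn (i, j) dij q1 q2 x x1 x2 z1 z2).
Unshelve. all: by end_near. Qed.

End Embedding.

Section EdgeBound.
Local Open Scope classical_set_scope.
Local Open Scope ring_scope.

Lemma embedding_edge_bound (R : realType) (h c : nat) (T : finType) (e : rel T) :
  symmetric e -> irreflexive e -> girth_at_least 9 e -> embeds_in R e (surface R h c) ->
  (7 * #|[set p : T * T | e p.1 p.2]%SET| <= 18 * (#|T| + (2 * (2 * h + c) + 2)))%N.
Proof.
move=> e_sym e_irr girth [pos [arc [pos_inj arcP arc_rev arc_pos arc_disj]]].
have [n [nl fine]] := @fine_resolution R h c T e pos arc arcP.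
pose pc := @piece R h c T e pos arc.
have starpos u : star e pos arc u (pos u) by exists None.
have third : [/\ 0 < 1 / 3 :> R, 1 / 3 <= 2 / 3 :> R & 2 / 3 < 1 :> R] by split; lra.
case: third => t1 t2 t3.
have midl u v : e u v -> middle arc u v (arc u v (1 / 3)).
  by move=> uv; exists (1 / 3) => //=; rewrite in_itv /= lexx.
have midr u v : e u v -> middle arc u v (arc u v (2 / 3)).
  by move=> uv; exists (2 / 3) => //=; rewrite in_itv /= lexx andbT.
have starl u v : e u v -> star e pos arc u (arc u v (1 / 3)).
  by move=> uv; exists (Some v) => //; exists (1 / 3) => //=; rewrite in_itv /= lexx (ltW t1).
have starr u v : e u v -> star e pos arc v (arc u v (2 / 3)).
  move=> uv; have -> : arc u v (2 / 3) = arc v u (1 / 3).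
    have vu : e v u by rewrite e_sym.
    rewrite (arc_rev _ _ vu) ?in_itv /=; last by apply/andP; split; lra.
    by congr (arc v u); field.
  by apply: starl; rewrite e_sym.
have pcM u v : e u v -> pc (inr (u, v)) = middle arc u v by move=> uv; rewrite /pc /= uv.
have [] := @branch_sets (snode n) T (@sadj h c n nl) e (@sadj_sym h c n nl) e_sym e_irr
  (fun u => trace n (pc (inl u))) (fun u v => trace n (pc (inr (u, v)))).
- by move=> u; apply: (@trace_neq0 R h c n nl _ (pos u)); exact: starpos.
- by move=> u; apply: (@trace_connected R h c n nl); exact: star_connected.
- move=> u v x /eqP uv; apply: fine; exact: star_disjoint.
- move=> u v uv; rewrite pcM //; apply: (@trace_connected R h c n nl).
  by apply: (arc_part_connected arcP uv); lra.
- move=> u v uv; rewrite pcM //.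
  by apply: (@trace_common R h c n nl _ _ (arc u v (1 / 3))); [exact: midl|exact: starl].
- move=> u v uv; rewrite pcM //.
  by apply: (@trace_common R h c n nl _ _ (arc u v (2 / 3))); [exact: midr|exact: starr].
- move=> u v w x uv /eqP wu /eqP wv; apply: fine; rewrite -/pc pcM //.
  exact: middle_star_disjoint.
- move=> u v u' v' x uv u'v' /eqP n1 /eqP n2; apply: fine; rewrite -/pc !pcM //.
  exact: (middle_disjoint arc_disj uv u'v' n1 n2).
move=> Bl [B0 Bc Bd Be]; apply: (@surface_grid_edge_bound h c n nl T e Bl) => //.
by move=> u; apply/set0Pn; exact: B0.
Qed.

End EdgeBound.

(** * Islands *)

Lemma card_bigcup_le (I T : finType) (P : pred I) (F : I -> {set T}) :
  #|\bigcup_(i | P i) F i| <= \sum_(i | P i) #|F i|.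
Proof.
apply: (big_ind2 (fun (A : {set T}) n => #|A| <= n)); first by rewrite cards0.
  by move=> A n B m nA mB; apply: leq_trans (leq_add nA mB); rewrite cardsU leq_subr.
by [].
Qed.

(** * Absorbed pairs and the growth of their number *)

Section Messages.
Variables (T : finType) (e : rel T) (Mk U : {set T}) (D : nat).
Hypotheses (e_sym : symmetric e) (e_irr : irreflexive e).

Definition nbrs x : {set T} := [set y in U | e x y].
Definition load x : nat := #|nbrs x| + (x \in Mk).

(* [absorbs i x y]: once [y] is in an island, the island can be completed on the
   side of [x], seen from [y], within distance [i] and through vertices of load
   at most [D].  If no vertex is ready to be the root of an island, the number
   of absorbed pairs grows linearly with [i]. *)
Fixpoint absorbs i x y : bool :=
  if i is i'.+1 then
    (load x <= D) && (load x <= #|[set z in nbrs x :\ y | absorbs i' z x]| + 2)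
  else false.

Fixpoint absorbed i x y : {set T} :=
  if i is i'.+1 then
    x |: \bigcup_(z in [set z in nbrs x :\ y | absorbs i' z x]) absorbed i' z x
  else finset.set0.

Fixpoint absorbed_bound i : nat := if i is i'.+1 then (D * absorbed_bound i').+1 else 0.

Lemma nbrs_sym x y : x \in U -> y \in nbrs x -> x \in nbrs y.
Proof. by rewrite !inE => xU /andP[_ xy]; rewrite xU e_sym. Qed.

Lemma absorbed_card i x y : load x <= D -> #|absorbed i x y| <= absorbed_bound i.
Proof.
elim: i x y => [|i IH] x y xD /=; first by rewrite cards0.
rewrite cardsU1; apply: (@leq_trans (1 + #|\bigcup_(z in [set z in nbrs x :\ y | absorbs i z x]) absorbed i z x|)).
  by rewrite leq_add2r leq_b1.
rewrite add1n ltnS; apply: leq_trans (card_bigcup_le _ _) _.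
apply: (@leq_trans (\sum_(z in [set z in nbrs x :\ y | absorbs i z x]) absorbed_bound i)).
  apply: leq_sum => z; rewrite inE => /andP[_ gz]; apply: IH.
  by case: (i) gz => //= j /andP[].
rewrite sum_nat_const leq_mul2r; apply/orP; right.
apply: leq_trans xD; apply: leq_trans (leq_addr _ _); apply: subset_leq_card.
by apply/fintype.subsetP => z; rewrite !inE => /andP[/and3P[_ -> ->]].
Qed.

Lemma absorbed_sub i x y : x \in U -> absorbed i x y \subset U.
Proof.
elim: i x y => [|i IH] x y xU /=; first exact: finset.sub0set.
rewrite finset.subUset finset.sub1set xU; apply/bigcupsP => z.
by rewrite !inE => /andP[/and3P[_ zU _] _]; exact: IH.
Qed.

(** The 2 in [absorbs] stands for the parent [y], which is in [X], and one neighbour or mark that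
    may remain outside. *)
Lemma absorbed_load i x y (X : {set T}) w : x \in U -> y \in nbrs x -> absorbs i x y ->
  absorbed i x y \subset X -> y \in X -> w \in absorbed i x y ->
  load w <= #|nbrs w :&: X| + 1.
Proof.
elim: i x y => [//|i IH] x y xU yx /= /andP[_ gx] sub yX.
have zX z : z \in [set z in nbrs x :\ y | absorbs i z x] -> absorbed i z x \subset X.
  by move=> zg; apply: fintype.subset_trans sub; apply/subsetU/orP; right;
    exact: (finset.bigcup_sup z (F := fun z => absorbed i z x) zg).
have xX : x \in X by apply: (fintype.subsetP sub); rewrite !inE eqxx.
rewrite in_setU1 => /orP[/eqP ->|/bigcupP[z zg wz]].
  apply: leq_trans gx _; rewrite addn2 addn1 ltnS.
  have -> : #|[set z in nbrs x :\ y | absorbs i z x]|.+1 =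
      #|y |: [set z in nbrs x :\ y | absorbs i z x]|.
    by rewrite cardsU1 !inE eqxx.
  apply: subset_leq_card; rewrite finset.subUset finset.sub1set inE yx yX /=.
  apply/fintype.subsetP => z zg; rewrite inE; move: (zg); rewrite !inE => /andP[/and3P[_ -> ->] gz] /=.
  apply: (fintype.subsetP (zX _ zg)).
  by case: (i) gz => //= j _; rewrite !inE eqxx.
move: (zg); rewrite inE => /andP[/setD1P[_ zx] gz].
have zU : z \in U by move: zx; rewrite inE => /andP[].
apply: (IH z x zU _ gz _ xX wz); first exact: nbrs_sym.
exact: zX.
Qed.

Definition incoming i x := [set z in nbrs x | absorbs i z x].
Definition outgoing i x := [set y in nbrs x | absorbs i x y].

Definition island (X : {set T}) :=
  [/\ X \subset U, X != finset.set0 & forall x, x \in X -> load x <= #|nbrs x :&: X| + 1].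

Lemma incoming_island i x : x \in U -> load x <= D -> load x <= #|incoming i x| + 1 ->
  exists X, island X /\ #|X| <= absorbed_bound i.+1.
Proof.
(* With [x] as its own parent no neighbour is excluded, since [e] is irreflexive. *)
move=> xU xD gx; exists (absorbed i.+1 x x); split; last exact: absorbed_card.
have nx : nbrs x :\ x = nbrs x.
  by apply/finset.setP => z; rewrite !inE; case: eqP => // ->; rewrite e_irr andbF.
have zX z : z \in incoming i x -> absorbed i z x \subset absorbed i.+1 x x.
  by move=> zg; rewrite /= nx; apply/subsetU/orP; right;
    exact: (finset.bigcup_sup z (F := fun z => absorbed i z x) zg).
have xX : x \in absorbed i.+1 x x by rewrite /= !inE eqxx.
split; [exact: absorbed_sub|by apply/set0Pn; exists x|] => w.
have XE : absorbed i.+1 x x = x |: \bigcup_(z in incoming i x) absorbed i z x by rewrite /= nx.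
rewrite {1}XE in_setU1 => /orP[/eqP ->|/bigcupP[z zg wz]].
  apply: leq_trans gx _; rewrite leq_add2r; apply: subset_leq_card.
  apply/fintype.subsetP => z zg; rewrite inE; move: (zg); rewrite inE => /andP[-> gz] /=.
  apply: (fintype.subsetP (zX _ zg)).
  by case: (i) gz => //= j _; rewrite !inE eqxx.
move: (zg); rewrite inE => /andP[zx gz].
have zU : z \in U by move: zx; rewrite inE => /andP[].
by apply: (absorbed_load zU (nbrs_sym xU zx) gz (zX z zg) xX wz).
Qed.

(** Either the load exceeds the incoming pairs by 3, or by exactly 2. In the latter case [x] is
    absorbed for every neighbour that is not incoming, and there is one, as the mark accounts for at
    most 1. *)
Lemma outgoing_gain i x : load x <= D -> #|incoming i x| + 2 <= load x ->
  #|incoming i x| + 3 <= #|outgoing i.+1 x| + load x.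
Proof.
move=> xD gx; have [lt|ge] := ltnP (#|incoming i x| + 2) (load x); first lia.
have E : load x = #|incoming i x| + 2 by lia.
have sub : nbrs x :\: incoming i x \subset outgoing i.+1 x.
  apply/fintype.subsetP => y; rewrite inE => /andP[yg yx]; rewrite inE yx /= xD /=.
  rewrite (_ : [set z in nbrs x :\ y | absorbs i z x] = incoming i x) ?E //.
  apply/finset.setP => z; rewrite !inE; case: eqP => [->|//] /=.
  by move: yg; rewrite inE yx /= => /negbTE ->; rewrite andbF.
have := subset_leq_card sub; rewrite cardsD.
have -> : nbrs x :&: incoming i x = incoming i x.
  by apply/finset.setIidPr/fintype.subsetP => y; rewrite inE => /andP[].
by move: E; rewrite /load; case: (x \in Mk) => /=; lia.
Qed.

Let traffic i := \sum_(x in U) #|incoming i x|.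

Lemma traffic_out i : traffic i = \sum_(x in U) #|outgoing i x|.
Proof.
have cardE (P : pred T) x : #|[set z in nbrs x | P z]| = \sum_(z in U) (e x z && P z).
  rewrite -sum1dep_card big_mkcond [RHS]big_mkcond /=; apply: eq_bigr => z _.
  by rewrite inE; case: (z \in U) => //=; case: (e x z) => //=; case: (P z).
rewrite /traffic; under eq_bigr do rewrite cardE.
rewrite exchange_big /=; apply: eq_bigr => z zU.
by rewrite cardE; apply: eq_bigr => x xU; rewrite e_sym.
Qed.

(** Absorbed pairs are counted by their first vertex in round [i.+1] and by their second in round
    [i], which lets [outgoing_gain] be summed over the light vertices. *)
Lemma traffic_growth i :
  (forall x, x \in U -> load x <= D -> #|incoming i x| + 2 <= load x) ->
  traffic i + 3 * #|[set x in U | load x <= D]| <= traffic i.+1 + \sum_(x in U) load x.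
Proof.
move=> noisl; rewrite [traffic i.+1]traffic_out /traffic -big_split /=.
have -> : 3 * #|[set x in U | load x <= D]| = \sum_(x in U) (if load x <= D then 3 else 0).
  rewrite mulnC -sum_nat_const -big_mkcondr /=; apply: eq_bigl => x; by rewrite inE.
rewrite -big_split /=; apply: leq_sum => x xU.
case: (leqP (load x) D) => xD; first exact: (outgoing_gain xD (noisl x xU xD)).
rewrite addn0; apply: leq_trans (leq_addl _ _); apply: leq_trans (leq_addr _ _).
by apply: subset_leq_card; apply/fintype.subsetP => y; rewrite inE => /andP[].
Qed.

Lemma traffic_lower r :
  (forall i x, i < r -> x \in U -> load x <= D -> #|incoming i x| + 2 <= load x) ->
  r * (3 * #|[set x in U | load x <= D]|) <= traffic r + r * \sum_(x in U) load x.
Proof.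
elim: r => [|r IH] noisl; first by rewrite mul0n.
have /IH{}IH : forall i x, i < r -> x \in U -> load x <= D -> #|incoming i x| + 2 <= load x.
  by move=> i x ir; apply: noisl; exact: ltnW.
have := @traffic_growth r (fun x => noisl r x (ltnSn r)); rewrite !mulSn; lia.
Qed.

Lemma traffic_upper i : traffic i <= \sum_(x in U) #|nbrs x|.
Proof.
apply: leq_sum => x _; apply: subset_leq_card.
by apply/fintype.subsetP => y; rewrite inE => /andP[].
Qed.

Lemma heavy_card : #|[set x in U | D < load x]| * D.+1 <= \sum_(x in U) load x.
Proof.
rewrite -sum_nat_const big_mkcond [X in _ <= X]big_mkcond /=; apply: leq_sum => x _.
by rewrite inE; case: (x \in U) => //=; case: ltnP.
Qed.

(** Without small islands every round adds at least three times the light vertices minus the total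
    load, while the pairs never outnumber the degree sum. An average load below 3 contradicts this
    for large [r]. *)
Lemma no_island_load r :
  (forall X, island X -> absorbed_bound r < #|X|) ->
  3 * r * #|U| <= \sum_(x in U) #|nbrs x| + r * (\sum_(x in U) load x)
    + 3 * r * #|[set x in U | D < load x]|.
Proof.
move=> noisl; have mono : {homo absorbed_bound : i j / i <= j}.
  move=> i j; elim: j i => [|j IH] [|i] //= ij; rewrite ltnS leq_mul2l.
  by apply/orP; right; exact: IH.
have := @traffic_lower r; have := traffic_upper r.
have -> : #|U| = #|[set x in U | load x <= D]| + #|[set x in U | D < load x]|.
  rewrite -(cardsID [set x | load x <= D] U); congr (_ + _); apply: eq_card => x.
    by rewrite !inE.
  by rewrite !inE ltnNge andbC.
move=> up low.
have H : forall i x, i < r -> x \in U -> load x <= D -> #|incoming i x| + 2 <= load x.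
  move=> i x ir xU xD; rewrite leqNgt; apply/negP => lt.
  have [|X [isl small]] := incoming_island (i := i) xU xD; first lia.
  by have := noisl X isl; rewrite ltnNge (leq_trans small) // mono.
have := low H; lia.
Qed.

End Messages.

(** * Sparsity forces bounded islands *)

Section BoundedIslands.
Variables (T : finType) (e : rel T) (Mk V : {set T}).
Hypotheses (e_sym : symmetric e) (e_irr : irreflexive e).
Hypothesis far : forall x y, x \in Mk -> y \in Mk -> x != y ->
  ~~ e x y /\ forall z, z \in V -> e x z -> ~~ e z y.

Lemma marked_neighbourhoods (U : {set T}) : U \subset V ->
  \sum_(x in U :&: Mk) (#|nbrs e U x| + 1) <= #|U|.
Proof.
move=> UV; apply: (@leq_trans (\sum_(y in U) #|[set x in U :&: Mk | (x == y) || e x y]|)).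
  have -> : \sum_(x in U :&: Mk) (#|nbrs e U x| + 1) =
      \sum_(x in U :&: Mk) \sum_(y in U) ((x == y) || e x y).
    apply: eq_bigr => x /setIP[xU _]; rewrite addn1 (bigD1 x) //= eqxx add1n; congr _.+1.
    rewrite -sum1dep_card big_mkcond [RHS]big_mkcond /=; apply: eq_bigr => y _.
    case: (y \in U) => //=; have [->|yx] := eqVneq y x; first by rewrite e_irr.
    by case: (e x y).
  rewrite exchange_big /=; apply: leq_sum => y yU.
  rewrite -sum1dep_card [X in _ <= X]big_mkcond [X in X <= _]big_mkcond /=.
  by apply: leq_sum => x _; case: (x \in _) => //=; case: (_ || _).
rewrite -sum1_card; apply: leq_sum => y yU.
apply/card_le1_eqP => x x'; rewrite !inE => /andP[/andP[xU xM] xy] /andP[/andP[x'U x'M] x'y].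
apply/eqP; apply: contraT => xx'; have [nxx' nz] := far x'M xM xx'.
have [yx|yx] := eqVneq x y; first by subst y; move: x'y; rewrite (negbTE xx') /= (negbTE nxx').
have [yx'|yx'] := eqVneq x' y.
  by subst y; move: xy; rewrite eq_sym (negbTE xx') /= e_sym (negbTE nxx').
move: xy x'y; rewrite (negbTE yx) (negbTE yx') /= => xy x'y.
by have := nz y (fintype.subsetP UV y yU) x'y; rewrite e_sym xy.
Qed.

(** A vertex of [P] carries at most one edge, and an edge contributes 2 to the degree sum. *)
Lemma degree_sum_remove (U P : {set T}) : P \subset U ->
  (forall x, x \in P -> #|nbrs e U x| <= 1) ->
  \sum_(x in U) #|nbrs e U x| <= \sum_(x in U :\: P) #|nbrs e (U :\: P) x| + 2 * #|P|.
Proof.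
move=> PU Pdeg; rewrite (big_setID P) /= (finset.setIidPr PU).
have s1 : \sum_(x in P) #|nbrs e U x| <= #|P| by rewrite -sum1_card; apply: leq_sum.
have s2 : \sum_(x in U :\: P) #|nbrs e U x| <=
    \sum_(x in U :\: P) #|nbrs e (U :\: P) x| + \sum_(x in U :\: P) \sum_(y in P) e x y.
  rewrite -big_split /=; apply: leq_sum => x _; rewrite -(cardsID P (nbrs e U x)) addnC.
  apply: leq_add.
    by apply: subset_leq_card; apply/fintype.subsetP => y; rewrite !inE => /and3P[-> -> ->].
  rewrite -sum1_card big_mkcond [X in _ <= X]big_mkcond /=; apply: leq_sum => y _.
  by rewrite !inE; case: (y \in P); rewrite ?andbT ?andbF //; case: (e x y); rewrite ?andbF ?leq_b1.
have s3 : \sum_(x in U :\: P) \sum_(y in P) e x y <= #|P|.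
  rewrite exchange_big /=; apply: leq_trans s1; apply: leq_sum => y yP.
  rewrite -sum1dep_card big_mkcond [X in _ <= X]big_mkcond /=; apply: leq_sum => x _.
  by rewrite !inE e_sym; case: (x \in P) => //=; case: (x \in U) => //=; case: (e y x).
lia.
Qed.

End BoundedIslands.

Definition sparse (T : finType) (e : rel T) (V : {set T}) (k : nat) :=
  forall U : {set T}, U \subset V -> 7 * \sum_(x in U) #|nbrs e U x| <= 18 * (#|U| + k).

(* Removing the marked vertices of degree at most 1 leaves [n'] vertices, at most
   [9/7 n'] edges and [n'/3] marks up to a constant, so the average load minus 3
   is at most [18/7 + 1/3 - 3 = - 2/21].  The constants 1800 and 60 let this gap
   absorb the heavy vertices and the number of pairs after 60 rounds. *)
Lemma bounded_island (k : nat) : exists b, forall (T : finType) (e : rel T) (Mk V : {set T}),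
  symmetric e -> irreflexive e ->
  (forall x y, x \in Mk -> y \in Mk -> x != y ->
    ~~ e x y /\ forall z, z \in V -> e x z -> ~~ e z y) ->
  sparse e V k ->
  forall U : {set T}, U \subset V -> U != finset.set0 ->
  exists X, island e Mk U X /\ #|X| <= b.
Proof.
have [D DE] : exists D, D = 1800 by eexists.
have [b0 b0E] : exists b0, b0 = absorbed_bound D 60 by eexists.
(* Without a small island the inequalities below force [#|U| <= 56 * k]; [130 * k] is safely beyond
   that. *)
exists (b0 + 130 * k + 1) => T e Mk V e_sym e_irr far sp U UV U0.
apply: contrapT => no.
have noisl X : island e Mk U X -> b0 + 130 * k + 1 < #|X|.
  by move=> isl; rewrite ltnNge; apply/negP => le; apply: no; exists X.
have loadU x : load e Mk U x <= #|nbrs e U x| + 1 by rewrite leq_add2l leq_b1.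
(* All of [U] is an island, its only outside allowance being the mark, so [U] must be large. *)
have big : b0 + 130 * k + 1 < #|U|.
  apply: noisl; split=> // x xU; rewrite (finset.setIidPl _) //.
  by apply/fintype.subsetP => y; rewrite inE => /andP[].
have load2 x : x \in U -> 2 <= load e Mk U x.
  move=> xU; rewrite ltnNge; apply/negP => le1.
  suff /noisl : island e Mk U [set x] by rewrite cards1; lia.
  split; [by rewrite finset.sub1set|by apply/set0Pn; exists x; rewrite inE|].
  by move=> y /set1P ->; apply: leq_trans le1 _; exact: leq_addl.
have low : 3 * 60 * #|U| <= \sum_(x in U) #|nbrs e U x| + 60 * (\sum_(x in U) load e Mk U x)
    + 3 * 60 * #|[set x in U | D < load e Mk U x]|.
  apply: no_island_load => // X /noisl; rewrite -b0E; lia.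
have heavy := heavy_card e Mk U D.
have loadE : \sum_(x in U) load e Mk U x = \sum_(x in U) #|nbrs e U x| + #|U :&: Mk|.
  rewrite big_split /=; congr (_ + _); rewrite -sum1_card big_mkcond [RHS]big_mkcond /=.
  by apply: eq_bigr => x _; rewrite inE; case: (x \in U) => //=; case: (x \in Mk).
pose P := [set x in U :&: Mk | #|nbrs e U x| <= 1].
have PU : P \subset U by apply/fintype.subsetP => x; rewrite !inE => /andP[/andP[]].
have Pdeg x : x \in P -> #|nbrs e U x| <= 1 by rewrite inE => /andP[].
have rem := degree_sum_remove e_sym PU Pdeg.
have sp' : 7 * \sum_(x in U :\: P) #|nbrs e (U :\: P) x| <= 18 * (#|U :\: P| + k).
  by apply: sp; apply: fintype.subset_trans UV; exact: finset.subsetDl.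
have cardU : #|U| = #|P| + #|U :\: P| by rewrite -(cardsID P U) (finset.setIidPr PU).
have PM : P \subset U :&: Mk by apply/fintype.subsetP => x; rewrite inE => /andP[].
have cardM : #|U :&: Mk| = #|P| + #|(U :&: Mk) :\: P|.
  by rewrite -(cardsID P (U :&: Mk)) (finset.setIidPr PM).
(* By [load2] marked vertices in [P] have degree 1 and the others at least 2, so their disjoint
   closed neighbourhoods have at least 2 and 3 vertices. *)
have nbhd : 2 * #|P| + 3 * #|(U :&: Mk) :\: P| <= #|U|.
  apply: leq_trans (marked_neighbourhoods e_sym e_irr far UV).
  rewrite (big_setID P) /= (finset.setIidPr PM) mulnC [3 * _]mulnC -!sum_nat_const.
  apply: leq_add; apply: leq_sum => x.
    rewrite !inE => /andP[/andP[xU xM] _]; have := load2 x xU; rewrite /load xM; lia.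
  rewrite !inE => /andP[xP /andP[xU xM]].
  by move: xP; rewrite xU xM /= -ltnNge; lia.
move: low heavy; rewrite loadE DE.
move: (\sum_(x in U) #|nbrs e U x|) (\sum_(x in U :\: P) _) rem sp' => M M' rem sp'.
move: #|[set x in U | 1800 < load e Mk U x]| => hv low heavy.
clear - big rem sp' cardU cardM nbhd low heavy.
move: #|U| #|U :&: Mk| #|P| #|U :\: P| #|(U :&: Mk) :\: P| b0 big rem sp' cardU cardM nbhd low heavy.
move=> n mu p n' mu2 b0 *; lia.
Qed.

(** * Colouring by successive removal of islands *)

Section IslandColouring.
Variables (T : finType) (e : rel T) (Mk V : {set T}) (b : nat).
Hypothesis e_sym : symmetric e.
Hypothesis islands : forall U : {set T}, U \subset V -> U != finset.set0 ->
  exists X, island e Mk U X /\ #|X| <= b.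

Definition mono (U : {set T}) (col : T -> bool) : rel T :=
  fun x y => [&& x \in U, y \in U, col x == col y & e x y].

Lemma mono_sym U col : symmetric (mono U col).
Proof. by move=> x y; rewrite /mono andbCA e_sym [col y == _]eq_sym. Qed.

Lemma island_colouring (U : {set T}) : U \subset V -> exists col : T -> bool,
  (forall x, x \in U :&: Mk -> col x) /\
  (forall x, x \in U -> #|connect (mono U col) x| <= b).
Proof.
have [m] := ubnP #|U|; elim: m U => // m IH U; rewrite ltnS => Um UV.
have [->|U0] := eqVneq U finset.set0.
  by exists xpredT; split=> // x; rewrite inE.
have [X [[XU X0 Xload] Xb]] := islands UV U0.
have UXm : #|U :\: X| < m.
  apply: leq_trans Um; rewrite cardsD (finset.setIidPr XU) -subn_gt0 subKn ?subset_leq_card //.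
  by rewrite card_gt0.
have [col' [colM colb]] := IH _ UXm (fintype.subset_trans (finset.subsetDl U X) UV).
pose out x := [set z in U :\: X | e x z].
pose col x := if x \in X then
    (if x \in Mk then true else if [pick z in out x] is Some z then ~~ col' z else true)
  else col' x.
have outX x : x \in X -> #|out x| + (x \in Mk) <= 1.
  move=> xX; have := Xload x xX; rewrite /load.
  have -> : #|nbrs e U x| = #|nbrs e U x :&: X| + #|out x|.
    rewrite -(cardsID X (nbrs e U x)); congr (_ + _); apply: eq_card => z.
    by rewrite !inE andbA.
  lia.
(* An outside neighbour uses up the allowance of [outX]: [x] is unmarked and [z] is the vertex
   picked by [col]. *)
have sep x z : x \in X -> z \in U :\: X -> e x z -> col x != col z.
  move=> xX zUX xz; have zo : z \in out x by rewrite inE zUX.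
  have o1 : 0 < #|out x| by apply/card_gt0P; exists z.
  have xM : x \notin Mk by move: (outX x xX); case: (x \in Mk) => //; lia.
  have zX : z \notin X by move: zUX; rewrite inE => /andP[].
  rewrite /col xX (negbTE xM) (negbTE zX); case: pickP => [z' z'o|/(_ z)]; last by rewrite zo.
  have le1 : #|out x| <= 1 by apply: leq_trans (outX x xX); exact: leq_addr.
  by rewrite (card_le1_eqP le1 z' z z'o zo); case: (col' _).
have closedX x y : x \in X -> connect (mono U col) x y -> y \in X.
  move=> xX /connectP[p pp ->]; elim: p x xX pp => [|z p IHp] x xX //= /andP[/and4P[_ zU cxz xz] pp].
  apply: IHp pp; apply: contraT => zX; have := sep x z xX _ xz.
  by rewrite inE zX zU (eqP cxz) eqxx => /(_ isT).
exists col; split=> [x|x xU].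
  rewrite inE => /andP[xU xM]; rewrite /col xM; case: ifP => // xX.
  by apply: colM; rewrite !inE xX xU.
have [xX|xX] := boolP (x \in X).
  apply: leq_trans Xb; apply: subset_leq_card; apply/fintype.subsetP => y.
  exact: closedX.
apply: leq_trans (colb x _); last by rewrite inE xX xU.
apply: subset_leq_card; apply/fintype.subsetP => y /connectP[p pp yE]; rewrite {}yE.
apply/connectP; exists p => //.
elim: p x xU xX pp => [//|z p IHp] x xU xX /= /andP[xz pp]; move: (xz) => /and4P[_ zU cxz exz].
have zX : z \notin X.
  apply: contra xX => zX; apply: closedX zX _; apply: connect1.
  by rewrite mono_sym.
rewrite {}IHp // andbT /mono !inE xX zX xU zU exz andbT /=.
by move: cxz; rewrite andbT /col (negbTE xX) (negbTE zX).
Qed.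

End IslandColouring.

(** A simple path inside the walk [p] closes through [a] to a cycle with at most 8 vertices. *)
Lemma short_cycle (T : finType) (e : rel T) (a x x' : T) (p : seq T) :
  symmetric e -> girth_at_least 9 e -> e a x -> e a x' -> x != x' ->
  path e x p -> last x p = x' -> size p <= 6 -> a \notin x :: p -> False.
Proof.
move=> e_sym girth ax ax' xx' xp lastE sp ap.
case/shortenP: xp lastE => q xq uq qp lastE.
have sq : size q <= size p.
  by apply: uniq_leq_size; [case/andP: uq|move=> z; exact: qp].
have aq : a \notin x :: q.
  apply: contra ap; rewrite !inE => /orP[->//|/qp ->]; by rewrite orbT.
have := girth (a :: x :: q); rewrite /ucycle /= rcons_path ax xq lastE e_sym ax' /=.
have -> : (a \notin x :: q) && ((x \notin q) && uniq q) by rewrite aq.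
case: q lastE {xq uq qp aq} sq => [|z q] /= lastE sq; first by rewrite lastE eqxx in xx'.
by move=> /(_ isT isT); lia.
Qed.

Section Exceptional.
Variables (T : finType) (e : rel T) (A : {set T}).
Hypotheses (e_sym : symmetric e) (girth : girth_at_least 9 e).

Definition within_two x y := e x y || [exists z, (z \notin A) && (e x z && e z y)].

(* Vertices adjacent to [A] that are too close to another such vertex.  By the
   girth condition each pair in [A * A] accounts for at most one of them. *)
Definition exceptional : {set T} := [set x | (x \notin A) &&
  [exists p : T * T, [&& p.1 \in A, p.2 \in A, e p.1 x &
    [exists y, [&& y \notin A, y != x, e p.2 y & within_two x y]]]]].

Lemma within_two_path x y : x \notin A -> y \notin A -> within_two x y ->
  exists p, [/\ path e x p, last x p = y, size p <= 2 & {in x :: p, forall z, z \notin A}].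
Proof.
move=> xA yA /orP[xy|/existsP[z /and3P[zA xz zy]]].
  exists [:: y]; rewrite /= xy; split=> // z; rewrite !inE => /orP[] /eqP -> //.
exists [:: z; y]; rewrite /= xz zy; split=> // w; rewrite !inE => /or3P[] /eqP -> //.
Qed.

(** Distinct [x] and [x'] would be joined by a walk through [y], [p.2] and [y'] of at most 2 + 2 + 2
    edges that avoids [p.1]. If [p.1 = p.2], the part from [x] to [y] already closes a short
    cycle. *)
Lemma exceptional_unique x x' (p : T * T) :
  x \notin A -> x' \notin A -> p.1 \in A -> p.2 \in A -> e p.1 x -> e p.1 x' ->
  [exists y, [&& y \notin A, y != x, e p.2 y & within_two x y]] ->
  [exists y, [&& y \notin A, y != x', e p.2 y & within_two x' y]] -> x = x'.
Proof.
case: p => a a' /= xA x'A aA a'A ax ax' /existsP[y /and4P[yA yx a'y xy]] /existsP[y' /and4P[y'A y'x' a'y' x'y']].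
apply/eqP; apply: contraT => xx'; exfalso.
have [p [xp lastp sp pA]] := within_two_path xA yA xy.
have [p' [x'p' lastp' sp' p'A]] := within_two_path x'A y'A x'y'.
have notin q z : {in z :: q, forall w, w \notin A} -> a \notin z :: q.
  by move=> H; apply: contraL aA; exact: H.
have [aa'|aa'] := eqVneq a a'.
  subst a'; apply: (@short_cycle _ e a x y p) => //.
  - by rewrite eq_sym.
  - by apply: leq_trans sp _.
  - exact: notin.
have rp' : path e y' (rev (belast x' p')).
  rewrite -lastp' rev_path; apply: sub_path x'p' => u v; by rewrite e_sym.
have lastr : last y' (rev (belast x' p')) = x'.
  case: p' lastp' {x'p' sp' p'A rp'} => [|z p'] /= lastp'; first by rewrite lastp'.
  by rewrite rev_cons last_rcons.
apply: (@short_cycle _ e a x x' (p ++ [:: a', y' & rev (belast x' p')])) => //.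
- by rewrite cat_path xp lastp /= e_sym a'y a'y' rp'.
- by rewrite last_cat /= lastr.
- by rewrite size_cat /= size_rev size_belast; apply: (leq_add sp (_ : _ <= 4)); rewrite !ltnS.
- have := notin p x pA; rewrite !inE mem_cat !inE !negb_or mem_rev => /andP[-> ->] /=.
  rewrite aa' /=; apply/andP; split; first by apply: contraNneq y'A => <-.
  by apply: contra (notin p' x' p'A); exact: mem_belast.
Qed.

End Exceptional.

Section Apex.
Variables (T : finType) (e : rel T) (A : {set T}).
Hypotheses (e_sym : symmetric e) (girth : girth_at_least 9 e).

Lemma card_exceptional : #|exceptional e A| <= #|A| * #|A|.
Proof.
pose F (p : T * T) : {set T} := [set x | [&& x \notin A, e p.1 x &
    [exists y, [&& y \notin A, y != x, e p.2 y & within_two e A x y]]]].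
apply: (@leq_trans #|\bigcup_(p in finset.setX A A) F p|).
  apply: subset_leq_card; apply/fintype.subsetP => x; rewrite inE => /andP[xA /existsP[p /and4P[p1 p2 px H]]].
  by apply/bigcupP; exists p; rewrite !inE ?p1 ?p2 // xA px.
apply: leq_trans (card_bigcup_le _ _) _; rewrite -cardsX -sum1_card.
apply: leq_sum => p; rewrite inE => /andP[p1 p2].
apply/card_le1_eqP => x x'; rewrite !inE => /and3P[xA px H] /and3P[x'A px' H'].
by apply: esym; apply: (exceptional_unique e_sym girth xA x'A p1 p2).
Qed.

Definition marked : {set T} :=
  [set x | (x \notin A) && [exists a, (a \in A) && e a x]] :\: exceptional e A.

Lemma marked_far x y : x \in marked -> y \in marked -> x != y ->
  ~~ e x y /\ forall z, z \in ~: A -> e x z -> ~~ e z y.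
Proof.
move=> /setDP[]; rewrite inE => /andP[xA /existsP[a /andP[aA ax]]] xE.
move=> /setDP[]; rewrite inE => /andP[yA /existsP[a' /andP[a'A a'y]]] _ xy.
have nclose : ~~ within_two e A x y.
  apply: contra xE => cxy; rewrite inE xA; apply/existsP; exists (a, a').
  by rewrite /= aA a'A ax; apply/existsP; exists y; rewrite yA eq_sym xy a'y.
split; first by apply: contra nclose => xy'; rewrite /within_two xy'.
move=> z; rewrite inE => zA xz; apply: contra nclose => zy.
by apply/orP; right; apply/existsP; exists z; rewrite zA xz.
Qed.

(** A monochromatic component can leave [A] only into exceptional vertices, so it lies in [A], the
    components outside [A] of these at most [#|A| * #|A|] vertices, and that of its starting
    point. *)
Lemma apex_clustering (b : nat) :
  (forall U : {set T}, U \subset ~: A -> U != finset.set0 ->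
    exists X, island e marked U X /\ #|X| <= b) ->
  colourable_with_clustering 2 (#|A| + (#|A| * #|A| + 1) * b) e.
Proof.
move=> isl; have [colU [colM colb]] := island_colouring e_sym isl (fintype.subxx (~: A)).
pose col (v : T) : 'I_2 := if v \in A then ord0 else if colU v then ord_max else ord0.
exists col => i x.
pose Y := (val x |: exceptional e A) :\: A.
pose comp y : {set T} := [set z | connect (mono e (~: A) colU) y z].
pose W := A :|: \bigcup_(y in Y) comp y.
have cardW : #|W| <= #|A| + (#|A| * #|A| + 1) * b.
  apply: leq_trans (leq_card_setU _ _) _; rewrite leq_add2l.
  apply: leq_trans (card_bigcup_le _ _) _.
  apply: (@leq_trans (\sum_(y in Y) b)).
    apply: leq_sum => y; rewrite inE => /andP[yA _]; rewrite cardsE.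
    by apply: colb; rewrite inE.
  rewrite sum_nat_const leq_mul2r; apply/orP; right.
  apply: leq_trans (subset_leq_card (finset.subsetDl _ _)) _.
  by rewrite cardsU1 addnC; apply: leq_add; [exact: card_exceptional|exact: leq_b1].
have step z z' : val z \in W -> Defs.induced e (fun v => col v == i) z z' -> val z' \in W.
  move=> zW zz'; have [z'A|z'A] := boolP (val z' \in A); first by rewrite inE z'A.
  apply/setUP; right; apply/bigcupP.
  have colz : col (val z) = col (val z') by rewrite (eqP (valP z)) (eqP (valP z')).
  have [zA|zA] := boolP (val z \in A).
    exists (val z'); last by rewrite inE connect0.
    (* A neighbour of [A] that is not exceptional is marked, and its forced colour differs from that
       of [A]. *)
    rewrite finset.in_setD z'A finset.in_setU1 /=; apply/orP; right; apply: contraT => nex.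
    have zM : val z' \in ~: A :&: marked.
      apply/setIP; split; first by rewrite finset.in_setC.
      apply/setDP; split=> //; rewrite inE z'A; apply/existsP; exists (val z); rewrite zA.
      exact: zz'.
    by move: colz; rewrite /col zA (negbTE z'A) (colM _ zM).
  case/setUP: zW => [zA'|/bigcupP[y yY zy]]; first by rewrite zA' in zA.
  exists y => //; move: zy; rewrite !inE => zy; apply: connect_trans zy _; apply: connect1.
  rewrite /mono !inE zA z'A /=; apply/andP; split=> //.
  move: colz; rewrite /col (negbTE zA) (negbTE z'A).
  by case: (colU _); case: (colU _).
have xW : val x \in W.
  have [xA|xA] := boolP (val x \in A); first by rewrite inE xA.
  apply/setUP; right; apply/bigcupP; exists (val x); last by rewrite inE connect0.
  by rewrite !inE xA eqxx.
have inW z : connect (Defs.induced e (fun v => col v == i)) x z -> val z \in W.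
  case/connectP => p pp ->; elim: p (x) xW pp => [//|z' p IH] y yW /= /andP[yz' pp].
  by apply: IH pp; exact: step yz'.
apply: leq_trans cardW; rewrite -(card_imset _ val_inj).
apply: subset_leq_card; apply/fintype.subsetP => _ /imsetP[z zx ->]; exact: inW.
Qed.

End Apex.

Section Main.
Local Open Scope ring_scope.
Local Open Scope classical_set_scope.

Lemma embeds_in_sub (R : realType) (T T' : finType) (e : rel T) (e' : rel T') (f : T' -> T)
    (S : topologicalType) : injective f -> (forall x y, e' x y -> e (f x) (f y)) ->
  embeds_in R e S -> embeds_in R e' S.
Proof.
move=> f_inj fe [pos [arc [p1 p2 p3 p4 p5]]].
exists (pos \o f), (fun x y => arc (f x) (f y)); split.
- exact: inj_comp.
- by move=> u v /fe; exact: p2.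
- by move=> u v /fe; exact: p3.
- by move=> u v w /fe uv; exact: p4.
- move=> u v x y /fe uv /fe xy n1 n2; apply: p5 => //.
    by case=> /f_inj ux /f_inj vy; apply: n1; rewrite ux vy.
  by case=> /f_inj ux /f_inj vy; apply: n2; rewrite ux vy.
Qed.

(** The subgraph induced by any [U] outside [A] inherits the embedding and the girth, so the edge
    bound applies to it. *)
Lemma embedded_sparse (R : realType) (h c g : nat) (T : finType) (e : rel T) (A : {set T}) :
  symmetric e -> irreflexive e -> girth_at_least 9 e -> (2 * h + c <= g)%N ->
  embeds_in R (Defs.induced e (fun x => x \notin A)) (surface R h c) ->
  sparse e (finset.setC A) (2 * g + 2).
Proof.
move=> e_sym e_irr girth hcg emb U UA.
have UA' (x : {x : T | x \in U}) : val x \notin A.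
  by have := fintype.subsetP UA _ (valP x); rewrite inE.
pose e' : rel {x : T | x \in U} := fun x y => e (val x) (val y).
have girth' : girth_at_least 9 e'.
  move=> s /andP[cs us] s3; rewrite -(size_map val); apply: girth; last by rewrite size_map.
  rewrite /ucycle (map_inj_uniq val_inj) us andbT.
  by case: s cs {us s3} => //= x s; rewrite -map_rcons path_map.
have emb' : embeds_in R e' (surface R h c).
  apply: (embeds_in_sub (f := fun x : {x : T | x \in U} => Sub (val x) (UA' x)) _ _ emb) => //.
  by move=> x y /(congr1 val); rewrite !SubK => /val_inj.
have e'_sym : symmetric e' by move=> x y; exact: e_sym.
have e'_irr : irreflexive e' by move=> x; exact: e_irr.
have := embedding_edge_bound e'_sym e'_irr girth' emb'; rewrite card_sig => bound.
apply: (@leq_trans (7 * #|[set p : {x : T | x \in U} * {x : T | x \in U} | e' p.1 p.2]%SET|)).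
  rewrite leq_mul2l /=; pose v (p : {x : T | x \in U} * {x : T | x \in U}) := (val p.1, val p.2).
  apply: leq_trans (leq_imset_card v _).
  have -> : (\sum_(x in U) #|nbrs e U x|)%N = #|[set p : T * T | [&& p.1 \in U, p.2 \in U & e p.1 p.2]]%SET|.
    rewrite -sum1dep_card -(pair_big_dep (mem U) (fun x y => (y \in U) && e x y) (fun _ _ => 1%N)) /=.
    by apply: eq_bigr => x _; rewrite -sum1dep_card.
  apply: subset_leq_card; apply/fintype.subsetP => -[x y]; rewrite inE /= => /and3P[xU yU xy].
  by apply/imsetP; exists (Sub x xU, Sub y yU) => //; rewrite inE.
apply: leq_trans bound _; rewrite leq_mul2l /= leq_add //.
by rewrite leq_add2r leq_mul2l.
Qed.

End Main.

Theorem theorem22 (R : realType) :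
  exists f : nat -> nat -> nat,
    forall (gamma k : nat) (T : finType) (e : rel T),
      symmetric e -> irreflexive e ->
      apex_graph R gamma k e ->
      girth_at_least 9 e ->
      colourable_with_clustering 2 (f gamma k) e.
Proof.
have /choice[b bP] := bounded_island.
(* [2 * gamma + 2] is the number of classes of a grid on a surface of Euler genus [gamma]; the rest
   is the clustering bound with [#|A|] replaced by [k]. *)
exists (fun gamma k => k + (k * k + 1) * b (2 * gamma + 2)) => gamma k T e e_sym e_irr.
move=> [A [Ak [g [[[h [c [hcg emb]]] _] gle]]]] girth.
have sp : sparse e (finset.setC A) (2 * gamma + 2).
  by apply: (embedded_sparse e_sym e_irr girth _ emb); rewrite hcg.
have [col colP] := apex_clustering e_sym girth
  (bP _ T e (marked e A) (finset.setC A) e_sym e_irr (@marked_far T e A) sp).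
exists col => i x; apply: leq_trans (colP i x) _.
by apply: leq_add => //; rewrite leq_mul2r leq_add2r leq_mul ?orbT.
Qed.
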